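(* Let $1\leq p<\infty$ with $p\neq 2$. Then the Hardy space $H_p$ contains no $1$-complemented subspace of finite dimension larger than one; that is, there is no linear subspace $Y\subset H_p$ with $1<\dim Y<\infty$ that is $1$-complemented in $H_p$.
   Context: $\mathbb{T}$ denotes the unit circle in $\mathbb{C}$ with Lebesgue (arc length) measure, and all spaces are over the complex scalars. For $1\le p<\infty$, $H_p=H_p(\mathbb{T})$ is the closed subspace of $L_p(\mathbb{T})$, with the $L_p$ norm, given by $$H_p(\mathbb{T})=\Big\{f\in L_p(\mathbb{T}) : \int_0^{2\pi} f(e^{i\theta})e^{in\theta}\,d\theta=0 \text{ for all integers } n\ge 1\Big\}$$ (equivalently, the boundary values of functions in the Hardy space $H_p$ of the unit disk). A closed linear subspace $Y$ of a Banach space $X$ is called $1$-complemented in $X$ if it is the range of a bounded linear projection $P:X\to X$ ($P^2=P$) with $\|P\|\le 1$. *)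

(* Defs.v *)
From HB Require Import structures.
From mathcomp Require Import all_boot all_order all_algebra.

From mathcomp Require Import all_classical all_reals all_analysis.
From mathcomp Require Import measurable_realfun.
From mathcomp Require Import complex.

Set Implicit Arguments.
Unset Strict Implicit.
Unset Printing Implicit Defensive.

Import Order.TTheory GRing.Theory Num.Theory.
Import numFieldNormedType.Exports.
Import Normc.

Local Open Scope classical_set_scope.
Local Open Scope ring_scope.
Local Open Scope quotient_scope.

(* Complex functions take values in R[i]^o, the alias of R[i] that carries its
   structure of module over itself. *)
Section ComplexFunctions.
Context d (T : measurableType d) (R : realType).
Variable mu : {measure set T -> \bar R}.
Implicit Types f g : T -> R[i]^o.

Definition cmeasurable f :=
  measurable_fun setT (fun x => complex.Re (f x)) /\
  measurable_fun setT (fun x => complex.Im (f x)).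

Definition cintegral f : R[i] :=
  ((\int[mu]_x complex.Re (f x))%R +i* (\int[mu]_x complex.Im (f x))%R)%C.

Definition cLnorm (p : R) f : \bar R := 'N[mu]_p%:E[EFin \o (fun x => normc (f x))]%E.

Lemma cmeasurableD f g : cmeasurable f -> cmeasurable g -> cmeasurable (f + g).
Proof.
move=> [f1 f2] [g1 g2]; split.
  have := measurable_funD f1 g1; congr measurable_fun; apply/funext => x /=.
  by rewrite fctE; case: (f x) (g x) => [? ?] [].
have := measurable_funD f2 g2; congr measurable_fun; apply/funext => x /=.
by rewrite fctE; case: (f x) (g x) => [? ?] [].
Qed.

Lemma cmeasurableM f g : cmeasurable f -> cmeasurable g -> cmeasurable (f \* g).
Proof.
move=> [f1 f2] [g1 g2]; split.
  have := measurable_funB (measurable_funM f1 g1) (measurable_funM f2 g2).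
  congr measurable_fun; apply/funext => x /=.
  by case: (f x) (g x) => [? ?] [].
have := measurable_funD (measurable_funM f1 g2) (measurable_funM f2 g1).
congr measurable_fun; apply/funext => x /=.
by case: (f x) (g x) => [? ?] [].
Qed.

Lemma cmeasurableZ (a : R[i]) f : cmeasurable f -> cmeasurable (a *: f).
Proof.
have ma : cmeasurable (cst a) by split; exact: measurable_cst.
by move=> mf; have := cmeasurableM ma mf.
Qed.

Lemma measurable_normc f :
  cmeasurable f -> measurable_fun setT (fun x => normc (f x)).
Proof.
move=> [f1 f2].
have := measurableT_comp (continuous_measurable_fun (@sqrt_continuous R))
  (measurable_funD (measurable_funX 2 f1) (measurable_funX 2 f2)).
congr measurable_fun; apply/funext => x /=.
by case: (f x) => a b.
Qed.

Lemma ler_normcD (a b : R[i]) : normc (a + b) <= normc a + normc b.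
Proof. by have := ler_normD a b; rewrite /Num.norm /= -rmorphD lecR. Qed.

Lemma normc_ge0 (a : R[i]) : 0 <= normc a.
Proof. by case: a => ? ?; exact: sqrtr_ge0. Qed.

Lemma cLnorm_ge0 p f : (0 <= cLnorm p f)%E.
Proof. exact: Lnorm_ge0. Qed.

Lemma ler_cLnormD p f g : 1 <= p -> cmeasurable f -> cmeasurable g ->
  (cLnorm p (f + g)%R <= cLnorm p f + cLnorm p g)%E.
Proof.
move=> p1 mf mg.
have p0 : 0 <= p by exact: le_trans p1.
have mnf := measurable_normc mf; have mng := measurable_normc mg.
have mnfg := measurable_normc (cmeasurableD mf mg).
apply: (le_trans _ (minkowski_EFin mu mnf mng p1)).
rewrite /cLnorm unlock; apply: gt0_ler_poweR; first by rewrite invr_ge0.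
- by rewrite in_itv/= leey andbT integral_ge0// => x _; exact: poweR_ge0.
- by rewrite in_itv/= leey andbT integral_ge0// => x _; exact: poweR_ge0.
apply: ge0_le_integral => //.
- by move=> x _; exact: poweR_ge0.
- apply: (measurableT_comp (measurable_poweR _)); apply: measurableT_comp => //.
  exact/measurable_EFinP.
- apply: (measurableT_comp (measurable_poweR _)); apply: measurableT_comp => //.
  by apply/measurable_EFinP; exact: measurable_funD.
- move=> x _; apply: gt0_ler_poweR => //=.
  + by rewrite in_itv/= lee_fin normr_ge0 leey.
  + by rewrite in_itv/= lee_fin normr_ge0 leey.
  rewrite lee_fin ger0_norm ?normc_ge0// ger0_norm ?addr_ge0 ?normc_ge0//.
  exact: ler_normcD.
Qed.

Lemma cLnormZ p f (a : R[i]) : 1 <= p -> cmeasurable f ->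
  cLnorm p (a *: f)%R = ((normc a)%:E * cLnorm p f)%E.
Proof.
move=> p1 mf; have p0 : p != 0 by rewrite gt_eqF// (lt_le_trans ltr01).
rewrite /cLnorm unlock.
have -> : (normc a)%:E = (((normc a) `^ p)%:E `^ p^-1)%E.
  by rewrite poweR_EFin -powRrM mulfV// powRr1// normc_ge0.
rewrite -poweRM ?lee_fin ?powR_ge0 ?integral_ge0//; last first.
  by move=> x _; exact: poweR_ge0.
rewrite -ge0_integralZl//; last 3 first.
- apply: (measurableT_comp (measurable_poweR _)); apply: measurableT_comp => //.
  by apply/measurable_EFinP; exact: measurable_normc.
- by move=> x _; exact: poweR_ge0.
- by rewrite lee_fin powR_ge0.
congr poweR; apply: eq_integral => x _.
rewrite /=. 
rewrite !ger0_norm ?normc_ge0// -EFinM -powRM ?normc_ge0//.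
by rewrite -normcM.
Qed.

Lemma cLnorm_ae p f g : cmeasurable f -> cmeasurable g ->
  f = g %[ae mu] -> cLnorm p f = cLnorm p g.
Proof.
move=> mf mg fg; rewrite /cLnorm unlock; congr poweR.
have mh h : cmeasurable h -> measurable_fun setT
    (fun x => `|(EFin \o (fun x => normc (h x))) x|%E `^ p)%E.
  move=> mh; apply: (measurableT_comp (measurable_poweR _)).
  apply: measurableT_comp => //.
  by apply/measurable_EFinP; exact: measurable_normc.
apply: ae_eq_integral => //; [exact: mh|exact: mh|].
by apply: filterS fg => x /(_ I) /= -> .
Qed.

Lemma cLnorm_eq0 p f : 1 <= p -> cmeasurable f ->
  cLnorm p f = 0%E -> f = 0 %[ae mu].
Proof.
move=> p1 mf /Lnorm_eq0_eq0 h.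
have : EFin \o (fun x => normc (f x)) = \0%E %[ae mu].
  apply: h; first by apply/measurable_EFinP; exact: measurable_normc.
  by rewrite lte_fin (lt_le_trans ltr01).
by apply: filterS => x /(_ I) /= [] /eq0_normc.
Qed.

End ComplexFunctions.

Section ComplexLp.
Context d (T : measurableType d) (R : realType).
Variables (mu : {measure set T -> \bar R}) (p : R) (p1 : 1 <= p).

(* The otherwise unused proof of 1 <= p is kept as an argument of cLfun, cLp and
   hardy so that the closure properties, which rely on it, can be inferred. *)
Definition cLfun of 1 <= p : {pred T -> R[i]^o} :=
  fun f => `[< cmeasurable f /\ (cLnorm mu p f < +oo)%E >].

Lemma cLfunP f :
  reflect (cmeasurable f /\ (cLnorm mu p f < +oo)%E) (f \in cLfun p1).
Proof. exact: asboolP. Qed.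

Lemma cLfun_submod_closed : submod_closed (cLfun p1).
Proof.
have m0 : cmeasurable (0 : T -> R[i]^o) by split; exact: measurable_cst.
split.
  apply/cLfunP; split=> //.
  have -> : (0 : T -> R[i]^o) = 0 *: 0 by rewrite scale0r.
  by rewrite cLnormZ// /normc/= expr0n/= addr0 sqrtr0 mul0e.
move=> a f g /cLfunP[mf fy] /cLfunP[mg gy].
have maf := cmeasurableZ a mf.
apply/cLfunP; split; first exact: cmeasurableD.
apply: le_lt_trans (ler_cLnormD mu p1 maf mg) _.
rewrite lte_add_pinfty// cLnormZ// lte_mul_pinfty// ?lee_fin ?normc_ge0//.
Qed.

HB.instance Definition _ :=
  GRing.isSubmodClosed.Build _ _ (cLfun p1) cLfun_submod_closed.

Definition cLfunType := {f : T -> R[i]^o | f \in cLfun p1}.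
HB.instance Definition _ := SubChoice.on cLfunType.
HB.instance Definition _ := [SubChoice_isSubLmodule of cLfunType by <:].

Definition cLequiv (f g : cLfunType) : bool :=
  `[< val f = val g %[ae mu] >].

Let cLequiv_refl : reflexive cLequiv.
Proof. by move=> f; apply/asboolP; exact: ae_eq_refl. Qed.

Let cLequiv_sym : symmetric cLequiv.
Proof. by move=> f g; apply/asboolP/asboolP; exact: ae_eq_sym. Qed.

Let cLequiv_trans : transitive cLequiv.
Proof.
by move=> g f h /asboolP fg /asboolP gh; apply/asboolP; exact: ae_eq_trans gh.
Qed.

Canonical cLequiv_canonical :=
  EquivRel cLequiv cLequiv_refl cLequiv_sym cLequiv_trans.

(* L_p(mu) over the complex scalars: p-integrable measurable functions modulo
   almost everywhere equality. *)
Definition cLp : Type := {eq_quot cLequiv}.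
HB.instance Definition _ := Choice.on cLp.
HB.instance Definition _ := EqQuotient.on cLp.

Definition cLp_fun (q : cLp) : T -> R[i] := val (repr q).

Lemma cLp_eqP (f g : cLfunType) :
  reflect (val f = val g %[ae mu]) (\pi_cLp f == \pi_cLp g).
Proof. by rewrite eqmodE; exact: asboolP. Qed.

Lemma cLp_fun_pi (f : cLfunType) : cLp_fun (\pi_cLp f) = val f %[ae mu].
Proof. by apply/cLp_eqP; rewrite reprK. Qed.

Definition cLp_zero : cLp := \pi_cLp 0.
Definition cLp_opp (q : cLp) : cLp := \pi_cLp (- repr q).
Definition cLp_add (q r : cLp) : cLp := \pi_cLp (repr q + repr r).
Definition cLp_scale (a : R[i]) (q : cLp) : cLp := \pi_cLp (a *: repr q).

Let pi_opp f : cLp_opp (\pi_cLp f) = \pi_cLp (- f).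
Proof.
apply/eqP/cLp_eqP; apply: filterS (cLp_fun_pi f) => x /(_ I) h _.
by rewrite /= !fctE; congr (- _).
Qed.

Let pi_add f g : cLp_add (\pi_cLp f) (\pi_cLp g) = \pi_cLp (f + g).
Proof.
apply/eqP/cLp_eqP; apply: filterS2 (cLp_fun_pi f) (cLp_fun_pi g).
by move=> x /(_ I) h /(_ I) h' _; rewrite /= !fctE; congr (_ + _).
Qed.

Let pi_scale a f : cLp_scale a (\pi_cLp f) = \pi_cLp (a *: f).
Proof.
apply/eqP/cLp_eqP; apply: filterS (cLp_fun_pi f) => x /(_ I) h _.
by rewrite /= !fctE; congr (_ *: _).
Qed.

Let cLpP (P : cLp -> Prop) : (forall f, P (\pi_cLp f)) -> forall q, P q.
Proof. by move=> h q; rewrite -[q]reprK. Qed.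

Let cLp_addA : associative cLp_add.
Proof.
by elim/cLpP => f; elim/cLpP => g; elim/cLpP => h; rewrite !pi_add addrA.
Qed.

Let cLp_addC : commutative cLp_add.
Proof. by elim/cLpP => f; elim/cLpP => g; rewrite !pi_add addrC. Qed.

Let cLp_add0 : left_id cLp_zero cLp_add.
Proof. by elim/cLpP => f; rewrite pi_add add0r. Qed.

Let cLp_addN : left_inverse cLp_zero cLp_opp cLp_add.
Proof. by elim/cLpP => f; rewrite pi_opp pi_add addNr. Qed.

HB.instance Definition _ :=
  GRing.isZmodule.Build cLp cLp_addA cLp_addC cLp_add0 cLp_addN.

Let cLp_scaleA a b q : cLp_scale a (cLp_scale b q) = cLp_scale (a * b) q.
Proof. by elim/cLpP: q => f; rewrite !pi_scale scalerA. Qed.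

Let cLp_scale1 : left_id 1 cLp_scale.
Proof. by elim/cLpP => f; rewrite pi_scale scale1r. Qed.

Let cLp_scaleDr : right_distributive cLp_scale cLp_add.
Proof.
by move=> a; elim/cLpP => f; elim/cLpP => g; rewrite !(pi_scale, pi_add) scalerDr.
Qed.

Let cLp_scaleDl q a b :
  cLp_scale (a + b) q = cLp_add (cLp_scale a q) (cLp_scale b q).
Proof. by elim/cLpP: q => f; rewrite !(pi_scale, pi_add) scalerDl. Qed.

HB.instance Definition _ := GRing.Zmodule_isLmodule.Build R[i] cLp
  cLp_scaleA cLp_scale1 cLp_scaleDr cLp_scaleDl.

Lemma cLp_piD f g : \pi_cLp (f + g) = \pi_cLp f + \pi_cLp g.
Proof. by rewrite -pi_add. Qed.

Lemma cLp_piZ a f : \pi_cLp (a *: f) = a *: \pi_cLp f.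
Proof. by rewrite -pi_scale. Qed.

(* The norm of a module over R[i] takes its values in R[i]; this one is real. *)
Definition cLp_norm (q : cLp) : R[i] := (fine (cLnorm mu p (cLp_fun q)))%:C%C.

Lemma cLp_funP q : cmeasurable (cLp_fun q) /\ (cLnorm mu p (cLp_fun q) < +oo)%E.
Proof. exact/cLfunP/valP. Qed.

Let cLnorm_fin q : cLnorm mu p (cLp_fun q) \is a fin_num.
Proof. by rewrite ge0_fin_numE ?cLnorm_ge0//; case: (cLp_funP q). Qed.

Lemma cLp_funD (q r : cLp) : cLp_fun (q + r) = cLp_fun q \+ cLp_fun r %[ae mu].
Proof. exact: cLp_fun_pi. Qed.

Lemma cLp_funZ a (q : cLp) : cLp_fun (a *: q) = a \*o cLp_fun q %[ae mu].
Proof. exact: cLp_fun_pi. Qed.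

Let cLp_ler_normD q r : cLp_norm (q + r) <= cLp_norm q + cLp_norm r.
Proof.
have [mq _] := cLp_funP q; have [mr _] := cLp_funP r.
have [mqr _] := cLp_funP (q + r).
rewrite /cLp_norm -rmorphD lecR -lee_fin EFinD !fineK//.
rewrite (cLnorm_ae p mqr _ (cLp_funD q r)); first exact: ler_cLnormD.
exact: cmeasurableD.
Qed.

Let cLp_normZ a q : cLp_norm (a *: q) = `|a| * cLp_norm q.
Proof.
have [mq _] := cLp_funP q; have [maq _] := cLp_funP (a *: q).
rewrite /cLp_norm -rmorphM; congr (_%:C)%C.
rewrite (cLnorm_ae p maq _ (cLp_funZ a q)); last exact: cmeasurableZ.
by rewrite cLnormZ// fineM.
Qed.

Let cLp_norm_eq0 q : cLp_norm q = 0 -> q = 0.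
Proof.
have [mq _] := cLp_funP q; move=> [] q0.
have {}q0 : cLnorm mu p (cLp_fun q) = 0%E by rewrite -[LHS]fineK// q0.
rewrite -[q]reprK; apply/eqP/cLp_eqP.
exact: (cLnorm_eq0 p1 mq q0).
Qed.

HB.instance Definition _ := Lmodule_isNormed.Build R[i] cLp
  cLp_ler_normD cLp_normZ cLp_norm_eq0.

End ComplexLp.

Section ComplexIntegral.
Context d (T : measurableType d) (R : realType).
Variable mu : {measure set T -> \bar R}.
Implicit Types f g : T -> R[i]^o.

Definition cintegrable f :=
  mu.-integrable setT (fun x => (complex.Re (f x))%:E) /\
  mu.-integrable setT (fun x => (complex.Im (f x))%:E).

Lemma cintegralD f g : cintegrable f -> cintegrable g ->
  cintegral mu (f + g) = cintegral mu f + cintegral mu g.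
Proof.
move=> [f1 f2] [g1 g2]; apply/eqP; rewrite eq_complex /=.
rewrite -!RintegralD//; apply/andP; split; apply/eqP; apply: eq_Rintegral => x _.
  by rewrite fctE; case: (f x) (g x) => [? ?] [].
by rewrite fctE; case: (f x) (g x) => [? ?] [].
Qed.

Lemma cintegralZ (a : R[i]) f : cintegrable f ->
  cintegral mu (a *: f) = a * cintegral mu f.
Proof.
move=> [f1 f2]; case: a => a b; apply/eqP; rewrite eq_complex /=.
rewrite -!RintegralZl// -RintegralB//; last 2 first.
- by have := integrableZl measurableT a f1; apply: eq_integrable.
- by have := integrableZl measurableT b f2; apply: eq_integrable.
rewrite -RintegralD//; last 2 first.
- by have := integrableZl measurableT a f2; apply: eq_integrable.
- by have := integrableZl measurableT b f1; apply: eq_integrable.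
apply/andP; split; apply/eqP; apply: eq_Rintegral => x _.
  by rewrite fctE; case: (f x).
by rewrite fctE; case: (f x).
Qed.

Lemma cintegral_ae f g : cmeasurable f -> cmeasurable g ->
  f = g %[ae mu] -> cintegral mu f = cintegral mu g.
Proof.
move=> [f1 f2] [g1 g2] fg; rewrite /cintegral /Rintegral.
congr (fine _ +i* fine _)%C; apply: ae_eq_integral => //;
  by [exact/measurable_EFinP|apply: filterS fg => x /(_ I) /= ->].
Qed.

Lemma ler_Re_normc (a : R[i]) : `|complex.Re a| <= normc a.
Proof.
case: a => a b /=; rewrite -sqrtr_sqr ler_sqrt ?addr_ge0 ?sqr_ge0//.
by rewrite lerDl sqr_ge0.
Qed.

Lemma ler_Im_normc (a : R[i]) : `|complex.Im a| <= normc a.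
Proof.
case: a => a b /=; rewrite -sqrtr_sqr ler_sqrt ?addr_ge0 ?sqr_ge0//.
by rewrite lerDr sqr_ge0.
Qed.

Lemma cLfun_integrable (p : R) (p1 : 1 <= p) f :
  mu setT \is a fin_num -> f \in cLfun mu p1 -> cintegrable f.
Proof.
move=> muT /cLfunP[mf fy].
have mnf := measurable_normc mf.
have : (fun x => normc (f x)) \in Lfun mu p%:E.
  by apply/andP; split; rewrite inE.
move/(@Lfun_subset _ _ _ _ 1%E p%:E (lexx _) p1 muT p1) => /Lfun1_integrable inf.
case: mf => f1 f2; split; apply: le_integrable inf => //.
- exact/measurable_EFinP.
- by move=> x _ /=; rewrite lee_fin (ger0_norm (normc_ge0 _)) ler_Re_normc.
- exact/measurable_EFinP.
- by move=> x _ /=; rewrite lee_fin (ger0_norm (normc_ge0 _)) ler_Im_normc.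
Qed.

End ComplexIntegral.

Section Circle.
Variable R : realType.

Definition circle := {z : R[i] | `|z| == 1}.
HB.instance Definition _ := Choice.on circle.

Lemma cos_sin_on_circle (t : R) : `|(cos t +i* sin t)%C| == 1.
Proof. by rewrite /Num.norm/= cos2Dsin2 sqrtr1. Qed.

Definition expi (t : R) : circle :=
  exist _ (cos t +i* sin t)%C (cos_sin_on_circle t).

HB.instance Definition _ := isPointed.Build circle (expi 0).

Definition circle_coord (z : circle) : R * R :=
  (complex.Re (val z), complex.Im (val z)).

(* The Borel sets of the circle as a subspace of the plane. *)
Definition circle_measurable : set (set circle) :=
  preimage_set_system setT circle_coord measurable.

Let circle_sigma_algebra : sigma_algebra setT circle_measurable.
Proof. exact/sigma_algebra_preimage/sigma_algebra_measurable. Qed.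

Let circle_measurable0 : circle_measurable set0.
Proof. by case: circle_sigma_algebra. Qed.

Let circle_measurableC A : circle_measurable A -> circle_measurable (~` A).
Proof. by case: circle_sigma_algebra => _ + _ mA => /(_ _ mA); rewrite setTD. Qed.

Let circle_measurable_bigcup (F : (set circle)^nat) :
  (forall i, circle_measurable (F i)) -> circle_measurable (\bigcup_i F i).
Proof. by case: circle_sigma_algebra => _ _; apply. Qed.

HB.instance Definition _ := @isMeasurable.Build default_measure_display circle
  circle_measurable circle_measurable0 circle_measurableC
  circle_measurable_bigcup.

Lemma measurable_circle_coord : measurable_fun setT circle_coord.
Proof. by move=> _ B mB; exists B. Qed.

Lemma measurable_expi : measurable_fun setT expi.
Proof.
move=> _ _ [B mB <-].
have : measurable_fun setT (fun t : R => (cos t, sin t)).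
  apply: measurable_fun_pair; apply: continuous_measurable_fun.
    exact: continuous_cos.
  exact: continuous_sin.
by move=> /(_ measurableT B mB); rewrite !setTI.
Qed.

HB.instance Definition _ :=
  isMeasurableFun.Build _ _ _ _ expi measurable_expi.

(* Image of the Lebesgue measure of [0, 2 pi] by t |-> e^(it); not normalized. *)
Definition arc_length : set circle -> \bar R :=
  pushforward (mrestr lebesgue_measure (measurable_itv `[0, 2 * pi])) expi.

Let arc_length0 : arc_length set0 = 0%E.
Proof. by rewrite /arc_length /pushforward preimage_set0 measure0. Qed.

Let arc_length_ge0 A : (0 <= arc_length A)%E.
Proof. by rewrite /arc_length /pushforward measure_ge0. Qed.

Let arc_length_sigma_additive : semi_sigma_additive arc_length.
Proof.
have /= := @measure_semi_sigma_additive _ _ _ (pushforward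
  (mrestr lebesgue_measure (measurable_itv `[0, 2 * pi])) expi).
by apply; exact: measurable_expi.
Qed.

HB.instance Definition _ := isMeasure.Build _ _ _ arc_length
  arc_length0 arc_length_ge0 arc_length_sigma_additive.

Lemma arc_lengthT : arc_length setT = (2 * pi)%:E.
Proof.
rewrite /arc_length /pushforward preimage_setT /mrestr setTI.
rewrite lebesgue_measure_itv/= lte_fin mulr_gt0 ?pi_gt0//.
by rewrite sube0.
Qed.

End Circle.

Section Hardy.
Variables (R : realType) (p : R) (p1 : 1 <= p).
Local Notation m := (@arc_length R).
Local Notation Lp := (cLp m p1).

Definition mulz (n : nat) (f : circle R -> R[i]^o) : circle R -> R[i]^o :=
  fun z => f z * val z ^+ n.

Lemma cmeasurable_mulz n f : cmeasurable f -> cmeasurable (mulz n f).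
Proof.
have mval : cmeasurable (fun z : circle R => val z : R[i]^o).
  split; first exact: (measurableT_comp measurable_fst (@measurable_circle_coord R)).
  exact: (measurableT_comp measurable_snd (@measurable_circle_coord R)).
have mn : cmeasurable (fun z : circle R => val z ^+ n : R[i]^o).
  elim: n => [|n ih]; first by split; exact: measurable_cst.
  rewrite (_ : (fun _ => _) = (fun z : circle R => val z : R[i]^o) \*
    (fun z : circle R => val z ^+ n : R[i]^o)); first exact: cmeasurableM.
  by apply/funext => z /=; rewrite exprS.
by move=> mf; exact: cmeasurableM mf mn.
Qed.

Lemma normc_mulz n f z : normc (mulz n f z) = normc (f z).
Proof.
apply: complexI; rewrite -[LHS]/`|mulz n f z| -[RHS]/`|f z|.
by rewrite /mulz normrM normrX (eqP (valP z)) expr1n mulr1.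
Qed.

Lemma cLfun_mulz_integrable n f : f \in cLfun m p1 ->
  cintegrable m (mulz n f).
Proof.
move=> /cLfunP[mf fy]; apply: (@cLfun_integrable _ _ _ _ p p1).
  by rewrite (_ : _ setT = (2 * pi)%:E)//; exact: arc_lengthT.
apply/cLfunP; split; first exact: cmeasurable_mulz.
rewrite /cLnorm (_ : EFin \o _ = EFin \o (fun x => normc (f x)))//.
by apply/funext => z /=; rewrite normc_mulz.
Qed.

(* For z = e^(it), val z ^+ n is e^(int), so that the integral below is
   \int_0^(2 pi) f(e^(it)) e^(int) dt. *)
Definition hardy of 1 <= p : {pred Lp} := fun q =>
  `[< forall n, (1 <= n)%N -> cintegral m (mulz n (cLp_fun q)) = 0 >].

Lemma hardyP q : reflect
  (forall n, (1 <= n)%N -> cintegral m (mulz n (cLp_fun q)) = 0)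
  (q \in hardy p1).
Proof. exact: asboolP. Qed.

Lemma cLp_fun_mem (q : Lp) : cLp_fun q \in cLfun m p1.
Proof. exact: valP. Qed.

Lemma hardy_submod_closed : submod_closed (hardy p1).
Proof.
have mc n (q : Lp) : cmeasurable (mulz n (cLp_fun q)).
  by apply: cmeasurable_mulz; case: (cLp_funP q).
have ic n (q : Lp) : cintegrable m (mulz n (cLp_fun q)).
  exact: cLfun_mulz_integrable (cLp_fun_mem q).
have cZ n a (q : Lp) : cintegral m (mulz n (cLp_fun (a *: q))) =
    a * cintegral m (mulz n (cLp_fun q)).
  rewrite -cintegralZ//; apply: cintegral_ae => //.
    exact: cmeasurableZ.
  apply: filterS (cLp_funZ a q) => z /(_ I) h _.
  by rewrite /mulz h; exact: (esym (mulrA _ _ _)).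
have cD n (q r : Lp) : cintegral m (mulz n (cLp_fun (q + r))) =
    cintegral m (mulz n (cLp_fun q)) + cintegral m (mulz n (cLp_fun r)).
  rewrite -cintegralD//; apply: cintegral_ae => //.
    exact: cmeasurableD.
  apply: filterS (cLp_funD q r) => z /(_ I) h _.
  by rewrite /mulz h; exact: mulrDl.
split=> [|a q r /hardyP hq /hardyP hr]; apply/hardyP => n n1.
  by rewrite -(scale0r 0) cZ mul0r.
by rewrite cD cZ hq// hr// mulr0 addr0.
Qed.

HB.instance Definition _ :=
  GRing.isSubmodClosed.Build _ _ (hardy p1) hardy_submod_closed.

Definition Hardy := {q : Lp | q \in hardy p1}.
HB.instance Definition _ := SubChoice.on Hardy.
HB.instance Definition _ := [SubChoice_isSubLmodule of Hardy by <:].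

Definition Hardy_norm (f : Hardy) : R[i] := `|val f|.

Let Hardy_ler_normD f g : Hardy_norm (f + g) <= Hardy_norm f + Hardy_norm g.
Proof. exact: ler_normD. Qed.

Let Hardy_normZ a f : Hardy_norm (a *: f) = `|a| * Hardy_norm f.
Proof. exact: normrZ. Qed.

Let Hardy_norm_eq0 f : Hardy_norm f = 0 -> f = 0.
Proof. by move=> /normr0_eq0 f0; exact: val_inj. Qed.

HB.instance Definition _ := Lmodule_isNormed.Build R[i] Hardy
  Hardy_ler_normD Hardy_normZ Hardy_norm_eq0.

End Hardy.

Section Complemented.
Variables (K : numFieldType) (V : normedModType K).

Definition linear_subspace (Y : set V) : Prop :=
  [/\ Y 0, (forall u v, Y u -> Y v -> Y (u + v)) &
      forall (a : K) u, Y u -> Y (a *: u)].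

(* Y is the span of n linearly independent vectors. *)
Definition has_dim (Y : set V) (n : nat) : Prop :=
  exists e : 'I_n -> V,
    (forall a : 'I_n -> K, \sum_i a i *: e i = 0 -> forall i, a i = 0) /\
    Y = range (fun a : 'I_n -> K => \sum_i a i *: e i).

(* The condition `|P v| <= `|v| for all v says that P is bounded with operator
   norm at most 1. *)
Definition one_complemented (Y : set V) : Prop :=
  [/\ linear_subspace Y, closed Y &
      exists P : {linear V -> V},
        [/\ (forall v, P (P v) = P v), (forall v, `|P v| <= `|v|) &
            range P = Y]].

End Complemented.

(* Main.v *)
(** A contractive projection of [H_p] onto [Y] makes the kernel metrically orthogonal to
    [Y], so the norming functional [|x|^(p-2) conj x] of any [x] in [Y] annihilates the
    kernel; hence a linear combination of such functionals that vanishes on [Y] vanishes on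
    [H_p]. Elements of [H_p] other than 0 vanish almost nowhere, by Szego's inequality.

    Let [m] be the ratio of two independent elements of [Y]. By a dimension count, any
    sufficiently many of the functions [|t - m|^p] are linearly dependent; exchanging the
    roles of the parameter [t] and of the values [a_j] of [m] gives a nontrivial relation
    [sum_j d_j |t - a_j|^p = 0] for all complex [t], which forces [p] to be an even integer
    since the other terms are smooth at [a_j].

    If [p] is an even integer larger than 2, then for [x] and [w] in [Y] there is [v] in [Y]
    with [|w|^2 = Re (conj x v)]. For a real bounded [h], choosing for [x] an eigenvector of
    the compression to [Y] of the multiplication by [h] shows that the integral of
    [(h - l) |w|^2] is 0 for all [w] in [Y], with [l] independent of [w]. So the functions
    [|w|^2] are pairwise proportional, and [m] is constant. *)

Require Import Defs.
From mathcomp Require Import all_boot all_order all_algebra.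
From mathcomp Require Import all_classical all_reals all_analysis.
From mathcomp Require Import measurable_realfun.
From mathcomp Require Import complex.
From mathcomp Require Import ring lra.

Set Implicit Arguments.
Unset Strict Implicit.
Unset Printing Implicit Defensive.

Import Order.TTheory GRing.Theory Num.Theory.
Import numFieldNormedType.Exports.
Import Normc.

Local Open Scope classical_set_scope.
Local Open Scope ring_scope.

(** * Integrals of real functions *)

Section RealIntegrals.
Context d (T : measurableType d) (R : realType).
Variable mu : {measure set T -> \bar R}.
Implicit Types f g : T -> R.

(** The Hardy space enters through two properties. It is stable under multiplication by [z], so a
    relation tested on [z ^ k x], with [x] in the span, controls Fourier coefficients of index
    [k >= 0]; these suffice for a real function, and the combinations are arranged so that [x] times
    its functional, the real function [|x| ^ p], appears. Its nonzero elements vanish almost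
    nowhere, which makes the norm differentiable at them even for [p = 1]. Each relation holds only
    off a null set depending on its parameters; this is why the parameters are Gaussian rationals
    until a final passage to the limit. An even [p] escapes the dimension count because
    [|t - m| ^ p] is then a polynomial in [t] and its conjugate: enough of these functions are
    dependent whatever [m] is. On the other hand, the functional of [x] is then a polynomial in [x]
    and its conjugate and can be polarised. For [p = 2] it is the conjugate of [x] alone, with no
    factor [x] to polarise, and orthogonal projections are indeed contractive. *)

Definition rintegrable f := mu.-integrable setT (EFin \o f).

Lemma rintegrable_measurable f : rintegrable f -> measurable_fun setT f.
Proof. by move=> /measurable_int /measurable_EFinP. Qed.

Lemma le_rintegrable f g : measurable_fun setT f -> rintegrable g ->
  (forall x, `|f x| <= g x) -> rintegrable f.
Proof.
move=> mf ig fg; apply: le_integrable ig => //; first exact/measurable_EFinP.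
by move=> x _; rewrite /= lee_fin (le_trans (fg x))// ler_norm.
Qed.

Lemma rintegrableD f g : rintegrable f -> rintegrable g ->
  rintegrable (fun x => f x + g x).
Proof. by move=> f1 g1; exact: (integrableD measurableT f1 g1). Qed.

Lemma rintegrableZ a f : rintegrable f -> rintegrable (fun x => a * f x).
Proof. by move=> f1; exact: (integrableZl measurableT a f1). Qed.

Lemma rintegrableN f : rintegrable f -> rintegrable (fun x => - f x).
Proof. by move=> f1; exact: (integrableN f1). Qed.

Lemma rintegrableB f g : rintegrable f -> rintegrable g ->
  rintegrable (fun x => f x - g x).
Proof. by move=> f1 g1; exact: (integrableB measurableT f1 g1). Qed.

Lemma rintegrable_norm f : rintegrable f -> rintegrable (fun x => `|f x|).
Proof. exact: integrable_norm. Qed.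

Lemma rintegrable0 : rintegrable (fun=> 0).
Proof. exact: integrable0. Qed.

Lemma rintegrable_sum I (s : seq I) (F : I -> T -> R) :
  (forall i, rintegrable (F i)) -> rintegrable (fun x => \sum_(i <- s) F i x).
Proof.
move=> iF; elim: s => [|a s ih].
  by rewrite (_ : (fun _ => _) = fun=> 0); [exact: rintegrable0|apply/funext => x; rewrite big_nil].
rewrite (_ : (fun _ => _) = (fun x => F a x + \sum_(i <- s) F i x)).
  exact: rintegrableD.
by apply/funext => x; rewrite big_cons.
Qed.

Lemma Rintegral_sum I (s : seq I) (F : I -> T -> R) :
  (forall i, rintegrable (F i)) ->
  \int[mu]_x (\sum_(i <- s) F i x) = \sum_(i <- s) \int[mu]_x F i x.
Proof.
move=> iF; elim: s => [|a s ih].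
  rewrite big_nil (_ : (fun _ => _) = cst 0) ?Rintegral_cst ?mul0r//.
  by apply/funext => x; rewrite big_nil.
rewrite big_cons -ih -RintegralD//; [|exact: iF|exact: rintegrable_sum].
by apply: eq_Rintegral => x _; rewrite big_cons.
Qed.

Lemma Rintegral_ae f g : measurable_fun setT f -> measurable_fun setT g ->
  f = g %[ae mu] -> \int[mu]_x f x = \int[mu]_x g x.
Proof.
move=> mf mg fg; rewrite /Rintegral; congr fine; apply: ae_eq_integral => //;
 by [exact/measurable_EFinP|apply: filterS fg => x /(_ I) /= ->].
Qed.

Lemma Rintegral_ge0_eq0 f : rintegrable f -> (forall x, 0 <= f x) ->
  \int[mu]_x f x = 0 -> f = 0 %[ae mu].
Proof.
move=> intf f0 If.
have /fineK : (\int[mu]_x (f x)%:E)%E \is a fin_num.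
  exact: integrable_fin_num.
rewrite -/(Rintegral _ _ _) If => /esym If0.
have E : (\int[mu]_x `|(f x)%:E| = 0)%E.
  by rewrite -[RHS]If0; apply: eq_integral => x _; rewrite /= ger0_norm.
have mf : measurable_fun setT (EFin \o f) by case/integrableP : intf.
have [A _] := @ae_eq_integral_abs _ _ _ mu setT measurableT (EFin \o f) mf.
by apply: filterS (A E) => x /(_ I) /= [].
Qed.

Lemma Rintegral_dct (u : nat -> T -> R) f g :
  (forall n, measurable_fun setT (u n)) -> measurable_fun setT f ->
  rintegrable g -> (forall n x, `|u n x| <= g x) ->
  {ae mu, forall x, (fun n => u n x) @ \oo --> f x} ->
  rintegrable f /\ (fun n => \int[mu]_x u n x) @ \oo --> \int[mu]_x f x.
Proof.
move=> mu_ mf ig ug uf.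
have [|||//||intf _ cv] := @dominated_convergence _ _ _ mu setT measurableT
  (fun n => EFin \o u n) (EFin \o f) (EFin \o g).
- by move=> n; exact/measurable_EFinP.
- exact/measurable_EFinP.
- by apply: filterS uf => x ux _; apply/fine_cvgP; split => //; apply: nearW.
- by apply: nearW => x n _; rewrite /= lee_fin.
split => //.
apply: fine_cvg; by rewrite fineK //; exact: (integrable_fin_num measurableT intf).
Qed.

End RealIntegrals.

Notation Re := complex.Re.
Notation Im := complex.Im.

(** * Real and imaginary parts, conjugation, modulus *)

Section ComplexBasics.
Variable R : realType.
Implicit Types x y : R[i].

Lemma ReD x y : Re (x + y) = Re x + Re y. Proof. by case: x y => [? ?] []. Qed.
Lemma ImD x y : Im (x + y) = Im x + Im y. Proof. by case: x y => [? ?] []. Qed.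
Lemma ReN x : Re (- x) = - Re x. Proof. by case: x. Qed.
Lemma ImN x : Im (- x) = - Im x. Proof. by case: x. Qed.
Lemma ReM x y : Re (x * y) = Re x * Re y - Im x * Im y.
Proof. by case: x y => [? ?] []. Qed.
Lemma ImM x y : Im (x * y) = Re x * Im y + Im x * Re y.
Proof. by case: x y => [? ?] []. Qed.
Lemma Re_conj x : Re (x^*)%C = Re x. Proof. by case: x. Qed.
Lemma Im_conj x : Im (x^*)%C = - Im x. Proof. by case: x. Qed.
Lemma ReC (a : R) : Re (a%:C)%C = a. Proof. by []. Qed.
Lemma ImC (a : R) : Im (a%:C)%C = 0. Proof. by []. Qed.

Lemma ReZ (a : R) x : Re (a%:C%C * x) = a * Re x.
Proof. by rewrite ReM /= mul0r subr0. Qed.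
Lemma ImZ (a : R) x : Im (a%:C%C * x) = a * Im x.
Proof. by rewrite ImM /= mul0r addr0. Qed.

Lemma RtoCD (a b : R) : (a + b)%:C%C = a%:C%C + b%:C%C.
Proof. exact: rmorphD. Qed.
Lemma RtoCB (a b : R) : (a - b)%:C%C = a%:C%C - b%:C%C.
Proof. exact: rmorphB. Qed.
Lemma RtoCM (a b : R) : (a * b)%:C%C = a%:C%C * b%:C%C.
Proof. exact: rmorphM. Qed.
Lemma RtoCX (a : R) n : (a ^+ n)%:C%C = a%:C%C ^+ n.
Proof. exact: rmorphXn. Qed.
Lemma conjcD x y : ((x + y)^*)%C = (x^*)%C + (y^*)%C.
Proof. exact: (rmorphD (@conjc R)). Qed.
Lemma conjcM x y : ((x * y)^*)%C = (x^*)%C * (y^*)%C.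
Proof. exact: (rmorphM (@conjc R)). Qed.
Lemma conjcX x n : ((x ^+ n)^*)%C = (x^*)%C ^+ n.
Proof. exact: (rmorphXn (@conjc R)). Qed.

Definition reimE := (ReD, ImD, ReN, ImN, ReM, ImM, Re_conj, Im_conj, ReC, ImC).

Lemma complexP x y : Re x = Re y -> Im x = Im y -> x = y.
Proof. by case: x y => [? ?] [? ?] /= -> ->. Qed.

Lemma normc_sqr x : normc x ^+ 2 = Re x ^+ 2 + Im x ^+ 2.
Proof. by case: x => a b /=; rewrite sqr_sqrtr// addr_ge0// sqr_ge0. Qed.

Lemma normcX x n : normc (x ^+ n) = normc x ^+ n.
Proof. by elim: n => [|n ih]; rewrite ?expr0 ?(normc1 R)// !exprS normcM ih. Qed.

Lemma normc_conj x : normc (x^*)%C = normc x.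
Proof. by case: x => a b /=; rewrite sqrrN. Qed.

Lemma normc_real (a : R) : normc (a%:C)%C = `|a|.
Proof. by rewrite /= expr0n addr0 sqrtr_sqr. Qed.

Lemma normc_eq0 x : (normc x == 0) = (x == 0).
Proof. by apply/eqP/eqP => [/eq0_normc|->]; last exact: normc0. Qed.

Lemma normc_gt0 x : (0 < normc x) = (x != 0).
Proof. by rewrite lt0r normc_ge0 andbT normc_eq0. Qed.

Lemma mul_conjc x : x * (x^*)%C = (normc x ^+ 2)%:C%C.
Proof. by rewrite normc_sqr; case: x => a b; apply: complexP => /=; ring. Qed.

Lemma normc_le_ReIm x : normc x <= `|Re x| + `|Im x|.
Proof.
rewrite -(@ler_pXn2r _ 2)// ?nnegrE ?normc_ge0 ?addr_ge0//.
rewrite normc_sqr -[Re x ^+ 2]real_normK ?num_real// -[Im x ^+ 2]real_normK ?num_real//.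
have := mulr_ge0 (normr_ge0 (Re x)) (normr_ge0 (Im x)); nra.
Qed.

Lemma Re_sum I (s : seq I) (F : I -> R[i]) :
  Re (\sum_(i <- s) F i) = \sum_(i <- s) Re (F i).
Proof.
by elim: s => [|a s ih]; rewrite ?big_nil// !big_cons ReD ih.
Qed.

Lemma Im_sum I (s : seq I) (F : I -> R[i]) :
  Im (\sum_(i <- s) F i) = \sum_(i <- s) Im (F i).
Proof.
by elim: s => [|a s ih]; rewrite ?big_nil// !big_cons ImD ih.
Qed.

Lemma conjc_sum I (s : seq I) (F : I -> R[i]) :
  ((\sum_(i <- s) F i)^*)%C = \sum_(i <- s) (F i)^*%C.
Proof. exact: (rmorph_sum (@conjc R)). Qed.

Lemma normc_sum_le I (s : seq I) (F : I -> R[i]) :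
  normc (\sum_(i <- s) F i) <= \sum_(i <- s) normc (F i).
Proof.
elim: s => [|a s ih]; first by rewrite !big_nil (normc0 R).
by rewrite !big_cons (le_trans (ler_normcD _ _))// lerD2l.
Qed.

End ComplexBasics.

(** * Integrals of complex functions *)

Section ComplexIntegrals.
Context d (T : measurableType d) (R : realType).
Variable mu : {measure set T -> \bar R}.
Implicit Types f g : T -> R[i].

Lemma cmeasurable_fD f g : cmeasurable f -> cmeasurable g ->
  cmeasurable (fun x => f x + g x).
Proof. exact: cmeasurableD. Qed.

Lemma cmeasurable_fM f g : cmeasurable f -> cmeasurable g ->
  cmeasurable (fun x => f x * g x).
Proof. exact: cmeasurableM. Qed.

Lemma cmeasurable_cst a : cmeasurable (fun _ : T => a : R[i]).
Proof. by split; exact: measurable_cst. Qed.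

Lemma cmeasurable_conj f : cmeasurable f -> cmeasurable (fun x => (f x)^*%C).
Proof.
move=> [f1 f2]; split.
  by under eq_fun do rewrite Re_conj.
by under eq_fun do rewrite Im_conj; exact: measurableT_comp.
Qed.

Lemma cmeasurable_real (u : T -> R) : measurable_fun setT u ->
  cmeasurable (fun x => (u x)%:C%C).
Proof. by move=> mu_; split => //=; exact: measurable_cst. Qed.

Lemma cmeasurable_fX f n : cmeasurable f -> cmeasurable (fun x => f x ^+ n).
Proof.
move=> mf; elim: n => [|n ih]; first by under eq_fun do rewrite expr0; exact: cmeasurable_cst.
by under eq_fun do rewrite exprS; exact: cmeasurable_fM.
Qed.

Lemma cmeasurable_sum I (s : seq I) (F : I -> T -> R[i]) :
  (forall i, cmeasurable (F i)) -> cmeasurable (fun x => \sum_(i <- s) F i x).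
Proof.
move=> iF; elim: s => [|a s ih].
  by under eq_fun do rewrite big_nil; exact: cmeasurable_cst.
by under eq_fun do rewrite big_cons; exact: cmeasurable_fD.
Qed.

Lemma cintegrable_measurable f : cintegrable mu f -> cmeasurable f.
Proof.
by move=> [f1 f2]; split; [exact: rintegrable_measurable f1|exact: rintegrable_measurable f2].
Qed.

Lemma le_cintegrable f (g : T -> R) : cmeasurable f -> rintegrable mu g ->
  (forall x, normc (f x) <= g x) -> cintegrable mu f.
Proof.
move=> [f1 f2] ig fg; split; apply: (@le_rintegrable _ _ _ mu _ g) => // x.
  exact: le_trans (ler_Re_normc _) (fg x).
exact: le_trans (ler_Im_normc _) (fg x).
Qed.

Lemma cintegrable_normc f : cintegrable mu f ->
  rintegrable mu (fun x => normc (f x)).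
Proof.
move=> intf; have [f1 f2] := intf.
apply: (@le_rintegrable _ _ _ mu _ (fun x => `|Re (f x)| + `|Im (f x)|)).
- exact/measurable_normc/cintegrable_measurable.
- by apply: rintegrableD; exact: rintegrable_norm.
- by move=> x; rewrite ger0_norm ?normc_ge0// normc_le_ReIm.
Qed.

Lemma cintegrable_real (u : T -> R) : rintegrable mu u ->
  cintegrable mu (fun x => (u x)%:C%C).
Proof. by move=> iu; split => //=; exact: rintegrable0. Qed.

Lemma cintegrable_fD f g : cintegrable mu f -> cintegrable mu g ->
  cintegrable mu (fun x => f x + g x).
Proof.
move=> [f1 f2] [g1 g2]; split.
  by under eq_fun do rewrite ReD; exact: rintegrableD.
by under eq_fun do rewrite ImD; exact: rintegrableD.
Qed.

Lemma cintegrable_fZ a f : cintegrable mu f -> cintegrable mu (fun x => a * f x).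
Proof.
move=> intf; apply: (@le_cintegrable _ (fun x => normc a * normc (f x))).
- by apply: cmeasurable_fM; [exact: cmeasurable_cst|exact: cintegrable_measurable].
- by apply: rintegrableZ; exact: cintegrable_normc.
- by move=> x; rewrite normcM.
Qed.

Lemma cintegrable_conj f : cintegrable mu f -> cintegrable mu (fun x => (f x)^*%C).
Proof.
move=> [f1 f2]; split.
  by under eq_fun do rewrite Re_conj.
by under eq_fun do rewrite Im_conj; exact: rintegrableN.
Qed.

Lemma cintegrable0 : cintegrable mu (fun=> 0).
Proof. by split; exact: rintegrable0. Qed.

Lemma cintegrable_sum I (s : seq I) (F : I -> T -> R[i]) :
  (forall i, cintegrable mu (F i)) -> cintegrable mu (fun x => \sum_(i <- s) F i x).
Proof.
move=> iF; elim: s => [|a s ih].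
  by under eq_fun do rewrite big_nil; exact: cintegrable0.
by under eq_fun do rewrite big_cons; exact: cintegrable_fD.
Qed.

Lemma cintegral_fD f g : cintegrable mu f -> cintegrable mu g ->
  cintegral mu (fun x => f x + g x) = cintegral mu f + cintegral mu g.
Proof. exact: cintegralD. Qed.

Lemma cintegral_fZ a f : cintegrable mu f ->
  cintegral mu (fun x => a * f x) = a * cintegral mu f.
Proof. exact: cintegralZ. Qed.

Lemma cintegral0 : cintegral mu (fun=> 0) = 0.
Proof. by apply: complexP; rewrite /= Rintegral_cst// mul0r. Qed.

Lemma cintegral_sum I (s : seq I) (F : I -> T -> R[i]) :
  (forall i, cintegrable mu (F i)) ->
  cintegral mu (fun x => \sum_(i <- s) F i x) = \sum_(i <- s) cintegral mu (F i).
Proof.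
move=> iF; elim: s => [|a s ih].
  by rewrite big_nil; under eq_fun do rewrite big_nil; exact: cintegral0.
rewrite big_cons -ih -cintegral_fD//; last exact: cintegrable_sum.
by under eq_fun do rewrite big_cons.
Qed.

Lemma cintegral_conj f : cintegrable mu f ->
  cintegral mu (fun x => (f x)^*%C) = (cintegral mu f)^*%C.
Proof.
move=> [f1 f2]; apply: complexP => /=.
  by under eq_Rintegral do rewrite Re_conj.
rewrite -mulN1r -RintegralZl//.
by apply: eq_Rintegral => x _; rewrite Im_conj mulN1r.
Qed.

Lemma cintegral_real (u : T -> R) :
  cintegral mu (fun x => (u x)%:C%C) = (\int[mu]_x u x)%:C%C.
Proof. by apply: complexP => //=; rewrite Rintegral_cst// mul0r. Qed.

Lemma Re_cintegral f : Re (cintegral mu f) = \int[mu]_x Re (f x).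
Proof. by []. Qed.

Lemma Im_cintegral f : Im (cintegral mu f) = \int[mu]_x Im (f x).
Proof. by []. Qed.

(* Rotating the integral onto the positive half-line reduces this to real parts. *)
Lemma normc_cintegral_le f : cintegrable mu f ->
  normc (cintegral mu f) <= \int[mu]_x normc (f x).
Proof.
move=> intf; set I := cintegral mu f.
have [I0|I0] := eqVneq (normc I) 0.
  by rewrite I0; apply: Rintegral_ge0 => x _; exact: normc_ge0.
have Igt0 : 0 < normc I by rewrite lt0r I0 normc_ge0.
pose c := I^*%C / (normc I)%:C%C.
have nc : normc c = 1.
  by rewrite normcM normc_conj normcV normc_real gtr0_norm// mulfV.
have -> : normc I = Re (c * I).
  have -> : c * I = (normc I)%:C%C.
    have cI0 : (normc I)%:C%C != 0 by rewrite fmorph_eq0.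
    apply: (mulIf cI0); rewrite /c mulrAC mulfVK// mulrC mul_conjc.
    by rewrite expr2 rmorphM.
  by [].
rewrite -cintegral_fZ// Re_cintegral; apply: le_Rintegral => //.
- by case: (cintegrable_fZ c intf).
- exact: cintegrable_normc.
- move=> x _; apply: le_trans (ler_norm _) _.
  by apply: le_trans (ler_Re_normc _) _; rewrite normcM nc mul1r.
Qed.

Lemma cintegral_aeE f g : cmeasurable f -> cmeasurable g ->
  {ae mu, forall x, f x = g x} -> cintegral mu f = cintegral mu g.
Proof. by move=> mf mg fg; apply: cintegral_ae => //; apply: filterS fg. Qed.

Lemma cintegrable_bounded f (u : T -> R[i]) (M : R) :
  cintegrable mu f -> cmeasurable u -> (forall x, normc (u x) <= M) ->
  cintegrable mu (fun x => f x * u x).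
Proof.
move=> intf mu_ uM; apply: (@le_cintegrable _ (fun x => M * normc (f x))).
- by apply: cmeasurable_fM => //; exact: cintegrable_measurable.
- by apply: rintegrableZ; exact: cintegrable_normc.
- by move=> x; rewrite normcM mulrC ler_wpM2r ?normc_ge0.
Qed.

Lemma rintegrable_bounded (f : T -> R) (u : T -> R) (M : R) :
  rintegrable mu f -> measurable_fun setT u -> (forall x, `|u x| <= M) ->
  rintegrable mu (fun x => f x * u x).
Proof.
move=> intf mu_ uM; apply: (@le_rintegrable _ _ _ _ _ (fun x => M * `|f x|)).
- by apply: measurable_funM => //; exact: rintegrable_measurable intf.
- by apply: rintegrableZ; exact: rintegrable_norm.
- by move=> x; rewrite normrM mulrC ler_wpM2r.
Qed.

End ComplexIntegrals.

(** * Bounded pointwise limits, as a monotone class argument *)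

Section BoundedPointwiseClosure.
Variables (T : Type) (R : realType).
Implicit Types (f g : T -> R) (A : (T -> R) -> Prop).

(** Adding the limits of sequences once need not give a set stable under limits, hence an inductive
    closure. A property of [A] preserved by bounded limits, typically through dominated convergence,
    extends to it by induction. *)
Inductive bpclosure A : (T -> R) -> Prop :=
| bpclosure_sub f : A f -> bpclosure A f
| bpclosure_lim (u : nat -> T -> R) f (M : R) : (forall n, bpclosure A (u n)) ->
    (forall n x, `|u n x| <= M) -> (forall x, (fun n => u n x) @ \oo --> f x) ->
    bpclosure A f.

Definition bounded_family A := forall f, A f -> exists M, forall x, `|f x| <= M.

Lemma bpclosure_bounded A : bounded_family A -> bounded_family (bpclosure A).
Proof.
move=> bA f; elim=> {f} [f /bA//|u f M _ _ uM uf].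
exists M => x; apply: (@closed_cvg _ _ _ _ (fun n => `|u n x|) (fun y => y <= M) _ _ _ (cvg_norm (uf x))).
  exact: closed_le.
exact: nearW.
Qed.

Section Algebra.
Variable A : (T -> R) -> Prop.
Hypothesis bA : bounded_family A.
Hypothesis A_cst : forall a, A (fun=> a).
Hypothesis A_D : forall f g, A f -> A g -> A (fun x => f x + g x).
Hypothesis A_M : forall f g, A f -> A g -> A (fun x => f x * g x).
Local Notation cl := (bpclosure A).

Let bcl := bpclosure_bounded bA.

(** Limits are taken in one argument at a time: the outer induction is on [f], for every [g] in the
    closure, and the inner one on [g], for [f] in [A]. The function [B] turns bounds on the
    arguments into a bound on the result, so that the limits stay bounded. *)
Lemma bpclosure_op (op : R -> R -> R) (B : R -> R -> R) :
  (forall f g, A f -> A g -> A (fun x => op (f x) (g x))) ->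
  (forall a b M N, `|a| <= M -> `|b| <= N -> `|op a b| <= B M N) ->
  (forall (u v : nat -> R) a b, u @ \oo --> a -> v @ \oo --> b ->
    (fun n => op (u n) (v n)) @ \oo --> op a b) ->
  forall f g, cl f -> cl g -> cl (fun x => op (f x) (g x)).
Proof.
move=> opA opB opc f g cf cg; elim: cf g cg => {f} [f Af|u f M cu ih uM uf] g cg.
  elim: cg => {g} [g Ag|v g N cv ih vN vg]; first exact/bpclosure_sub/opA.
  have [M fM] := bA Af.
  apply: (@bpclosure_lim _ (fun n x => op (f x) (v n x)) _ (B M N)) => //.
    by move=> n x; exact: opB.
  by move=> x; apply: opc => //; exact: cvg_cst.
have [N gN] := bcl cg.
apply: (@bpclosure_lim _ (fun n x => op (u n x) (g x)) _ (B M N)).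
- by move=> n; exact: ih.
- by move=> n x; exact: opB.
- by move=> x; apply: opc => //; exact: cvg_cst.
Qed.

Lemma bpclosureD f g : cl f -> cl g -> cl (fun x => f x + g x).
Proof.
apply: (bpclosure_op (op := +%R) (B := +%R)) => //.
  by move=> a b M N aM bN; rewrite (le_trans (ler_normD _ _))// lerD.
by move=> u v a b ua vb; exact: cvgD.
Qed.

Lemma bpclosureM f g : cl f -> cl g -> cl (fun x => f x * g x).
Proof.
apply: (bpclosure_op (op := *%R) (B := *%R)) => //.
  by move=> a b M N aM bN; rewrite normrM ler_pM.
by move=> u v a b ua vb; exact: cvgM.
Qed.

Lemma bpclosure_cst a : cl (fun=> a).
Proof. exact/bpclosure_sub/A_cst. Qed.

Lemma bpclosureZ a f : cl f -> cl (fun x => a * f x).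
Proof. by move=> cf; apply: bpclosureM => //; exact: bpclosure_cst. Qed.

(* The iterates of [h] tend to the sign function on [-1, 1]. *)
Let h (t : R) := (3 * t - t ^+ 3) / 2.

(** The iterates increase, so by the last bound each step multiplies the distance to 1 by at most
    [1 - t / 2], with [t] the starting point. *)
Let h_itv t : 0 <= t <= 1 -> [/\ t <= h t, h t <= 1 & 1 - h t <= (1 - t) * (1 - t / 2)].
Proof.
move=> /andP[t0 t1]; have t2 : t ^+ 2 <= 1 by rewrite expr_le1.
have t3 : 0 <= t ^+ 2 by rewrite sqr_ge0.
split; rewrite /h.
- have : 0 <= t * (1 - t ^+ 2) by rewrite mulr_ge0// subr_ge0.
  nra.
- have : 0 <= (1 - t) ^+ 2 * (2 + t) by rewrite mulr_ge0 ?sqr_ge0// addr_ge0.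
  nra.
- have : 0 <= (1 - t) * t ^+ 2 by rewrite mulr_ge0// subr_ge0.
  nra.
Qed.

Let iter_h t : 0 < t <= 1 -> (fun n => iter n h t) @ \oo --> (1 : R).
Proof.
move=> /andP[t0 t1]; have q1 : `|1 - t / 2| < 1.
  by rewrite ger0_norm ?subr_ge0; lra.
have key n : [/\ t <= iter n h t, iter n h t <= 1 & 1 - iter n h t <= (1 - t / 2) ^+ n].
  elim: n => [|n [ih1 ih2 ih3]]; first by rewrite /= expr0; split => //; lra.
  have [|h1 h2 h3] := @h_itv (iter n h t); first by rewrite ih2 (le_trans (ltW t0)).
  rewrite iterS; split => //; first exact: le_trans h1.
  apply: (le_trans h3); rewrite exprSr; apply: ler_pM => //; rewrite ?subr_ge0//.
    by lra.
  by lra.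
have : (fun n => 1 - (1 - t / 2) ^+ n) @ \oo --> (1 - 0 : R).
  by apply: cvgB; [exact: cvg_cst|exact: cvg_expr].
rewrite subr0 => lc; apply: (squeeze_cvgr _ lc); last exact: cvg_cst.
by apply: nearW => n; have [_ -> k3] := key n; rewrite andbT; lra.
Qed.

Let hN t : h (- t) = - h t.
Proof. by rewrite /h; ring. Qed.

Let iter_hN n t : iter n h (- t) = - iter n h t.
Proof. by elim: n => //= n ->; rewrite hN. Qed.

Let h0 : h 0 = 0.
Proof. by rewrite /h; ring. Qed.

Lemma bpclosure_sg f : cl f -> cl (fun x => Num.sg (f x)).
Proof.
move=> cf; have [M fM] := bcl cf.
(* Rescaling keeps the sign and brings [f] into [-1, 1], which [h] preserves; the summand 1 makes
   [c] positive even if [M] is 0. *)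
pose c := (`|M| + 1)^-1.
have c0 : 0 < c by rewrite invr_gt0 ltr_wpDl.
have cf1 x : `|c * f x| <= 1.
  rewrite normrM gtr0_norm// mulrC ler_pdivrMr ?ltr_wpDl// mul1r.
  by rewrite (le_trans (fM x))// (le_trans (ler_norm _))// lerDl.
apply: (@bpclosure_lim _ (fun n x => iter n h (c * f x)) _ 1).
- elim=> [|n ih] /=; first exact: bpclosureZ.
  rewrite (_ : (fun _ => _) = (fun x => 2^-1 * (3 * iter n h (c * f x) +
    -1 * (iter n h (c * f x) * (iter n h (c * f x) * iter n h (c * f x)))))).
    apply: bpclosureZ; apply: bpclosureD; first exact: bpclosureZ.
    by apply: bpclosureZ; apply: bpclosureM => //; exact: bpclosureM.
  by apply/funext => x; rewrite /h; ring.
- have aux t n : 0 <= t <= 1 -> 0 <= iter n h t <= 1.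
    elim: n => //= n ih /ih /[dup] /h_itv[a b _] /andP[c' _].
    by rewrite b andbT (le_trans c').
  move=> n x; have := cf1 x; case: (lerP 0 (c * f x)) => [f0 f1|f0].
    rewrite ger0_norm// in f1.
    have /andP[a b] : 0 <= iter n h (c * f x) <= 1 by apply: aux; rewrite f0.
    by rewrite ger0_norm.
  move=> f1; rewrite ltr0_norm// in f1.
  rewrite -[c * f x]opprK iter_hN normrN.
  have /andP[a b] : 0 <= iter n h (- (c * f x)) <= 1 by apply: aux; lra.
  by rewrite ger0_norm.
- move=> x; have [f0|f0|f0] := sgrP (f x).
  + rewrite f0 mulr0 (_ : (fun _ => _) = cst 0); first exact: cvg_cst.
    by apply/funext; elim=> //= n ->; rewrite h0.
  + apply: iter_h; rewrite mulr_gt0//=.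
    by have := cf1 x; rewrite gtr0_norm// mulr_gt0.
  + have -> : (fun n => iter n h (c * f x)) = - (fun n => iter n h (- (c * f x))).
      by apply/funext => n; rewrite fctE iter_hN opprK.
    apply: cvgN; apply: iter_h.
    rewrite oppr_gt0 pmulr_rlt0// f0/=.
    by have := cf1 x; rewrite ltr0_norm// pmulr_rlt0.
Qed.

(** In terms of the sign [s] of [f], this indicator is the polynomial [(s + s ^ 2) / 2]. *)
Lemma bpclosure_indic_pos f : cl f -> cl (\1_[set x | 0 < f x]).
Proof.
move=> /bpclosure_sg cf.
rewrite (_ : \1_ _ = (fun x => 2^-1 * (Num.sg (f x) + Num.sg (f x) * Num.sg (f x)))).
  by apply: bpclosureZ; apply: bpclosureD => //; exact: bpclosureM.
apply/funext => x; rewrite indicE; have [fx|fx|fx] := sgrP (f x).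
- by rewrite memNset ?mulr0 ?addr0 ?mulr0//= fx ltxx.
- by rewrite mem_set//= mul1r (_ : 1 + 1 = 2)// mulVf.
- by rewrite memNset ?mulrNN ?mulr1 ?addNr ?mulr0//= ltNge (ltW fx).
Qed.

(** Complements and intersections are polynomial operations on indicators; a countable union is the
    limit of its finite subunions, with bound 1. *)
Lemma bpclosure_sigma_algebra : sigma_algebra setT [set B | cl (\1_B)].
Proof.
have cC B : cl (\1_B) -> cl (\1_(~` B)).
  move=> cB; rewrite (_ : \1_ _ = (fun x => 1 + -1 * \1_B x)).
    by apply: bpclosureD; [exact: bpclosure_cst|exact: bpclosureZ].
  by apply/funext => x; rewrite !indicE in_setC; case: (x \in B) => /=; ring.
have cI B C : cl (\1_B) -> cl (\1_C) -> cl (\1_(B `&` C)).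
  move=> cB cC'; rewrite (_ : \1_ _ = (fun x => \1_B x * \1_C x)); first exact: bpclosureM.
  by apply/funext => x; rewrite !indicE in_setI -natrM mulnb.
have c0 : cl (\1_set0).
  rewrite (_ : \1_ _ = (fun=> 0)); first exact: bpclosure_cst.
  by apply/funext => x; rewrite indicE in_set0.
split => /=.
- exact: c0.
- by move=> B cB; rewrite setTD; exact: cC.
- move=> F cF.
  have cU n : cl (\1_(\big[setU/set0]_(i < n) F i)).
    elim: n => [|n ih]; first by rewrite big_ord0.
    by rewrite big_ord_recr/= -[_ `|` _]setCK setCU; apply/cC/cI; exact: cC.
  apply: (@bpclosure_lim _ (fun n => \1_(\big[setU/set0]_(i < n) F i)) _ 1) => //.
    by move=> n x; rewrite indicE; case: (_ \in _); rewrite ?normr0 ?normr1.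
  move=> x; have [[k _ Fkx]|nF] := pselect ((\bigcup_k F k) x).
    have -> : \1_(\bigcup_k F k) x = 1 :> R by rewrite indicE mem_set//; exists k.
    apply: cvg_near_cst; exists k.+1 => // n /= kn.
    by rewrite indicE mem_set// -bigcup_mkord; exists k.
  have -> : \1_(\bigcup_k F k) x = 0 :> R by rewrite indicE memNset.
  apply: cvg_near_cst; apply: nearW => n.
  rewrite indicE memNset// -bigcup_mkord => -[k _ Fk]; apply: nF; by exists k.
Qed.

End Algebra.
End BoundedPointwiseClosure.

(* Folding the projection hides the subtype structure of the circle from unification. *)
Definition cval (R : realType) (z : circle R) : R[i] := val z.

(** * Integration over the circle *)

Section CircleIntegrals.
Variable R : realType.
Local Notation mu := (@arc_length R).

Lemma normc_circle (z : circle R) : normc (cval z) = 1.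
Proof. by apply: complexI; rewrite -[LHS]/`|val z|; exact/eqP/(valP z). Qed.

Lemma normc_circleX (z : circle R) k : normc (cval z ^+ k) = 1.
Proof. by rewrite normcX normc_circle expr1n. Qed.

Lemma cmeasurable_val : cmeasurable (fun z : circle R => cval z).
Proof.
split; first exact: (measurableT_comp measurable_fst (@measurable_circle_coord R)).
exact: (measurableT_comp measurable_snd (@measurable_circle_coord R)).
Qed.

Lemma cmeasurable_valX k : cmeasurable (fun z : circle R => cval z ^+ k).
Proof. exact/cmeasurable_fX/cmeasurable_val. Qed.

Lemma rintegrable_cst (M : R) : rintegrable mu (fun=> M).
Proof.
apply/integrableP; split; first exact: measurable_cst.
rewrite /= integral_cst//= (_ : _ setT = (2 * pi)%:E); last exact: arc_lengthT.
by rewrite -EFinM ltry.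
Qed.

Lemma rintegrable_le_cst (f : circle R -> R) M : measurable_fun setT f ->
  (forall x, `|f x| <= M) -> rintegrable mu f.
Proof. by move=> mf fM; exact: le_rintegrable mf (rintegrable_cst M) fM. Qed.

Lemma cintegrable_le_cst (f : circle R -> R[i]) M : cmeasurable f ->
  (forall x, normc (f x) <= M) -> cintegrable mu f.
Proof. by move=> mf fM; exact: le_cintegrable mf (rintegrable_cst M) fM. Qed.

Lemma cintegrable_valX k : cintegrable mu (fun z : circle R => cval z ^+ k).
Proof.
by apply: (@cintegrable_le_cst _ 1); [exact: cmeasurable_valX|move=> z; rewrite normc_circleX].
Qed.

Lemma cintegrable_mulX (f : circle R -> R[i]) k : cintegrable mu f ->
  cintegrable mu (fun z => f z * cval z ^+ k).
Proof.
move=> intf; apply: (@cintegrable_bounded _ _ _ _ _ _ 1) => //.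
  exact: cmeasurable_valX.
by move=> z; rewrite normc_circleX.
Qed.

Lemma expi_exp (t : R) n :
  cval (expi t) ^+ n = (cos (n%:R * t) +i* sin (n%:R * t))%C.
Proof.
elim: n => [|n ih]; first by rewrite expr0 mul0r cos0 sin0.
rewrite exprS ih -natr1 mulrDl mul1r addrC cosD sinD.
by apply: complexP; rewrite reimE /=; ring.
Qed.

(** The change of variables for a pushforward yields an integral over the whole line for the
    restricted measure [m], which does not charge the complement of [D] and agrees with Lebesgue
    measure inside. *)
Lemma Rintegral_arc_length (f : circle R -> R) : rintegrable mu f ->
  \int[mu]_z f z = \int[lebesgue_measure]_(t in `[0, 2 * pi]) f (expi t).
Proof.
move=> intf; have mf := rintegrable_measurable intf.
have mE : measurable_fun setT (EFin \o f) by exact/measurable_EFinP.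
pose D := (`[0, 2 * pi] : set R)%classic; pose l := @lebesgue_measure R.
pose m : {measure set (measurableTypeR R) -> \bar R} := mrestr l (measurable_itv `[0, 2 * pi]).
have mfe : measurable_fun setT (EFin \o f \o @expi R).
  exact: measurableT_comp mE (@measurable_expi R).
have mD : measurable D by exact: measurable_itv.
have intm : m.-integrable setT (EFin \o f \o @expi R).
  apply/integrableP; split => //.
  have /integrableP[_] := intf.
  have mabs : measurable_fun setT (fun z => `|(f z)%:E|%E) by exact: measurableT_comp.
  have /= := @ge0_integral_pushforward _ _ (measurableTypeR R) (circle R) R (@expi R) (@measurable_expi R) m setT _
    measurableT mabs (fun _ _ => abse_ge0 _).
  by move=> <-.
have mDC0 : m (~` D) = 0%E by rewrite /m /= /mrestr -/D setICl measure0.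
rewrite /Rintegral; congr fine.
have -> : (\int[mu]_x (f x)%:E = \int[m]_t (f (expi t))%:E)%E.
  by have := @integral_pushforward _ _ (measurableTypeR R) (circle R) R (@expi R) (@measurable_expi R) m setT _ mE intm measurableT.
have -> : (\int[m]_t (f (expi t))%:E = \int[m]_(t in D) (f (expi t))%:E)%E.
  have := @negligible_integral _ _ R m setT (~` D) _ (measurableC mD) measurableT intm mDC0.
  by rewrite setTD setCK.
apply: (@eq_measure_integral _ (measurableTypeR R) R D (@lebesgue_measure R) m) => A mA AD.
by rewrite /m /= /mrestr setIidl.
Qed.

Lemma Rintegral_cos_sin n : (0 < n)%N ->
  \int[lebesgue_measure]_(t in `[0, 2 * pi]) cos (n%:R * t) = 0 :> R /\
  \int[lebesgue_measure]_(t in `[0, 2 * pi]) sin (n%:R * t) = 0 :> R.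
Proof.
move=> n0; have nn0 : n%:R != 0 :> R by rewrite pnatr_eq0 -lt0n.
have pi2 : 0 < 2 * pi :> R by rewrite mulr_gt0// pi_gt0.
have FTC (f F : R -> R) : continuous f -> (forall x : R, is_derive x 1 F (f x)) ->
    F (2 * pi) = F 0 -> \int[lebesgue_measure]_(t in `[0, 2 * pi]) f t = 0.
  move=> cf dF F0; rewrite /Rintegral (@continuous_FTC2 _ f F)//.
  - by rewrite F0 subee.
  - exact: continuous_subspaceT.
  - have cF : continuous F.
      move=> x; apply: differentiable_continuous; apply/derivable1_diffP.
      by have := dF x; case.
    split; first by move=> x _; have := dF x; case.
      exact/cvg_at_right_filter/cF.
    exact/cvg_at_left_filter/cF.
  - by move=> x _; rewrite derive1E; exact: derive_val.
have cn : continuous (fun t : R => n%:R * t) by exact: mulrl_continuous.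
have s2 : sin (n%:R * (2 * pi)) = 0 :> R /\ cos (n%:R * (2 * pi)) = 1 :> R.
  have e k : (k%:R * (2 * pi) : R) = (2 * pi) *+ k by rewrite mulr_natl.
  rewrite e; elim: n {n0 nn0 cn} => [|k [ih1 ih2]]; first by rewrite mulr0n sin0 cos0.
  rewrite mulrSr sinD cosD ih1 ih2 (_ : 2 * pi = pi *+ 2) ?mulr_natl//.
  by rewrite sin2pi cos2pi; split; ring.
split.
- apply: (FTC _ (fun t => n%:R^-1 * sin (n%:R * t))).
  + by move=> x; apply: continuous_comp; [exact: cn|exact: continuous_cos].
  + move=> x; have : is_derive x 1 (fun t => n%:R^-1 * sin (n%:R * t)) (n%:R^-1 *: (n%:R * cos (n%:R * x))).
      apply: is_deriveZ; have : is_derive x 1 (fun t : R => n%:R * t) n%:R.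
        by apply: is_derive_eq; rewrite /GRing.scale/= mulr1.
      by move=> dn; have := @is_derive1_comp _ sin (fun t : R => n%:R * t) x _ _ (is_derive_sin _) dn; rewrite mulrC.
    by rewrite /GRing.scale/= mulrA mulVf// mul1r.
  + by rewrite s2.1 !mulr0 sin0 mulr0.
- apply: (FTC _ (fun t => - n%:R^-1 * cos (n%:R * t))).
  + by move=> x; apply: continuous_comp; [exact: cn|exact: continuous_sin].
  + move=> x; have : is_derive x 1 (fun t => - n%:R^-1 * cos (n%:R * t)) (- n%:R^-1 *: (n%:R * - sin (n%:R * x))).
      apply: is_deriveZ; have : is_derive x 1 (fun t : R => n%:R * t) n%:R.
        by apply: is_derive_eq; rewrite /GRing.scale/= mulr1.
      by move=> dn; have := @is_derive1_comp _ cos (fun t : R => n%:R * t) x _ _ (is_derive_cos _) dn; rewrite mulrC.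
    by rewrite /GRing.scale/= mulrA mulNr mulVf// mulrNN mul1r.
  + by rewrite s2.2 mulr0 cos0.
Qed.

Lemma cintegral_valX n : (0 < n)%N -> cintegral mu (fun z : circle R => cval z ^+ n) = 0.
Proof.
move=> n0; have [i1 i2] := cintegrable_valX n.
have [c s] := Rintegral_cos_sin n0.
apply: complexP; rewrite ?Re_cintegral ?Im_cintegral Rintegral_arc_length//=.
  by rewrite -[RHS]c; apply: eq_Rintegral => t _; rewrite expi_exp.
by rewrite -[RHS]s; apply: eq_Rintegral => t _; rewrite expi_exp.
Qed.

Lemma arc_length_neq0 : mu setT != 0%E.
Proof.
rewrite (_ : mu setT = (2 * pi)%:E); last exact: arc_lengthT.
by rewrite eqe mulf_neq0 ?gt_eqF ?pi_gt0.
Qed.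

Lemma Rintegral_cst_arc (a : R) : \int[mu]_z a = a * (2 * pi).
Proof.
by rewrite Rintegral_cst//= (_ : _ setT = (2 * pi)%:E)//; exact: arc_lengthT.
Qed.

End CircleIntegrals.

(** * Trigonometric polynomials and uniqueness of Fourier coefficients *)

Section TrigonometricPolynomials.
Variable R : realType.
Local Notation mu := (@arc_length R).

(** Since the conjugate of [z] is its inverse on the circle, real parts of polynomials in [z] are
    all the real trigonometric polynomials; in this form they only involve powers of nonnegative
    exponent. *)
Definition trigpoly (f : circle R -> R) :=
  exists g : {poly R[i]}, forall z, f z = Re g.[cval z].

Lemma trigpoly_Re (g : {poly R[i]}) : trigpoly (fun z => Re g.[cval z]).
Proof. by exists g. Qed.

Lemma eq_trigpoly f g : trigpoly f -> f =1 g -> trigpoly g.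
Proof. by move=> [h hf] fg; exists h => z; rewrite -fg hf. Qed.

Lemma trigpoly_cst a : trigpoly (fun=> a).
Proof. by exists (a%:C%C)%:P => z; rewrite hornerC. Qed.

Lemma trigpolyD f g : trigpoly f -> trigpoly g -> trigpoly (fun z => f z + g z).
Proof. by move=> [p hp] [q hq]; exists (p + q) => z; rewrite hornerD ReD hp hq. Qed.

Lemma trigpoly_sum I (s : seq I) (F : I -> circle R -> R) :
  (forall i, trigpoly (F i)) -> trigpoly (fun z => \sum_(i <- s) F i z).
Proof.
move=> tF; elim: s => [|i s ih].
  by apply: eq_trigpoly (trigpoly_cst 0) _ => z; rewrite big_nil.
by apply: eq_trigpoly (trigpolyD (tF i) ih) _ => z; rewrite big_cons.
Qed.

Lemma circle_mulJX (z : circle R) k : cval z ^+ k * (cval z ^+ k)^*%C = 1.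
Proof. by rewrite mul_conjc normc_circleX expr1n. Qed.

(** The relation [z z^* = 1] cancels the smaller exponent. If a conjugated power remains,
    conjugating the whole expression does not change its real part. *)
Lemma trigpoly_mono (c : R[i]) j l :
  trigpoly (fun z => Re (c * cval z ^+ j * (cval z ^+ l)^*%C)).
Proof.
have [lj|/ltnW jl] := leqP l j.
  exists (c *: 'X^(j - l)) => z; rewrite hornerZ hornerXn -{1}(subnK lj) exprD.
  by congr Re; rewrite -!mulrA circle_mulJX mulr1.
exists ((c^*)%C *: 'X^(l - j)) => z; rewrite hornerZ hornerXn -{1}(subnK jl) exprD.
rewrite conjcM (mulrC (_^*)%C) mulrA -(mulrA c) circle_mulJX mulr1.
by rewrite -[LHS]Re_conj conjcM conjcK.
Qed.

(** [Re p Re q] is half the real part of [p q + p q^*], and the second product is a sum of the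
    monomials of [trigpoly_mono]. *)
Lemma trigpolyM f g : trigpoly f -> trigpoly g -> trigpoly (fun z => f z * g z).
Proof.
move=> [p hp] [q hq].
have tpq : trigpoly (fun z => Re (p.[cval z] * (q.[cval z])^*%C)).
  have : trigpoly (fun z => \sum_(i < size p) \sum_(j < size q)
      Re (p`_i * (q`_j)^*%C * cval z ^+ i * (cval z ^+ j)^*%C)).
    by apply: trigpoly_sum => i; apply: trigpoly_sum => j; exact: trigpoly_mono.
  move=> /eq_trigpoly; apply => z.
  rewrite (horner_coef p) (horner_coef q) conjc_sum mulr_suml Re_sum.
  apply: eq_bigr => i _; rewrite mulr_sumr Re_sum; apply: eq_bigr => j _.
  by rewrite conjcM; congr Re; ring.
have [h hh] := tpq.
exists ((2^-1)%:C%C *: (p * q + h)) => z.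
by rewrite hornerZ hornerD hornerM hp hq ReZ ReD -hh !ReM Re_conj Im_conj; field.
Qed.

Lemma trigpoly_bounded : bounded_family trigpoly.
Proof.
move=> f [g fg]; exists (\sum_(i < size g) normc g`_i) => z.
rewrite fg (le_trans (ler_Re_normc _))// horner_coef.
apply: le_trans (normc_sum_le _ _) _; apply: ler_sum => i _.
by rewrite normcM normc_circleX mulr1.
Qed.

Lemma cmeasurable_horner (g : {poly R[i]}) : cmeasurable (fun z : circle R => g.[cval z]).
Proof.
under eq_fun do rewrite horner_coef.
apply: cmeasurable_sum => i; apply: cmeasurable_fM; first exact: cmeasurable_cst.
exact: cmeasurable_valX.
Qed.

Lemma measurable_bpclosure_trigpoly f : bpclosure trigpoly f -> measurable_fun setT f.
Proof.
elim=> {f} [f [g fg]|u f M _ ih uM uf].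
  rewrite (_ : f = (fun z => Re g.[cval z])); last exact/funext.
  by case: (cmeasurable_horner g).
by apply: (measurable_fun_cvg ih) => x _; exact: uf.
Qed.

(** The sets whose indicator is in the closure form a sigma-algebra. The two coordinates are
    trigonometric polynomials, so it contains the preimages of rays under them, and these generate
    the Borel sets. *)
Lemma bpclosure_trigpoly_indic (B : set (circle R)) :
  measurable B -> bpclosure trigpoly (\1_B).
Proof.
have SA := bpclosure_sigma_algebra trigpoly_bounded trigpoly_cst trigpolyD trigpolyM.
pose S : set (set (circle R)) := [set B | bpclosure trigpoly (\1_B)].
have SA' : sigma_algebra setT S by [].
have ray (h : circle R -> R) : trigpoly h -> forall A : set R, measurable A -> S (h @^-1` A).
  move=> th; have SI := sigma_algebra_image h SA'.
  have sub : (@ocitv R).-sigma.-measurable `<=` image_set_system setT h S.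
    rewrite RGenOInfty.measurableE; apply: smallest_sub => // A [x ->].
    rewrite /image_set_system /= setTI.
    have tx : bpclosure trigpoly (fun z => h z + - x).
      by apply/bpclosure_sub/trigpolyD => //; exact: trigpoly_cst.
    have := bpclosure_indic_pos trigpoly_bounded trigpoly_cst trigpolyD trigpolyM tx.
    rewrite /S /= (_ : [set z | 0 < h z + - x] = h @^-1` `]x, +oo[%classic)//.
    by apply/seteqP; split => z /=; rewrite in_itv/= andbT subr_gt0.
  by move=> A /sub; rewrite /image_set_system /= setTI.
have tRe : trigpoly (fun z => Re (cval z)).
  by exists 'X => z; rewrite hornerX.
have tIm : trigpoly (fun z => Im (cval z)).
  exists ((Complex 0 (-1))%:P * 'X) => z; rewrite hornerM hornerC hornerX.
  by rewrite ReM /= mul0r sub0r mulN1r opprK.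
have SP := sigma_algebra_image (@circle_coord R) SA'.
have : (@measurable _ (R * R)%type) `<=` image_set_system setT (@circle_coord R) S.
  apply: smallest_sub => //; rewrite subUset; split => _ [A mA <-];
    rewrite /image_set_system /= !setTI; exact: ray.
move=> sub [C mC <-]; move/sub: mC; by rewrite /image_set_system /= setTI.
Qed.

Lemma cintegral_mul_horner (f : circle R -> R[i]) (g : {poly R[i]}) : cintegrable mu f ->
  (forall n, (1 <= n)%N -> cintegral mu (fun z => f z * cval z ^+ n) = 0) ->
  cintegral mu (fun z => f z * g.[cval z]) = g`_0 * cintegral mu f.
Proof.
move=> intf f0.
have -> : (fun z => f z * g.[cval z]) =
    (fun z => \sum_(i < size g) (g`_i * (f z * cval z ^+ i))).
  apply/funext => z; rewrite horner_coef mulr_sumr; apply: eq_bigr => i _.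
  by rewrite mulrCA.
rewrite cintegral_sum; last by move=> i; apply/cintegrable_fZ/cintegrable_mulX.
have [->|g0] := eqVneq g 0; first by rewrite coef0 mul0r size_poly0 big_ord0.
have : (0 < size g)%N by rewrite size_poly_gt0.
case: (size g) => // n _; rewrite big_ord_recl big1 ?addr0/=.
  rewrite cintegral_fZ; last exact: cintegrable_mulX.
  by under eq_fun do rewrite expr0 mulr1.
move=> i _; rewrite cintegral_fZ; last exact: cintegrable_mulX.
by rewrite f0 ?mulr0.
Qed.

(** As [f] is real, vanishing coefficients of nonnegative index make it orthogonal to all
    trigonometric polynomials, hence by dominated convergence to their closure, which contains the
    indicators of the sets where [f > 0] and where [f < 0]. *)
Lemma fourier_uniqueness (f : circle R -> R) : rintegrable mu f ->
  (forall k, cintegral mu (fun z => (f z)%:C%C * cval z ^+ k) = 0) ->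
  {ae mu, forall z, f z = 0}.
Proof.
move=> intf f0; have mf := rintegrable_measurable intf.
have intC := cintegrable_real intf.
have key psi : bpclosure trigpoly psi -> \int[mu]_z (f z * psi z) = 0.
  elim=> {psi} [psi [g psig]|u psi M cu ih uM upsi].
    have fg0 : cintegral mu (fun z => (f z)%:C%C * g.[cval z]) = 0.
      rewrite cintegral_mul_horner//; have := f0 0.
      by under eq_fun do rewrite expr0 mulr1; move=> ->; rewrite mulr0.
    rewrite -(ReC 0) -[LHS]ReC -[X in _ = Re X]fg0 Re_cintegral /=.
    apply: eq_Rintegral => z _; rewrite psig ReM/=; ring.
  have mpsi : measurable_fun setT psi.
    by apply/measurable_bpclosure_trigpoly/bpclosure_lim.
  have [|||||_] := @Rintegral_dct _ _ _ mu (fun n z => f z * u n z)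
      (fun z => f z * psi z) (fun z => M * `|f z|).
  - move=> n; apply: measurable_funM => //.
    exact: measurable_bpclosure_trigpoly.
  - exact: measurable_funM.
  - exact/rintegrableZ/rintegrable_norm.
  - by move=> n x; rewrite normrM mulrC ler_wpM2r.
  - by apply: nearW => x; apply: cvgM; [exact: cvg_cst|exact: upsi].
  rewrite (_ : (fun _ => _) = cst 0); last by apply/funext => n; exact: ih.
  by move=> /cvg_lim; rewrite lim_cst// => <-.
have part (h : circle R -> R) : rintegrable mu h -> (forall z, h z = f z \/ h z = - f z) ->
    \int[mu]_z (h z * \1_[set z | 0 < h z] z) = 0 ->
    {ae mu, forall z, h z <= 0}.
  move=> inth hf I0; have mh := rintegrable_measurable inth.
  have mset : measurable [set z | 0 < h z].
    have := mh measurableT _ (measurable_itv `]0, +oo[); rewrite setTI.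
    congr measurable; apply/seteqP; split => z /=; by rewrite in_itv/= andbT.
  have intp : rintegrable mu (fun z => h z * \1_[set z | 0 < h z] z).
    apply: (@rintegrable_bounded _ _ _ _ _ _ 1) => //.
    by move=> z; rewrite indicE; case: (_ \in _); rewrite ?normr0 ?normr1.
  have /(Rintegral_ge0_eq0 intp) := I0.
  case=> [z|N [mN N0 sN]]; last first.
    exists N; split => // z /= nz; apply: sN => /= /(_ I) e; apply: nz.
    rewrite leNgt; apply/negP => hz; move: e.
    by rewrite indicE mem_set//= mulr1 => /eqP; rewrite gt_eqF.
  rewrite indicE; have [hz|hz] := ltP 0 (h z).
    by rewrite mulr_ge0// ltW.
  by rewrite memNset ?mulr0//= ltNge hz.
have p1 : {ae mu, forall z, f z <= 0}.
  apply: part => //; first by move=> z; left.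
  apply/key/bpclosure_trigpoly_indic.
  have := mf measurableT _ (measurable_itv `]0, +oo[); rewrite setTI.
  congr measurable; apply/seteqP; split => z /=; by rewrite in_itv/= andbT.
have p2 : {ae mu, forall z, - f z <= 0}.
  apply: part; first exact: rintegrableN.
    by move=> z; right.
  have : \int[mu]_z (f z * \1_[set z | 0 < - f z] z) = 0.
    apply/key/bpclosure_trigpoly_indic.
    have := mf measurableT _ (measurable_itv `]-oo, 0[); rewrite setTI.
    by congr measurable; apply/seteqP; split => z /=; rewrite in_itv/= oppr_gt0.
  move=> e; transitivity (-1 * \int[mu]_z (f z * \1_[set z | 0 < - f z] z)); last by rewrite e mulr0.
  rewrite -RintegralZl//.
    by apply: eq_Rintegral => z _; rewrite mulN1r mulNr.
  apply: (@rintegrable_bounded _ _ _ _ _ _ 1) => //.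
    apply: measurable_indic.
    have := mf measurableT _ (measurable_itv `]-oo, 0[); rewrite setTI.
    by congr measurable; apply/seteqP; split => z /=; rewrite in_itv/= oppr_gt0.
  by move=> z; rewrite indicE; case: (_ \in _); rewrite ?normr0 ?normr1.
apply: filterS2 p1 p2 => z f1 f2; apply/eqP; rewrite eq_le f1/=.
by rewrite -oppr_le0.
Qed.

End TrigonometricPolynomials.

(** * Szego's inequality and the zeros of Hardy functions *)

Section Szego.
Variable R : realType.
Local Notation mu := (@arc_length R).

(** The exponent is even so that no square root occurs: [|1 + s / (2 N)| ^ 2] equals [1 + x], which
    is at most [exp x], and [x N] is the exponent on the right. *)
Lemma normc_expr_le (s : R[i]) N : (0 < N)%N ->
  normc ((1 + (N.*2%:R^-1)%:C%C * s) ^+ N.*2) <= expR (Re s + normc s ^+ 2 / (4 * N%:R)).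
Proof.
move=> N0; have n0 : N%:R != 0 :> R by rewrite pnatr_eq0 -lt0n.
have n1 : 0 < N%:R :> R by rewrite ltr0n.
set x : R := Re s / N%:R + normc s ^+ 2 / (4 * N%:R ^+ 2).
have -> : normc ((1 + (N.*2%:R^-1)%:C%C * s) ^+ N.*2) = (1 + x) ^+ N.
  rewrite normcX -mul2n exprM; congr (_ ^+ _).
  rewrite normc_sqr /x normc_sqr !reimE/= natrM; field; exact: n0.
have -> : Re s + normc s ^+ 2 / (4 * N%:R) = x * N%:R.
  by rewrite /x; field; exact: n0.
have x1 : 0 <= 1 + x.
  have := sqr_ge0 (Re s / (2 * N%:R) + 1).
  have -> : 1 + x = (1 + Re s / (2 * N%:R)) ^+ 2 + (Im s / (2 * N%:R)) ^+ 2.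
    by rewrite /x normc_sqr; field; exact: n0.
  by move=> _; rewrite addr_ge0// sqr_ge0.
by rewrite expRM_natr lerXn2r ?nnegrE ?expR_ge0// expR_ge1Dx.
Qed.

Lemma le_of_expR_div (X Y C : R) : 0 <= Y ->
  (forall N, (0 < N)%N -> X <= expR (C / N%:R) * Y) -> X <= Y.
Proof.
move=> Y0 XY.
have c0 : (fun n => expR (C * n.+1%:R^-1)) @ \oo --> (1 : R).
  rewrite -[X in _ --> X](@expR0 R); apply: continuous_cvg; first exact: continuous_expR.
  have : (fun n => C * n.+1%:R^-1) @ \oo --> C * 0.
    by apply: cvgM; [exact: cvg_cst|exact: (@cvg_harmonic R)].
  by rewrite mulr0.
have c1 : (fun n => expR (C * n.+1%:R^-1) * Y) @ \oo --> Y.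
  have : (fun n => expR (C * n.+1%:R^-1) * Y) @ \oo --> 1 * Y.
    by apply: cvgM => //; exact: cvg_cst.
  by rewrite mul1r.
apply: (ler_cvg_to (cvg_cst X) c1).
by apply: nearW => n; exact: XY.
Qed.

(* [f] is tested on [(1 + g / 2N) ^ 2N], a polynomial with constant term 1 whose modulus
   is at most [exp (Re g)] up to a factor tending to 1. *)
Lemma szego_trigpoly (f : circle R -> R[i]) (g : {poly R[i]}) : cintegrable mu f ->
  (forall n, (1 <= n)%N -> cintegral mu (fun z => f z * cval z ^+ n) = 0) ->
  g`_0 = 0 ->
  normc (cintegral mu f) <= \int[mu]_z (normc (f z) * expR (Re g.[cval z])).
Proof.
move=> intf f0 g0.
have [G gG] : exists G, forall z : circle R, normc g.[cval z] <= G.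
  exists (\sum_(i < size g) normc g`_i) => z; rewrite horner_coef.
  apply: le_trans (normc_sum_le _ _) _; apply: ler_sum => i _.
  by rewrite normcM normc_circleX mulr1.
have G0 : 0 <= G by rewrite (le_trans _ (gG (expi 0)))// normc_ge0.
have mexp : measurable_fun setT (fun z : circle R => expR (Re g.[cval z])).
  by apply: measurableT_comp => //; case: (cmeasurable_horner g).
have intE : rintegrable mu (fun z => normc (f z) * expR (Re g.[cval z])).
  apply: (@rintegrable_bounded _ _ _ _ _ _ (expR G)) => //.
    exact: cintegrable_normc.
  move=> z; rewrite ger0_norm ?expR_ge0// ler_expR (le_trans _ (gG z))//.
  exact: le_trans (ler_norm _) (ler_Re_normc _).
apply: (@le_of_expR_div _ _ (G ^+ 2 / 4)).
  by apply: Rintegral_ge0 => z _; rewrite mulr_ge0 ?normc_ge0 ?expR_ge0.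
move=> N N0; set c := (N.*2%:R^-1)%:C%C : R[i].
pose q : {poly R[i]} := (1 + c *: g) ^+ N.*2.
have q0 : q`_0 = 1.
  rewrite -horner_coef0 /q horner_exp hornerD hornerZ hornerC horner_coef0 g0.
  by rewrite mulr0 addr0 expr1n.
have qz (z : circle R) : q.[cval z] = (1 + c * g.[cval z]) ^+ N.*2.
  by rewrite /q horner_exp hornerD hornerZ hornerC.
have qle (z : circle R) : normc q.[cval z] <= expR (G ^+ 2 / 4 / N%:R) * expR (Re g.[cval z]).
  rewrite qz; apply: le_trans (normc_expr_le _ N0) _.
  rewrite addrC expRD ler_wpM2r ?expR_ge0// ler_expR invfM mulrA.
  by rewrite !ler_wpM2r ?invr_ge0 ?ler0n// lerXn2r ?nnegrE ?normc_ge0.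
have intfq : cintegrable mu (fun z => f z * q.[cval z]).
  apply: (@cintegrable_bounded _ _ _ _ _ _ (expR (G ^+ 2 / 4 / N%:R) * expR G)) => //.
    exact: cmeasurable_horner.
  move=> z; apply: le_trans (qle z) _; rewrite ler_wpM2l ?expR_ge0// ler_expR.
  by apply: le_trans (gG z); exact: le_trans (ler_norm _) (ler_Re_normc _).
have <- : cintegral mu (fun z => f z * q.[cval z]) = cintegral mu f.
  by rewrite cintegral_mul_horner// q0 mul1r.
apply: le_trans (normc_cintegral_le intfq) _.
have intE' := rintegrableZ (expR (G ^+ 2 / 4 / N%:R)) intE.
rewrite -RintegralZl//; apply: (le_Rintegral _ (cintegrable_normc intfq) intE') => //.
by move=> z _; rewrite normcM mulrCA ler_wpM2l ?normc_ge0.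
Qed.

(** Both sides pass to bounded pointwise limits of [psi], so it is enough to treat trigonometric
    polynomials. The purpose of the limits is to reach weights that are step functions. *)
Lemma szego (f : circle R -> R[i]) psi : cintegrable mu f ->
  (forall n, (1 <= n)%N -> cintegral mu (fun z => f z * cval z ^+ n) = 0) ->
  bpclosure (@trigpoly R) psi ->
  normc (cintegral mu f) * expR ((\int[mu]_z psi z) / (2 * pi)) <=
  \int[mu]_z (normc (f z) * expR (psi z)).
Proof.
move=> intf f0; have nf := cintegrable_normc intf; have mnf := rintegrable_measurable nf.
elim=> {psi} [psi [g psig]|u psi M cu ih uM upsi].
  (* [Re a] is the mean of [psi]; removing it leaves a polynomial with constant coefficient 0. *)
  pose a := g`_0; pose h := g - a%:P.
  have h0 : h`_0 = 0 by rewrite coefB coefC eqxx subrr.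
  have hz (z : circle R) : h.[cval z] = g.[cval z] - a by rewrite hornerD hornerN hornerC.
  have -> : \int[mu]_z psi z = Re a * (2 * pi).
    have ig : cintegral mu (fun z : circle R => (1 : R[i]) * g.[cval z]) = a * (2 * pi)%:C%C.
      rewrite cintegral_mul_horner//; last 2 first.
      - exact/cintegrable_real/(rintegrable_cst 1).
      - move=> n n1; under eq_fun do rewrite mul1r; exact: cintegral_valX.
      congr (_ * _); rewrite (cintegral_real _ (fun=> 1)) Rintegral_cst_arc.
      by rewrite mul1r.
    transitivity (Re (a * (2 * pi)%:C%C)); last by rewrite ReM/= mulr0 subr0.
    rewrite -ig Re_cintegral; apply: eq_Rintegral => z _.
    by rewrite mul1r psig.
  rewrite mulfK ?gt_eqF ?mulr_gt0 ?pi_gt0//.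
  have -> : (fun z => normc (f z) * expR (psi z)) =
      (fun z => expR (Re a) * (normc (f z) * expR (Re h.[cval z]))).
    by apply/funext => z; rewrite psig mulrCA -expRD hz ReD ReN subrKC.
  have mexp : measurable_fun setT (fun z : circle R => expR (Re h.[cval z])).
    by apply: measurableT_comp => //; case: (cmeasurable_horner h).
  have [B hB] := trigpoly_bounded (trigpoly_Re h).
  rewrite RintegralZl//; last first.
    apply: (@rintegrable_bounded _ _ _ _ _ _ (expR B)) => //.
    move=> z; rewrite ger0_norm ?expR_ge0// ler_expR (le_trans _ (hB z))//.
    exact: ler_norm.
  by rewrite mulrC ler_wpM2l ?expR_ge0//; exact: szego_trigpoly.
have mu_ n : measurable_fun setT (u n) by exact: measurable_bpclosure_trigpoly.
have mpsi : measurable_fun setT psi by apply/measurable_bpclosure_trigpoly/bpclosure_lim.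
have cpsi : (fun n => \int[mu]_z u n z) @ \oo --> \int[mu]_z psi z.
  have [|||_//] := @Rintegral_dct _ _ _ mu u psi (fun=> M) mu_ mpsi.
  - exact: rintegrable_cst.
  - by [].
  - exact: nearW.
have cexp : (fun n => \int[mu]_z (normc (f z) * expR (u n z))) @ \oo -->
    \int[mu]_z (normc (f z) * expR (psi z)).
  have [|||||_//] := @Rintegral_dct _ _ _ mu (fun n z => normc (f z) * expR (u n z))
    (fun z => normc (f z) * expR (psi z)) (fun z => expR M * normc (f z)).
  - by move=> n; apply: measurable_funM => //; exact: measurableT_comp.
  - by apply: measurable_funM => //; exact: measurableT_comp.
  - exact: rintegrableZ.
  - move=> n x; rewrite normrM ger0_norm ?normc_ge0// ger0_norm ?expR_ge0//.
    rewrite mulrC ler_wpM2r ?normc_ge0// ler_expR.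
    exact: le_trans (ler_norm _) (uM n x).
  - apply: nearW => x; apply: cvgM; first exact: cvg_cst.
    by apply: continuous_cvg; [exact: continuous_expR|exact: upsi].
apply: (ler_cvg_to _ cexp); last by apply: nearW => n; exact: ih.
apply: cvgM; first exact: cvg_cst.
apply: continuous_cvg; first exact: continuous_expR.
by apply: cvgM => //; exact: cvg_cst.
Qed.

(* If [f] vanishes on [E], testing on [M / mu E] times the indicator of [E] minus a
   constant shows that the integral of [f] is at most [exp (- M)] times a constant. *)
Lemma hardy_mean_eq0 (f : circle R -> R[i]) : cintegrable mu f ->
  (forall n, (1 <= n)%N -> cintegral mu (fun z => f z * cval z ^+ n) = 0) ->
  mu [set z | f z = 0] != 0%E -> cintegral mu f = 0.
Proof.
move=> intf f0; set E := [set z | f z = 0] => muE.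
have mE : measurable E.
  have mn := measurable_normc (cintegrable_measurable intf).
  have := mn measurableT _ (measurable_set1 0); rewrite setTI.
  congr measurable; apply/seteqP; split => z /=.
    by move/eq0_normc.
  by move=> ->; exact: normc0.
have muEfin : mu E \is a fin_num.
  rewrite ge0_fin_numE//; apply: le_lt_trans (le_measure mu _ _ (@subsetT _ E)) _.
  - by rewrite inE.
  - by rewrite inE.
  by rewrite (_ : _ setT = (2 * pi)%:E) ?ltry//; exact: arc_lengthT.
pose e := fine (mu E).
have e0 : 0 < e by rewrite lt0r fine_ge0// andbT fine_eq0.
have key M : normc (cintegral mu f) <= expR (- M) * \int[mu]_z normc (f z).
  (* The factor [2 * pi / e] makes the integral of [psi] vanish. Off [E] the weight is [exp (- M)];
     on [E] its size is harmless because [f] is 0 there. *)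
  pose psi z := M * (2 * pi) / e * \1_E z + - M.
  have cpsi : bpclosure (@trigpoly R) psi.
    apply: (bpclosureD (@trigpoly_bounded R) (@trigpolyD R)); last first.
      exact: (bpclosure_cst (@trigpoly_cst R)).
    apply: (bpclosureZ (@trigpoly_bounded R) (@trigpoly_cst R) (@trigpolyM R)).
    exact: bpclosure_trigpoly_indic.
  have intI : rintegrable mu (\1_E).
    apply: (@rintegrable_le_cst _ _ 1); first exact: measurable_indic.
    by move=> z; rewrite indicE; case: (_ \in _); rewrite ?normr0 ?normr1.
  have psi0 : \int[mu]_z psi z = 0.
    rewrite RintegralD//; last 2 first.
    - exact: rintegrableZ.
    - exact: rintegrable_cst.
    rewrite RintegralZl// Rintegral_cst_arc.
    have -> : \int[mu]_z \1_E z = e by rewrite /Rintegral integral_indic// setIT.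
    by rewrite mulfVK ?gt_eqF// mulNr subrr.
  have := szego intf f0 cpsi; rewrite psi0 mul0r expR0 mulr1.
  move=> /le_trans; apply; rewrite -RintegralZl//; last exact: cintegrable_normc.
  rewrite le_eqVlt; apply/orP; left; apply/eqP; apply: eq_Rintegral => z _; rewrite /psi indicE.
  have [zE|zE] := boolP (z \in E).
    move/set_mem : zE => /= ->; rewrite [normc 0](normc0 R).
    by rewrite mul0r mulr0.
  by rewrite mulr0 add0r mulrC.
apply/eqP; rewrite -normc_eq0 eq_le normc_ge0 andbT.
have c0 : (fun n => expR (- n%:R) * \int[mu]_z normc (f z)) @ \oo -->
    0 * \int[mu]_z normc (f z).
  apply: cvgM; last exact: cvg_cst.
  have q1 : `|expR (-1) : R| < 1.
    by rewrite ger0_norm ?expR_ge0// expR_lt1 ltrN10.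
  rewrite (_ : (fun _ => _) = (fun n => expR (-1) ^+ n)); first exact: cvg_expr.
  by apply/funext => n; rewrite -expRM_natr mulN1r.
rewrite mul0r in c0.
have key' n : normc (cintegral mu f) <= expR (- n%:R) * \int[mu]_z normc (f z) by exact: key.
by apply: (ler_cvg_to (cvg_cst (normc (cintegral mu f))) c0); exact: nearW.
Qed.

(** Strong induction on [k]: once the means of [f] against lower conjugate powers vanish, [f] times
    the conjugate of [z ^ k] satisfies the Hardy condition and has the zeros of [f], so its mean
    vanishes too. All Fourier coefficients of [f] are then 0, hence those of its real and imaginary
    parts. *)
Lemma hardy_uniqueness (f : circle R -> R[i]) : cintegrable mu f ->
  (forall n, (1 <= n)%N -> cintegral mu (fun z => f z * cval z ^+ n) = 0) ->
  mu [set z | f z = 0] != 0%E -> {ae mu, forall z, f z = 0}.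
Proof.
move=> intf f0 muE.
have intfJ k : cintegrable mu (fun z => f z * (cval z ^+ k)^*%C).
  apply: (@cintegrable_bounded _ _ _ _ _ _ 1) => //.
    exact/cmeasurable_conj/cmeasurable_valX.
  by move=> z; rewrite normc_conj normc_circleX.
have fJ k : cintegral mu (fun z => f z * (cval z ^+ k)^*%C) = 0.
  have [K] := ubnP k; elim: K k => // K ih k kK.
  apply: hardy_mean_eq0 => //.
    move=> n n1; have [kn|nk] := ltnP k n.
      rewrite -[RHS](f0 (n - k)%N) ?subn_gt0//; congr cintegral; apply/funext => z.
      rewrite -{1}(subnKC (ltnW kn)) exprD -!mulrA; congr (_ * _).
      by rewrite mulrA [X in X * _]mulrC circle_mulJX mul1r.
    rewrite -[RHS](ih (k - n)%N); last first.
      by rewrite ltnS in kK; rewrite (leq_trans _ kK)// ltn_subrL n1 (leq_trans n1).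
    congr cintegral; apply/funext => z.
    rewrite -{1}(subnK nk) exprD conjcM -!mulrA; congr (_ * _).
    by rewrite [X in _ * X]mulrC circle_mulJX mulr1.
  apply: contra_neq muE => e; rewrite -e; congr (_ _).
  apply/seteqP; split => z /=; first by move=> ->; rewrite mul0r.
  move/eqP; rewrite mulf_eq0 => /orP[/eqP//|/eqP h].
  by have := circle_mulJX z k; rewrite h mulr0 => /esym/eqP; rewrite oner_eq0.
have fX k : cintegral mu (fun z => f z * cval z ^+ k) = 0.
  case: k => [|k]; last exact: f0.
  by have := fJ 0; under eq_fun do rewrite expr0 conjc1 mulr1; under [in X in _ -> X]eq_fun do rewrite expr0 mulr1.
have cfX k : cintegral mu (fun z => (f z)^*%C * cval z ^+ k) = 0.
  have := cintegral_conj (intfJ k); rewrite fJ conjc0 => <-.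
  by congr cintegral; apply/funext => z; rewrite conjcM conjcK.
have intc := cintegrable_conj intf.
have [if1 if2] := intf.
have reX : {ae mu, forall z, Re (f z) = 0}.
  apply: fourier_uniqueness => // k.
  have -> : (fun z => (Re (f z))%:C%C * cval z ^+ k) =
     (fun z => 2^-1 * (f z * cval z ^+ k + (f z)^*%C * cval z ^+ k)).
    by apply/funext => z; rewrite ReJ_add; field.
  rewrite cintegral_fZ; last by apply: cintegrable_fD; exact: cintegrable_mulX.
  by rewrite cintegral_fD ?fX ?cfX ?addr0 ?mulr0//; exact: cintegrable_mulX.
have imX : {ae mu, forall z, Im (f z) = 0}.
  apply: fourier_uniqueness => // k.
  have -> : (fun z => (Im (f z))%:C%C * cval z ^+ k) =
     (fun z => (2^-1 * 'i%C) * ((f z)^*%C * cval z ^+ k + (-1) * (f z * cval z ^+ k))).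
    by apply/funext => z; rewrite ImJ_sub; field.
  rewrite cintegral_fZ; last first.
    by apply: cintegrable_fD; last apply: cintegrable_fZ; exact: cintegrable_mulX.
  rewrite cintegral_fD; last 2 first.
  - exact: cintegrable_mulX.
  - by apply: cintegrable_fZ; exact: cintegrable_mulX.
  rewrite cintegral_fZ ?fX ?cfX ?mulr0 ?addr0 ?mulr0//; exact: cintegrable_mulX.
by apply: filterS2 reX imX => z ? ?; exact: complexP.
Qed.

End Szego.

(** * Convexity and differentiability of [|x| ^ p] *)

Section PowerInequalities.
Variable R : realType.
Implicit Types (a b t p : R) (x k : R[i]).

Lemma powR_convex p a b t : 1 <= p -> 0 <= a -> 0 <= b -> 0 <= t <= 1 ->
  ((1 - t) * a + t * b) `^ p <= (1 - t) * a `^ p + t * b `^ p.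
Proof.
move=> p1 a0 b0 /andP[t0 t1].
have := @convex_powR R p p1 (Itv01 t0 t1) b a.
rewrite !inE/= !in_itv/= !andbT => /(_ b0 a0).
rewrite !convRE/= /unstable.onem => h.
by rewrite addrC [X in _ <= X]addrC; exact: h.
Qed.

Lemma powRD_le p a b : 0 <= p -> 0 <= a -> 0 <= b ->
  (a + b) `^ p <= 2 `^ p * (a `^ p + b `^ p).
Proof.
move=> p0 a0 b0.
have aux u v : 0 <= u -> u <= v -> (u + v) `^ p <= 2 `^ p * (u `^ p + v `^ p).
  move=> u0 uv; have v0 := le_trans u0 uv.
  apply: (@le_trans _ _ (2 `^ p * v `^ p)); last first.
    by rewrite ler_wpM2l ?powR_ge0// lerDr powR_ge0.
  rewrite -powRM//; apply: ge0_ler_powR => //; rewrite ?nnegrE ?addr_ge0 ?mulr_ge0//.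
  by rewrite mulr_natl mulr2n lerD2r.
have [ab|/ltW ba] := leP a b; first exact: aux.
by rewrite addrC [in X in _ <= X]addrC; exact: aux.
Qed.

(** A crude form of Young's inequality: the [p]-th power of the larger number is already a bound. It
    avoids the conjugate exponent, and so covers [p = 1]. *)
Lemma mulr_powR_le p a b : 1 <= p -> 0 <= a -> 0 <= b ->
  a * b `^ (p - 1) <= a `^ p + b `^ p.
Proof.
move=> p1 a0 b0; have p0 : 0 < p by exact: lt_le_trans p1.
have [ab|/ltW ba] := leP a b.
  apply: (@le_trans _ _ (b `^ p)); last by rewrite lerDr powR_ge0.
  by rewrite -[X in _ <= X](mulr_powRB1 b0 p0) ler_wpM2r ?powR_ge0.
apply: (@le_trans _ _ (a `^ p)); last by rewrite lerDl powR_ge0.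
rewrite -[X in _ <= X](mulr_powRB1 a0 p0) ler_wpM2l//.
by apply: ge0_ler_powR => //; rewrite subr_ge0.
Qed.

Lemma le_1D_powR p a : 1 <= p -> 0 <= a -> a <= 1 + a `^ p.
Proof.
move=> p1 a0; have [a1|/ltW a1] := leP a 1; first by rewrite (le_trans a1)// lerDl powR_ge0.
by rewrite (le_trans (le1r_powR a1 p1))// lerDr.
Qed.

(** The conjugate gives it the value 0 at 0, also when [p - 2] is negative. *)
Definition duality p x : R[i] := (normc x `^ (p - 2))%:C%C * (x^*)%C.

Lemma normc_duality p x : x != 0 -> normc (duality p x) = normc x `^ (p - 1).
Proof.
move=> x0; have nx : normc x != 0 by rewrite normc_eq0.
rewrite normcM normc_real normc_conj ger0_norm ?powR_ge0//.
rewrite -[X in _ * X](powRr1 (normc_ge0 x)) -powRD ?nx ?implybT//.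
by congr (_ `^ _); ring.
Qed.

Lemma normc_duality_le p x : normc (duality p x) <= normc x `^ (p - 1).
Proof.
have [->|x0] := eqVneq x 0; last by rewrite normc_duality.
by rewrite /duality conjc0 mulr0 [normc 0](normc0 R) powR_ge0.
Qed.

Lemma mul_duality p x : 0 < p -> x * duality p x = (normc x `^ p)%:C%C.
Proof.
move=> p0; have [->|x0] := eqVneq x 0.
  by rewrite mul0r [normc 0](normc0 R) powR0 ?gt_eqF.
have nx : normc x != 0 by rewrite normc_eq0.
rewrite mulrCA mul_conjc -rmorphM/= -powR_mulrn ?normc_ge0// -powRD ?nx ?implybT//.
by rewrite subrK.
Qed.

Lemma normc_duality_mul_le p k x : 1 <= p ->
  normc (k * duality p x) <= normc k `^ p + normc x `^ p.
Proof.
move=> p1; rewrite normcM; apply: le_trans (mulr_powR_le p1 (normc_ge0 k) (normc_ge0 x)).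
by rewrite ler_wpM2l ?normc_ge0// normc_duality_le.
Qed.

Definition diffquot p x k t := t^-1 * (normc (x + t%:C%C * k) `^ p - normc x `^ p).

Lemma normcZ_real t k : 0 <= t -> normc (t%:C%C * k) = t * normc k.
Proof. by move=> t0; rewrite normcM normc_real ger0_norm. Qed.

(** By convexity, [x + t k] being a barycentre of [x] and [x + k]. Neither this bound nor the lower
    one depends on [t]: they dominate the difference quotients under the integral. *)
Lemma diffquot_le p x k t : 1 <= p -> 0 < t <= 1 ->
  diffquot p x k t <= normc (x + k) `^ p - normc x `^ p.
Proof.
move=> p1 /andP[t0 t1]; rewrite /diffquot ler_pdivrMl//.
have p0 : 0 <= p by exact: le_trans p1.
have : normc (x + t%:C%C * k) `^ p <= ((1 - t) * normc x + t * normc (x + k)) `^ p.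
  apply: ge0_ler_powR => //; rewrite ?nnegrE ?normc_ge0//.
    by rewrite addr_ge0// mulr_ge0 ?normc_ge0 ?subr_ge0// ltW.
  have -> : x + t%:C%C * k = (1 - t)%:C%C * x + t%:C%C * (x + k).
    by rewrite rmorphB rmorph1; ring.
  by rewrite (le_trans (ler_normcD _ _))// !normcZ_real ?subr_ge0// ltW.
have : ((1 - t) * normc x + t * normc (x + k)) `^ p <=
    (1 - t) * normc x `^ p + t * normc (x + k) `^ p.
  by apply: powR_convex; rewrite ?normc_ge0// t1 ltW.
move=> h1 h2; have := le_trans h2 h1; lra.
Qed.

(** Here [x] is the barycentre of [x + t k] and [x - k], the latter with weight
    [s = t / (1 + t)]. *)
Lemma diffquot_ge p x k t : 1 <= p -> 0 < t <= 1 ->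
  normc x `^ p - normc (x - k) `^ p <= diffquot p x k t.
Proof.
move=> p1 /andP[t0 t1]; rewrite /diffquot ler_pdivlMl//.
have p0 : 0 <= p by exact: le_trans p1.
set s := t / (1 + t); have t10 : 0 < 1 + t by rewrite addr_gt0.
have s01 : 0 <= s <= 1.
  by rewrite /s (divr_ge0 (ltW t0) (ltW t10))/= ler_pdivrMr// mul1r lerDr.
have /andP[s0 s1] := s01.
have s1E : 1 - s = (1 + t)^-1 by rewrite /s; field; rewrite gt_eqF.
have : normc x `^ p <= ((1 - s) * normc (x + t%:C%C * k) + s * normc (x - k)) `^ p.
  apply: ge0_ler_powR => //; rewrite ?nnegrE ?normc_ge0//.
    by rewrite addr_ge0// mulr_ge0 ?normc_ge0 ?subr_ge0.
  have {1}-> : x = (1 - s)%:C%C * (x + t%:C%C * k) + s%:C%C * (x - k).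
    have e : (1 - s) * t = s by rewrite s1E /s mulrC.
    have -> : (1 - s)%:C%C * (x + t%:C%C * k) = (1 - s)%:C%C * x + ((1 - s) * t)%:C%C * k.
      by rewrite rmorphM mulrDr mulrA.
    by rewrite e rmorphB rmorph1; ring.
  by rewrite (le_trans (ler_normcD _ _))// !normcZ_real ?subr_ge0.
have := powR_convex p1 (normc_ge0 (x + t%:C%C * k)) (normc_ge0 (x - k)) s01.
move=> h1 h2; have := le_trans h2 h1; rewrite s1E /s -(ler_pM2l t10).
set u := normc _ `^ p; set v := normc _ `^ p; set w := normc _ `^ p.
have -> : (1 + t) * ((1 + t)^-1 * v + t / (1 + t) * w) = v + t * w.
  by field; rewrite gt_eqF.
lra.
Qed.

(** [|x + t k| ^ 2] is a polynomial [Q] in [t], positive at 0 since [x] is nonzero, so [Q ^ (p / 2)]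
    is differentiable at 0. *)
Lemma diffquot_cvg p x k : x != 0 ->
  (fun n => diffquot p x k n.+1%:R^-1) @ \oo --> p * Re (k * duality p x).
Proof.
move=> x0; pose Q (t : R) := normc x ^+ 2 + t * (2 * Re (k * (x^*)%C)) + t ^+ 2 * normc k ^+ 2.
have QE t : normc (x + t%:C%C * k) ^+ 2 = Q t.
  by rewrite /Q !normc_sqr !reimE/=; ring.
have nx : 0 < normc x by rewrite normc_gt0.
have Q0 : Q 0 = normc x ^+ 2 by rewrite /Q; ring.
have GE t : normc (x + t%:C%C * k) `^ p = Q t `^ (p / 2).
  by rewrite -QE -powR_mulrn ?normc_ge0// -powRrM; congr (_ `^ _); field.
have dQ : is_derive (0 : R) (1 : R) Q (2 * Re (k * (x^*)%C)).
  rewrite /Q; apply: is_derive_eq.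
  by rewrite /GRing.scale/= !(mulr1, mul1r, mulr0, mul0r, addr0, add0r, scaler0, expr0n)/=; ring.
have dG : is_derive (0 : R) (1 : R) (fun t => Q t `^ (p / 2)) (p * Re (k * duality p x)).
  have Q0gt : 0 < Q 0 by rewrite Q0 exprn_gt0.
  have := @is_derive1_comp _ (fun u : R => u `^ (p / 2)) Q 0 _ _ (is_derive1_powR (p / 2) Q0gt) dQ.
  move=> h; apply: is_derive_eq h _; rewrite Q0 -powR_mulrn ?normc_ge0// -powRrM.
  have -> : 2%:R * (p / 2 - 1) = p - 2 by field.
  by rewrite /duality [k * (_ * _)]mulrCA ReZ; field.
have [dG1 dG2] := dG.
have cv : t^-1 * (Q t `^ (p / 2) - Q 0 `^ (p / 2)) @[t --> (0:R)^'] --> p * Re (k * duality p x).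
  have : derivable (fun t => Q t `^ (p / 2)) 0 1 by [].
  move=> /cvg_ex[l hl]; have l2 : l = p * Re (k * duality p x).
    by rewrite -dG2 /derive; apply/esym/cvg_lim => //; exact: hl.
  rewrite -l2; apply: cvg_trans hl; apply: near_eq_cvg; apply: nearW => t /=.
  by rewrite /GRing.scale/= mulr1 addr0.
have E n : diffquot p x k n.+1%:R^-1 =
    (n.+1%:R^-1)^-1 * (Q n.+1%:R^-1 `^ (p / 2) - Q 0 `^ (p / 2)).
  have G0 : normc x `^ p = Q 0 `^ (p / 2) by rewrite -GE mul0r addr0.
  by rewrite /diffquot GE G0.
under eq_fun do rewrite E.
have := cvg_dnbhs_at_right cv; move=> /cvg_at_rightP /(_ (fun n => n.+1%:R^-1)).
by apply; split; [move=> n; rewrite invr_gt0|exact: (@cvg_harmonic R)].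
Qed.

End PowerInequalities.

(** * First variation of the [L_p] norm *)

Section CircleLp.
Variable R : realType.
Variable p : R.
Hypothesis p1 : 1 <= p.
Local Notation mu := (@arc_length R).
Implicit Types f g x k : circle R -> R[i].

Let p_gt0 : 0 < p. Proof. exact: lt_le_trans p1. Qed.
Let p_ge0 : 0 <= p. Proof. exact: ltW. Qed.

Definition inLp f := cmeasurable f /\ rintegrable mu (fun z => normc (f z) `^ p).

Lemma measurable_normc_powR f q : cmeasurable f ->
  measurable_fun setT (fun z => normc (f z) `^ q).
Proof. by move=> /measurable_normc h; exact: (measurableT_comp (measurable_powR q) h). Qed.

Lemma inLpD f g : inLp f -> inLp g -> inLp (fun z => f z + g z).
Proof.
move=> [mf nf] [mg ng]; split; first exact: cmeasurable_fD.
apply: (@le_rintegrable _ _ _ _ _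
  (fun z => 2 `^ p * (normc (f z) `^ p + normc (g z) `^ p))).
- exact/measurable_normc_powR/cmeasurable_fD.
- by apply: rintegrableZ; exact: rintegrableD.
- move=> z; rewrite ger0_norm ?powR_ge0//.
  apply: le_trans (powRD_le p_ge0 (normc_ge0 _) (normc_ge0 _)).
  by apply: ge0_ler_powR => //; rewrite ?nnegrE ?addr_ge0 ?normc_ge0// ler_normcD.
Qed.

Lemma inLpZ a f : inLp f -> inLp (fun z => a * f z).
Proof.
move=> [mf nf]; split; first by apply: cmeasurable_fM => //; exact: cmeasurable_cst.
under eq_fun do rewrite normcM powRM ?normc_ge0//.
exact: rintegrableZ.
Qed.

Lemma inLp_sum I (s : seq I) (F : I -> circle R -> R[i]) :
  (forall i, inLp (F i)) -> inLp (fun z => \sum_(i <- s) F i z).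
Proof.
move=> iF; elim: s => [|a s ih].
  under eq_fun do rewrite big_nil; split; first exact: cmeasurable_cst.
  by under eq_fun do rewrite [normc 0](normc0 R) powR0 ?gt_eqF//; exact: rintegrable0.
by under eq_fun do rewrite big_cons; exact: inLpD.
Qed.

Lemma inLpB f g : inLp f -> inLp g -> inLp (fun z => f z - g z).
Proof.
move=> Lf Lg; under eq_fun do rewrite -mulN1r; apply: inLpD => //; exact: inLpZ.
Qed.

Lemma inLp_mulX f n : inLp f -> inLp (fun z => f z * cval z ^+ n).
Proof.
move=> [mf nf]; split; first by apply: cmeasurable_fM => //; exact: cmeasurable_valX.
by under eq_fun do rewrite normcM normc_circleX mulr1.
Qed.

Lemma inLp_cintegrable f : inLp f -> cintegrable mu f.
Proof.
move=> [mf nf]; apply: (@le_cintegrable _ _ _ _ _ (fun z => 1 + normc (f z) `^ p)) => //.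
  by apply: rintegrableD => //; exact: rintegrable_cst.
by move=> z; rewrite le_1D_powR// normc_ge0.
Qed.

Lemma cmeasurable_duality x : cmeasurable x -> cmeasurable (fun z => duality p (x z)).
Proof.
move=> mx; apply: cmeasurable_fM; last exact: cmeasurable_conj.
exact/cmeasurable_real/measurable_normc_powR.
Qed.

Lemma cintegrable_duality f x : inLp f -> inLp x ->
  cintegrable mu (fun z => f z * duality p (x z)).
Proof.
move=> [mf nf] [mx nx].
apply: (@le_cintegrable _ _ _ _ _ (fun z => normc (f z) `^ p + normc (x z) `^ p)).
- by apply: cmeasurable_fM => //; exact: cmeasurable_duality.
- exact: rintegrableD.
- by move=> z; exact: normc_duality_mul_le.
Qed.

(** The right derivative at 0 of a function with a minimum there is nonnegative; dominated
    convergence along [1 / (n + 1)] identifies it, the pointwise limits existing where [x] does not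
    vanish. *)
Lemma norm_variation_ge0 x k : inLp x -> inLp k -> {ae mu, forall z, x z != 0} ->
  (forall t : R, \int[mu]_z normc (x z) `^ p <= \int[mu]_z normc (x z + t%:C%C * k z) `^ p) ->
  0 <= Re (cintegral mu (fun z => k z * duality p (x z))).
Proof.
move=> Lx Lk x0 mint.
have Lxk t : inLp (fun z => x z + t * k z) by apply: inLpD => //; exact: inLpZ.
have [mx nx] := Lx; have [mk nk] := Lk.
have Lxp : inLp (fun z => x z + k z) by exact: inLpD.
have Lxm : inLp (fun z => x z - k z) by exact: inLpB.
have intkJ := cintegrable_duality Lk Lx.
pose q n z := diffquot p (x z) (k z) n.+1%:R^-1.
have intq n : rintegrable mu (q n).
  by apply: rintegrableZ; apply: rintegrableB => //; case: (Lxk (n.+1%:R^-1)%:C%C).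
have q0 n : 0 <= \int[mu]_z q n z.
  rewrite /q /diffquot RintegralZl//; last first.
    by apply: rintegrableB => //; case: (Lxk (n.+1%:R^-1)%:C%C).
  rewrite mulr_ge0 ?invr_ge0// RintegralB//; last by case: (Lxk (n.+1%:R^-1)%:C%C).
  by rewrite subr_ge0.
have [|||||_ cv] := @Rintegral_dct _ _ _ mu q (fun z => p * Re (k z * duality p (x z)))
  (fun z => normc (x z) `^ p + normc (x z + k z) `^ p + normc (x z - k z) `^ p).
- by move=> n; exact: rintegrable_measurable (intq n).
- by apply: measurable_funM => //; case: (cintegrable_measurable intkJ).
- by apply: rintegrableD; [apply: rintegrableD => //; case: Lxp|case: Lxm].
- move=> n z; have n01 : 0 < (n.+1%:R^-1 : R) <= 1.
    by rewrite invr_gt0 ltr0n/= invf_le1 ?ler1n ?ltr0n.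
  have h1 := diffquot_le (x z) (k z) p1 n01; have h2 := diffquot_ge (x z) (k z) p1 n01.
  have := powR_ge0 (normc (x z)) p; have := powR_ge0 (normc (x z + k z)) p.
  have := powR_ge0 (normc (x z - k z)) p.
  rewrite -/(q n z) in h1 h2 *; rewrite ler_norml; lra.
- by apply: filterS x0 => z xz; exact: diffquot_cvg.
have : 0 <= \int[mu]_z (p * Re (k z * duality p (x z))).
  by apply: (ler_cvg_to (cvg_cst 0) cv); exact: nearW.
by rewrite RintegralZl//; [rewrite pmulr_rge0|case: intkJ].
Qed.

(* Metric orthogonality of [k] to [x] is orthogonality to the norming functional of [x]. *)
Lemma norm_variation x k : inLp x -> inLp k -> {ae mu, forall z, x z != 0} ->
  (forall t : R[i], \int[mu]_z normc (x z) `^ p <= \int[mu]_z normc (x z + t * k z) `^ p) ->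
  cintegral mu (fun z => k z * duality p (x z)) = 0.
Proof.
move=> Lx Lk x0 mint.
have intkJ := cintegrable_duality Lk Lx.
have key a : 0 <= Re (a * cintegral mu (fun z => k z * duality p (x z))).
  rewrite -cintegral_fZ//; under eq_fun do rewrite mulrA.
  apply: (norm_variation_ge0 Lx (inLpZ a Lk) x0) => t.
  apply: (le_trans (mint (t%:C%C * a))).
  by under eq_fun do rewrite -mulrA.
set I := cintegral _ _ in key *.
(* The four directions 1, -1, [i], [-i] bound both parts of the integral from both sides. *)
have := key (Complex 1 0); have := key (Complex (-1) 0).
have := key (Complex 0 1); have := key (Complex 0 (-1)).
by rewrite !ReM; case: I {key} => u v /= *; apply: complexP => /=; lra.
Qed.

Definition inHp f := inLp f /\
  forall n, (1 <= n)%N -> cintegral mu (fun z => f z * cval z ^+ n) = 0.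

Lemma inHp_mulX f n : inHp f -> inHp (fun z => f z * cval z ^+ n).
Proof.
move=> [Lf Hf]; split; first exact: inLp_mulX.
move=> m m1; under eq_fun do rewrite -mulrA -exprD.
by apply: Hf; rewrite (leq_trans m1)// leq_addl.
Qed.

Lemma inHpD f g : inHp f -> inHp g -> inHp (fun z => f z + g z).
Proof.
move=> [Lf Hf] [Lg Hg]; split; first exact: inLpD.
move=> n n1; under eq_fun do rewrite mulrDl.
by rewrite cintegral_fD ?Hf ?Hg ?addr0//; exact/cintegrable_mulX/inLp_cintegrable.
Qed.

Lemma inHpZ a f : inHp f -> inHp (fun z => a * f z).
Proof.
move=> [Lf Hf]; split; first exact: inLpZ.
move=> n n1; under eq_fun do rewrite -mulrA.
by rewrite cintegral_fZ ?Hf ?mulr0//; exact/cintegrable_mulX/inLp_cintegrable.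
Qed.

Lemma inHp_sum I (s : seq I) (F : I -> circle R -> R[i]) :
  (forall i, inHp (F i)) -> inHp (fun z => \sum_(i <- s) F i z).
Proof.
move=> iF; elim: s => [|a s ih]; last by under eq_fun do rewrite big_cons; exact: inHpD.
split; first by apply: inLp_sum => i; case: (iF i).
move=> n n1; under eq_fun do rewrite big_nil mul0r; exact: cintegral0.
Qed.

Lemma inHp_ae_neq0 f : inHp f -> ~ {ae mu, forall z, f z = 0} ->
  {ae mu, forall z, f z != 0}.
Proof.
move=> [Lf Hf] nf; have intf := inLp_cintegrable Lf.
have mE : measurable [set z | f z = 0].
  have mn := measurable_normc (cintegrable_measurable intf).
  have := mn measurableT _ (measurable_set1 0); rewrite setTI.
  congr measurable; apply/seteqP; split => z /=; first by move/eq0_normc.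
  by move=> ->; exact: normc0.
have [E0|E0] := eqVneq (mu [set z | f z = 0]) 0%E.
  by exists [set z | f z = 0]; split => // z /= /negP; rewrite negbK => /eqP.
by case: nf; exact: hardy_uniqueness.
Qed.

End CircleLp.

(** * Expansions at 0 of powers of distances *)

Section PowerExpansion.
Variable R : realType.
Implicit Types (a p t s : R) (P Q : {poly R}).

Definition poly_primitive P : {poly R} := \poly_(i < (size P).+1) (P`_i.-1 / i%:R *+ (i != 0)).

Lemma deriv_primitive P : (poly_primitive P)^`() = P.
Proof.
apply/polyP => i; rewrite coef_deriv coef_poly ltnS /= mulr1n.
case: ltnP => si; last by rewrite mul0rn nth_default.
by rewrite -[_ *+ i.+1]mulr_natr mulfVK// pnatr_eq0.
Qed.

Lemma horner_primitive0 P : (poly_primitive P).[0] = 0.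
Proof. by rewrite horner_coef0 coef_poly /= mulr0n. Qed.

(** Taylor's formula by induction on the order: the approximation of the derivative, which has
    exponent [a - 1], is integrated, and the mean value theorem gains one power of [|s|]. *)
Lemma powR1D_expansion M a : exists P C, forall s, `|s| <= 2^-1 ->
  `|(1 + s) `^ a - P.[s]| <= C * `|s| ^+ M.
Proof.
elim: M a => [|M ih] a.
  (* [1 + s] lies in [1/2, 3/2]; the two summands bound its power for [a] of either sign. *)
  exists 0, ((3 / 2) `^ a + 2^-1 `^ a) => s; rewrite ler_norml => /andP[s1 s2].
  rewrite expr0 mulr1 horner0 subr0 ger0_norm ?powR_ge0//.
  have [a0|a0] := leP 0 a.
    apply: (@le_trans _ _ ((3 / 2) `^ a)); last by rewrite lerDl powR_ge0.
    by apply: ge0_ler_powR => //; rewrite ?nnegrE; lra.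
  apply: (@le_trans _ _ (2^-1 `^ a)); last by rewrite lerDr powR_ge0.
  rewrite -[a]opprK !(powRN _ (- a)) lef_pV2 ?posrE ?powR_gt0//; last by lra.
  by apply: ge0_ler_powR; rewrite ?nnegrE; lra.
have [P [C PC]] := ih (a - 1).
exists (1 + a *: poly_primitive P), (`|a| * C) => s hs.
have C0 : 0 <= C * `|s| ^+ M by exact: le_trans (PC s hs).
pose Q := 1 + a *: poly_primitive P.
pose r t := (1 + t) `^ a - Q.[t].
have r0 : r 0 = 0.
  by rewrite /r addr0 powR1 /Q hornerD hornerZ horner_primitive0 mulr0 addr0 hornerC subrr.
have dr t : `|t| <= 2^-1 -> is_derive t 1 r (a * ((1 + t) `^ (a - 1) - P.[t])).
  rewrite ler_norml => /andP[t1 t2].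
  have t10 : 0 < 1 + t by lra.
  have d1 : is_derive t (1 : R) (fun u : R => 1 + u) 1.
    by have := is_deriveD (is_derive_cst (1 : R) t 1) (is_derive_id t 1); rewrite add0r.
  have d2 := @is_derive1_comp _ (fun u => u `^ a) (fun t => 1 + t) t _ _ (is_derive1_powR a t10) d1.
  have d3 : is_derive t 1 (fun t => Q.[t]) Q^`().[t] by exact: is_derive_poly.
  apply: is_derive_eq (is_deriveB d2 d3) _.
  have -> : Q^`() = a *: P.
    by rewrite /Q derivD derivZ deriv_primitive derivC add0r.
  by rewrite hornerZ; ring.
have bnd t : `|t| <= `|s| -> `|a * ((1 + t) `^ (a - 1) - P.[t])| <= `|a| * C * `|s| ^+ M.
  move=> ts; rewrite normrM -mulrA ler_wpM2l//; apply: le_trans (PC t (le_trans ts hs)) _.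
  have [s0|s0] := eqVneq s 0.
    by move: ts; rewrite s0 normr0 normr_le0 => /eqP ->; rewrite normr0.
  have C0' : 0 <= C by move: C0; rewrite pmulr_lge0// exprn_gt0// normr_gt0.
  by rewrite ler_wpM2l// lerXn2r ?nnegrE.
have crt t : `|t| <= 2^-1 -> {for t, continuous r}.
  move=> ht; apply: differentiable_continuous; apply/derivable1_diffP.
  by have := dr t ht; case.
have mvt u v : u < v -> (forall t, u <= t <= v -> `|t| <= `|s|) ->
    exists2 c, `|c| <= `|s| & r v - r u = a * ((1 + c) `^ (a - 1) - P.[c]) * (v - u).
  move=> uv uvs.
  have [||c cuv ->] := @MVT _ r (fun t => a * ((1 + t) `^ (a - 1) - P.[t])) u v uv.
  - move=> t; rewrite in_itv/= => /andP[ut tv]; apply: dr.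
    by rewrite (le_trans _ hs)// uvs// !ltW.
  - apply: continuous_in_subspaceT => t; rewrite inE /= in_itv/= => tuv.
    by apply: crt; rewrite (le_trans _ hs)// uvs.
  - by exists c => //; apply: uvs; move: cuv; rewrite in_itv/= => /andP[/ltW-> /ltW->].
rewrite -[X in `|X|]/(r s); have [s0|s0|s0] := ltgtP s 0.
- have [|c cs] := mvt s 0 s0.
    by move=> t /andP[st t0]; rewrite (ler0_norm t0) (ltr0_norm s0) lerN2.
  rewrite r0 !sub0r => e; rewrite -[r s]opprK normrN e normrM normrN exprSr mulrA.
  by rewrite ler_wpM2r// bnd.
- have [|c cs] := mvt 0 s s0.
    by move=> t /andP[t0 ts]; rewrite (ger0_norm t0) (gtr0_norm s0).
  rewrite r0 !subr0 => ->; rewrite normrM exprSr mulrA.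
  by rewrite ler_wpM2r// bnd.
- by rewrite s0 r0 normr0 expr0n mulr0.
Qed.

(** [|t - b| ^ 2] is [|b| ^ 2 (1 + S)] with [S] a polynomial in [t] vanishing at 0, so the expansion
    of [(1 + s) ^ (p / 2)] is composed with [S]. *)
Lemma normcB_powR_expansion M p (b : R[i]) : b != 0 -> exists P C d, 0 < d /\
  forall t, `|t| <= d -> `|normc (t%:C%C - b) `^ p - P.[t]| <= C * `|t| ^+ M.
Proof.
move=> b0; have nb : 0 < normc b by rewrite normc_gt0.
have [P [C PC]] := powR1D_expansion M (p / 2).
pose N := normc b ^+ 2; have N0 : 0 < N by rewrite exprn_gt0.
pose S : {poly R} := N^-1 *: ('X^2 - (2 * Re b) *: 'X).
have SE t : S.[t] = (t ^+ 2 - 2 * Re b * t) / N.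
  by rewrite /S !hornerE mulrC.
pose K := (1 + 2 * `|Re b|) / N.
have K0 : 0 < K by rewrite divr_gt0// ltr_pwDl// mulr_ge0.
have SK t : `|t| <= 1 -> `|S.[t]| <= K * `|t|.
  move=> t1; rewrite SE normrM normfV (gtr0_norm N0) /K [X in _ <= X]mulrAC ler_wpM2r ?invr_ge0 ?(ltW N0)//.
  have -> : t ^+ 2 - 2 * Re b * t = t * (t - 2 * Re b) by ring.
  rewrite normrM mulrC ler_wpM2r// (le_trans (ler_normB _ _))// lerD//.
  by rewrite normrM ger0_norm.
(* As [|S|] is at most [K |t|] for [|t| <= 1], this radius keeps [|S|] below 1/2. *)
exists ((normc b `^ p) *: (P \Po S)), (normc b `^ p * (C * K ^+ M)), (Num.min 1 (2 * K)^-1).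
split; first by rewrite lt_min ltr01 invr_gt0 mulr_gt0.
move=> t; rewrite le_min => /andP[t1 t2].
have hS : `|S.[t]| <= 2^-1.
  by apply: le_trans (SK t t1) _; rewrite -ler_pdivlMl// (le_trans t2)// invfM mulrC.
have -> : normc (t%:C%C - b) `^ p = normc b `^ p * (1 + S.[t]) `^ (p / 2).
  have e : normc (t%:C%C - b) ^+ 2 = N * (1 + S.[t]).
    rewrite SE mulrDr mulr1 mulrCA mulfV ?mulr1 ?gt_eqF// /N !normc_sqr !reimE; ring.
  have S1 : 0 <= 1 + S.[t] by move: hS; rewrite ler_norml => /andP[]; lra.
  have e2 (x : R[i]) : normc x `^ p = (normc x ^+ 2) `^ (p / 2).
    by rewrite -powR_mulrn ?normc_ge0// -powRrM; congr (_ `^ _); field.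
  by rewrite e2 e powRM// ?(ltW N0)// e2.
rewrite [(_ *: (P \Po S)).[t]]hornerZ horner_comp -mulrBr normrM ger0_norm ?powR_ge0// -!mulrA.
rewrite ler_wpM2l ?powR_ge0//; apply: le_trans (PC _ hS) _.
have [->|t0] := eqVneq t 0.
  have -> : S.[0] = 0 by rewrite SE; ring.
  rewrite !normr0; case: (M) => [|M']; first by rewrite !expr0 mul1r.
  by rewrite !expr0n !mulr0.
have C0 : 0 <= C.
  have := PC 2^-1; rewrite ger0_norm// lexx => /(_ isT) h.
  by move: (le_trans (normr_ge0 _) h); rewrite pmulr_lge0// exprn_gt0.
by rewrite ler_wpM2l// -exprMn lerXn2r ?nnegrE ?SK// mulr_ge0// ltW.
Qed.

(** The constant coefficient is a limit of values tending to 0; then [Q] is divided by [X]. The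
    bound is asked for nonzero [t] only, so that it survives this division. *)
Lemma poly_bigO_coef M Q (C d : R) : 0 < d ->
  (forall t, 0 < `|t| <= d -> `|Q.[t]| <= C * `|t| ^+ M) ->
  forall i, (i < M)%N -> Q`_i = 0.
Proof.
elim: M Q => // M ih Q d0 QC.
have Q0 : Q`_0 = 0.
  rewrite -horner_coef0.
  have cv (P : {poly R}) : (fun n => P.[d * n.+1%:R^-1]) @ \oo --> P.[0].
    apply: continuous_cvg; first exact: continuous_horner.
    have : (fun n => d * n.+1%:R^-1) @ \oo --> d * 0.
      by apply: cvgM; [exact: cvg_cst|exact: (@cvg_harmonic R)].
    by rewrite mulr0.
  have cQ := cv Q; have := cv (C *: 'X^(M.+1)).
  under eq_fun do rewrite hornerZ hornerXn.
  rewrite hornerZ hornerXn expr0n mulr0 => cC.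
  apply/eqP; rewrite -normr_le0; apply: (ler_cvg_to (cvg_norm cQ) cC).
  apply: nearW => n; have dn : 0 < d * n.+1%:R^-1 by rewrite mulr_gt0// invr_gt0.
  have := QC (d * n.+1%:R^-1); rewrite (gtr0_norm dn) dn /=; apply.
  by rewrite ger_pMr// invf_le1 ?ltr0n// ler1n.
have [Q1 QE] : exists Q1, Q = Q1 * 'X.
  have /factor_theorem : root Q 0 by rewrite /root horner_coef0 Q0.
  by rewrite subr0.
case=> [//|i]; rewrite ltnS => iM; rewrite QE coefMX /=.
apply: ih => // t td; have := QC t td; rewrite QE hornerM hornerX normrM exprSr mulrA.
by rewrite ler_pM2r//; case/andP: td.
Qed.

(* Comparing [t] with [2 t] shows that the expansion of [`|t| `^ p] can only contain
   the monomial of degree [p]. *)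
Lemma norm_powR_expansion_even M p P (C d : R) : 0 < p -> p < M%:R -> 0 < d ->
  (forall t, 0 < `|t| <= d -> `| `|t| `^ p - P.[t]| <= C * `|t| ^+ M) ->
  exists k : nat, p = k.*2%:R.
Proof.
move=> p0 pM d0 PC.
pose P2 : {poly R} := \poly_(i < size P) (2 ^+ i * P`_i).
have P2E t : P2.[t] = P.[2 * t].
  rewrite horner_poly horner_coef; apply: eq_bigr => i _.
  by rewrite exprMn; ring.
have P2c i : P2`_i = 2 ^+ i * P`_i.
  by rewrite coef_poly; case: ltnP => // /(nth_default 0) ->; rewrite mulr0.
have Qc : forall i, (i < M)%N -> (P2 - (2 `^ p) *: P)`_i = 0.
  apply: (@poly_bigO_coef M _ (C * 2 ^+ M + 2 `^ p * C) (d / 2)).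
    by rewrite divr_gt0.
  move=> t /andP[t0 td].
  have n2 : `|2 * t| = 2 * `|t| by rewrite normrM ger0_norm.
  have h1 := PC (2 * t); rewrite n2 in h1.
  have h2 := PC t.
  rewrite hornerD hornerN hornerZ P2E.
  have -> : P.[2 * t] - 2 `^ p * P.[t] =
     2 `^ p * (`|t| `^ p - P.[t]) - ((2 * `|t|) `^ p - P.[2 * t]).
    by rewrite powRM//; ring.
  apply: le_trans (ler_normB _ _) _; rewrite [(C * _ + _) * _]mulrDl addrC; apply: lerD.
    by rewrite -mulrA -exprMn; apply: h1; lra.
  rewrite normrM (ger0_norm (powR_ge0 _ _)) -mulrA ler_wpM2l ?powR_ge0//.
  by apply: h2; lra.
have Pc i : (i < M)%N -> i%:R != p -> P`_i = 0.
  move=> iM ip; have := Qc i iM.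
  rewrite coefB coefZ P2c -mulrBl => /eqP; rewrite mulf_eq0 => /orP[|/eqP//].
  rewrite subr_eq0 -powR_mulrn// => /eqP e.
  have : ln (2 `^ i%:R : R) = ln (2 `^ p) by rewrite e.
  rewrite !ln_powR => /mulIf; rewrite gt_eqF ?ln_gt0 ?ltr1n// => /(_ isT) ip'.
  by rewrite ip' eqxx in ip.
have main (k : nat) (c : R) : (k < M)%N -> (forall i, (i < M)%N -> (c *: 'X^k - P)`_i = 0) ->
    exists C' d', 0 < d' /\
    forall t, 0 < `|t| <= d' -> `| `|t| `^ p - c * t ^+ k| <= C' * `|t| ^+ M.
  move=> kM cP; have [Q QE] : exists Q, P = c *: 'X^k + Q * 'X^M.
    exists (drop_poly M P); rewrite -{1}(poly_take_drop M P); congr (_ + _).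
    apply/polyP => i; rewrite coef_take_poly; case: ifP => iM.
      by have := cP i iM; rewrite coefB => /eqP; rewrite subr_eq0 => /eqP.
    by rewrite coefZ coefXn (gtn_eqF (leq_trans kM _)) ?mulr0// leqNgt iM.
  have [B BQ] : exists B, forall t, `|t| <= 1 -> `|Q.[t]| <= B.
    exists (\sum_(i < size Q) `|Q`_i|) => t t1; rewrite horner_coef.
    apply: le_trans (ler_norm_sum _ _ _) _; apply: ler_sum => i _.
    by rewrite normrM normrX ler_piMr// exprn_ile1.
  exists (C + B), (Num.min d 1); split; first by rewrite lt_min d0 ltr01.
  move=> t /andP[t0]; rewrite le_min => /andP[td t1].
  have := PC t; rewrite t0 td => /(_ isT); rewrite QE hornerD hornerZ hornerXn hornerM hornerXn.
  move=> h; rewrite (_ : _ - _ = (`|t| `^ p - (c * t ^+ k + Q.[t] * t ^+ M)) + Q.[t] * t ^+ M); last by ring.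
  apply: le_trans (ler_normD _ _) _; rewrite mulrDl lerD// normrM normrX.
  by rewrite ler_wpM2r// BQ.
(* Since [p < M], dividing by [t ^ p] leaves a positive power of [t], which tends to 0. *)
have noO (a B d' : R) : 0 < d' -> (forall t, 0 < t <= d' -> `|a * t `^ p| <= B * t ^+ M) -> a = 0.
  move=> d'0 aB.
  have aB' t : 0 < t <= d' -> `|a| <= B * t `^ (M%:R - p).
    move=> /[dup] /andP[t0 _] /aB; rewrite normrM (ger0_norm (powR_ge0 _ _)).
    rewrite -ler_pdivlMr ?powR_gt0// => /le_trans; apply.
    rewrite -mulrA ler_wpM2l//.
      have := aB d'; rewrite lexx d'0 => /(_ isT) /(le_trans (normr_ge0 _)).
      by rewrite pmulr_lge0// exprn_gt0.
    by rewrite powRB ?(gt_eqF t0) ?implybT// powR_mulrn ?(ltW t0).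
  have cB : (fun n : nat => B * (d' * n.+1%:R^-1) `^ (M%:R - p)) @ \oo --> B * 0.
    apply: cvgM; first exact: cvg_cst.
    have := @powR_cvg0 R (M%:R - p); rewrite subr_gt0 => /(_ pM) /cvg_at_rightP; apply.
    split; first by move=> n; rewrite mulr_gt0// invr_gt0.
    have : (fun n => d' * n.+1%:R^-1) @ \oo --> d' * 0.
      by apply: cvgM; [exact: cvg_cst|exact: (@cvg_harmonic R)].
    by rewrite mulr0.
  apply/eqP; rewrite -normr_le0 -(mulr0 B); apply: (ler_cvg_to (cvg_cst `|a|) cB).
  apply: nearW => n; apply: aB'; rewrite mulr_gt0 ?invr_gt0//=.
  by rewrite ger_pMr// invf_le1 ?ltr0n// ler1n.
(* If [p] is not a natural number, all coefficients below [M] vanish and [|t| ^ p] itself would be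
   of order [t ^ M]. *)
have [[k kp]|nk] := pselect (exists k : nat, k%:R = p); last first.
  have M0 : (0 < M)%N by rewrite -(ltr0n R) (lt_trans p0).
  have [|C' [d' [d'0 h]]] := main 0%N 0 M0.
    move=> i iM; rewrite scale0r sub0r coefN Pc ?oppr0//.
    by apply/eqP => ip; apply: nk; exists i.
  have : (1 : R) = 0.
    apply: (noO _ C' d' d'0) => t /[dup] /andP[t0 _] td.
    by have := h t; rewrite (gtr0_norm t0) td mul0r subr0 mul1r => /(_ isT).
  by move/eqP; rewrite oner_eq0.
have kM : (k < M)%N by rewrite -(ltr_nat R) kp.
have [|C' [d' [d'0 h]]] := main k P`_k kM.
  move=> i iM; rewrite coefB coefZ coefXn; have [->|ik] := eqVneq i k.
    by rewrite mulr1 subrr.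
  by rewrite mulr0 sub0r Pc ?oppr0// -kp eqr_nat.
have tk (t : R) : 0 < t -> t `^ p = t ^+ k by move=> t0; rewrite -kp powR_mulrn ?ltW.
(* Positive [t] give the coefficient 1, negative [t] the coefficient [(-1) ^ k]; so [k] is even. *)
have e1 : 1 - P`_k = 0.
  apply: (noO _ C' d' d'0) => t /[dup] /andP[t0 _] td.
  have := h t; rewrite (gtr0_norm t0) td => /(_ isT).
  by rewrite mulrBl mul1r (tk t t0).
have e2 : 1 - P`_k * (-1) ^+ k = 0.
  apply: (noO _ C' d' d'0) => t /[dup] /andP[t0 _] td.
  have := h (- t); rewrite normrN (gtr0_norm t0) td => /(_ isT).
  by rewrite mulrBl mul1r (tk t t0) -mulrA -exprMn mulN1r.
exists (k./2); rewrite -kp; congr _%:R; apply/esym.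
rewrite -[RHS]odd_double_half; case ok : (odd k) => //=.
move/eqP: e1; rewrite subr_eq0 => /eqP e1; move/eqP: e2.
rewrite -e1 mul1r -signr_odd ok expr1 opprK -[1 + 1]/(2 : R).
by rewrite pnatr_eq0.
Qed.

End PowerExpansion.

(** * Contractive projections in coordinates *)

Section ContractiveFamily.
Variable R : realType.
Variable p : R.
Hypothesis p1 : 1 <= p.
Local Notation mu := (@arc_length R).
Variable n : nat.
Variable E : 'I_n -> circle R -> R[i].
Implicit Types (a b : 'I_n -> R[i]) (f : circle R -> R[i]).

Definition lincomb a (z : circle R) : R[i] := \sum_i a i * E i z.

(* [f - lincomb b] is the component of [f] in the kernel of the projection. *)
Definition contractive_family :=
  [/\ forall i, inHp p (E i),
      forall a, {ae mu, forall z, lincomb a z = 0} -> forall i, a i = 0 &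
      forall f, inHp p f -> exists b, forall a (t : R[i]),
        \int[mu]_z normc (lincomb a z) `^ p <=
        \int[mu]_z normc (lincomb a z + t * (f z - lincomb b z)) `^ p].

Hypothesis CF : contractive_family.

Let EH i : inHp p (E i). Proof. by have [] := CF. Qed.

Lemma lincomb_delta i z : lincomb (fun j => (j == i)%:R) z = E i z.
Proof.
rewrite /lincomb (bigD1 i)//= eqxx mul1r big1 ?addr0// => j /negbTE ->.
by rewrite mul0r.
Qed.

Lemma lincombD a b z : lincomb (fun i => a i + b i) z = lincomb a z + lincomb b z.
Proof. by rewrite /lincomb -big_split; apply: eq_bigr => i _; rewrite mulrDl. Qed.

Lemma lincombZ c a z : lincomb (fun i => c * a i) z = c * lincomb a z.
Proof. by rewrite /lincomb mulr_sumr; apply: eq_bigr => i _; rewrite mulrA. Qed.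

Lemma inHp_lincomb a : inHp p (lincomb a).
Proof. by apply: inHp_sum => // i; exact: inHpZ. Qed.

Lemma inLp_lincomb a : inLp p (lincomb a).
Proof. by case: (inHp_lincomb a). Qed.

Lemma lincomb_neq0 a : (exists i, a i != 0) -> {ae mu, forall z, lincomb a z != 0}.
Proof.
move=> [i ai]; apply: (inHp_ae_neq0 p1 (inHp_lincomb a)) => h.
by have [_ ind _] := CF; move: ai; rewrite (ind a h i) eqxx.
Qed.

(** The coefficients [b] are those of the projection of [f], so that the same [b] serves every [a];
    for nonzero [a] the combination vanishes almost nowhere and the first variation applies. *)
Lemma duality_annihilates f : inHp p f -> exists b, forall a,
  cintegral mu (fun z => (f z - lincomb b z) * duality p (lincomb a z)) = 0.
Proof.
move=> Hf; have [_ _ /(_ f Hf)[b bP]] := CF; exists b => a.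
have [[i ai]|a0] := pselect (exists i, a i != 0); last first.
  have a00 z : lincomb a z = 0.
    rewrite /lincomb big1// => i _; have [->|ai] := eqVneq (a i) 0; first by rewrite mul0r.
    by case: a0; exists i.
  under eq_fun do rewrite a00 /duality conjc0 !mulr0.
  exact: cintegral0.
apply: norm_variation => //.
- exact: inLp_lincomb.
- by apply: inLpB => //; [case: Hf|exact: inLp_lincomb].
- by apply: lincomb_neq0; exists i.
Qed.

(* The norming functionals of elements of the span annihilate the kernel of the
   projection. *)
Lemma duality_sum_eq0 N (c : 'I_N -> R[i]) (a : 'I_N -> 'I_n -> R[i]) :
  (forall i, \sum_l c l * cintegral mu (fun z => E i z * duality p (lincomb (a l) z)) = 0) ->
  forall f, inHp p f ->
  \sum_l c l * cintegral mu (fun z => f z * duality p (lincomb (a l) z)) = 0.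
Proof.
move=> cE f Hf; have [b bP] := duality_annihilates Hf.
have Lf : inLp p f by case: Hf.
have ci g l : inLp p g -> cintegrable mu (fun z => g z * duality p (lincomb (a l) z)).
  by move=> Lg; apply: cintegrable_duality => //; exact: inLp_lincomb.
have fE l : cintegral mu (fun z => f z * duality p (lincomb (a l) z)) =
    \sum_i b i * cintegral mu (fun z => E i z * duality p (lincomb (a l) z)).
  have -> : (fun z => f z * duality p (lincomb (a l) z)) =
     (fun z => (f z - lincomb b z) * duality p (lincomb (a l) z) +
       \sum_i b i * (E i z * duality p (lincomb (a l) z))).
    apply/funext => z; rewrite mulrBl.
    have -> : \sum_i b i * (E i z * duality p (lincomb (a l) z)) =
        lincomb b z * duality p (lincomb (a l) z).
      by rewrite /lincomb mulr_suml; apply: eq_bigr => i _; rewrite mulrA.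
    by rewrite subrK.
  have ciE i : cintegrable mu (fun z => b i * (E i z * duality p (lincomb (a l) z))).
    by apply/cintegrable_fZ/ci; case: (EH i).
  rewrite cintegral_fD; last 2 first.
  - by apply/ci/inLpB => //; exact: inLp_lincomb.
  - exact: cintegrable_sum.
  rewrite bP add0r cintegral_sum//; apply: eq_bigr => i _.
  by rewrite cintegral_fZ//; apply: ci; case: (EH i).
under eq_bigr do rewrite fE mulr_sumr.
rewrite exchange_big/= big1// => i _.
under eq_bigr do rewrite mulrCA.
by rewrite -mulr_sumr cE mulr0.
Qed.

End ContractiveFamily.

(** * Linear systems *)

Section LinearAlgebra.
Variable K : fieldType.

Lemma homogeneous_solution (J : finType) N (M : 'I_N -> J -> K) : (#|J| < N)%N ->
  exists c : 'I_N -> K, (exists l, c l != 0) /\ forall j, \sum_l c l * M l j = 0.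
Proof.
move=> JN; pose A : 'M[K]_(N, #|J|) := \matrix_(l, j) M l (enum_val j).
have : kermx A != 0.
  rewrite kermx_eq0 /row_free; apply/eqP => rA.
  by have := rank_leq_col A; rewrite rA leqNgt JN.
move=> /rowV0Pn[v /sub_kermxP vA /rV0Pn[l vl]].
exists (fun l => v ord0 l); split; first by exists l.
move=> j; have := congr1 (fun B : 'rV_ #|J| => B ord0 (enum_rank j)) vA.
rewrite !mxE => h; rewrite -[RHS]h; apply: eq_bigr => i _.
by rewrite !mxE enum_rankK.
Qed.

(* Row rank is column rank, for a matrix with arbitrarily many rows. *)
Lemma dependent_rows_columns (X : Type) N (v : X -> 'I_N -> K) :
  (forall T : 'I_N -> X, exists c : 'I_N -> K, (exists l, c l != 0) /\
    forall j, \sum_l c l * v (T l) j = 0) ->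
  exists d : 'I_N -> K, (exists j, d j != 0) /\ forall x, \sum_j d j * v x j = 0.
Proof.
move=> dep; apply: contrapT => nd.
(* Otherwise independent rows can be added one at a time until there are [N] of them, against the
   hypothesis. *)
suff /(_ N (leqnn N)) [T TP] : forall k, (k <= N)%N -> exists T : 'I_k -> X,
    forall c : 'I_k -> K, (forall j, \sum_l c l * v (T l) j = 0) -> forall l, c l = 0.
  have [c [[l cl] cT]] := dep T.
  by move: cl; rewrite (TP c cT l) eqxx.
elim=> [_|k ih kN].
  by exists (fun i : 'I_0 => match i with Ordinal _ h => False_rect X (notF h) end) => c _ [].
have [T TP] := ih (ltnW kN).
have kN' : (#|{: 'I_k}| < N)%N by rewrite card_ord.
(* [d] is orthogonal to the rows already chosen but not to all rows. A row [x] not orthogonal to it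
   is the next one: pairing a relation with [d] isolates the coefficient of [x]. *)
have [d [[j0 dj0] dT]] := homogeneous_solution (fun j l => v (T l) j) kN'.
have [x xd] : exists x, \sum_j d j * v x j != 0.
  apply: contrapT => nx; apply: nd; exists d; split; first by exists j0.
  by move=> x; apply: contrapT => /eqP h; apply: nx; exists x.
exists (fun l => if unlift ord_max l is Some l' then T l' else x) => c cT.
have cT' j : \sum_(l < k) c (lift ord_max l) * v (T l) j + c ord_max * v x j = 0.
  rewrite -[RHS](cT j) big_ord_recr/=; congr (_ + _).
    apply: eq_bigr => i _.
    have -> : widen_ord (leqnSn k) i = lift ord_max i.
      by apply: val_inj; rewrite /= /bump leqNgt ltn_ord.
    by rewrite liftK.
  by rewrite unlift_none.
have cmax : c ord_max = 0.
  have : \sum_j d j * (\sum_(l < k) c (lift ord_max l) * v (T l) j + c ord_max * v x j) = 0.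
    by rewrite big1// => j _; rewrite cT' mulr0.
  under eq_bigr do rewrite mulrDr mulr_sumr.
  rewrite big_split/= exchange_big/= big1 ?add0r; last first.
    move=> l _; under eq_bigr do rewrite mulrCA.
    by rewrite -mulr_sumr dT mulr0.
  under eq_bigr do rewrite mulrCA.
  by rewrite -mulr_sumr => /eqP; rewrite mulf_eq0 (negbTE xd) orbF => /eqP.
move=> l; have [l' ->|->//] := unliftP ord_max l.
apply: (TP (fun l => c (lift ord_max l))) => j.
by have := cT' j; rewrite cmax mul0r addr0.
Qed.

End LinearAlgebra.

(** * Linear dependence of the functions [|t x - y| ^ p] *)

Section NormPencil.
Variable R : realType.
Variable p : R.
Hypothesis p1 : 1 <= p.
Local Notation mu := (@arc_length R).
Variable n : nat.
Variable E : 'I_n -> circle R -> R[i].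
Hypothesis CF : contractive_family p E.

Let p_gt0 : 0 < p. Proof. exact: lt_le_trans p1. Qed.

Let EH i : inHp p (E i). Proof. by have [] := CF. Qed.

(* The functionals [sum_l c l * w l * duality p (t l * E i0 - E i1)] with [w = t] and with
   [w = 1] annihilate the span, hence [H_p]; at [E i0 * z ^ k] and [E i1 * z ^ k] their
   difference gives the Fourier coefficients of [sum_l c l * `|t l * E i0 - E i1| ^ p]. *)
Lemma pencil_norm_dependent (i0 i1 : 'I_n) N (t : 'I_N -> R[i]) :
  (#|{: bool * bool * 'I_n}| < N)%N ->
  exists c : 'I_N -> R, (exists l, c l != 0) /\
  {ae mu, forall z, \sum_l c l * normc (t l * E i0 z - E i1 z) `^ p = 0}.
Proof.
move=> cN.
pose a l (j : 'I_n) : R[i] := t l * (j == i0)%:R + -1 * (j == i1)%:R.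
have aE l z : lincomb E (a l) z = t l * E i0 z - E i1 z.
  rewrite /a (lincombD E (fun j => t l * (j == i0)%:R) (fun j => -1 * (j == i1)%:R)).
  by rewrite !lincombZ !lincomb_delta mulN1r.
pose q l i := cintegral mu (fun z => E i z * duality p (lincomb E (a l) z)).
(* Real coefficients are needed for the combination of norms to be real. Each complex equation is
   thus split in two: the first boolean selects the weight [t] or 1, the second the real or
   imaginary part. *)
pose M l (j : bool * bool * 'I_n) : R :=
  let w := (if j.1.1 then t l else 1) * q l j.2 in if j.1.2 then Re w else Im w.
have [c [cn0 cM]] := homogeneous_solution M cN.
exists c; split=> //.
have ker (w : 'I_N -> R[i]) : (w = t \/ w = fun=> 1) -> forall f, inHp p f ->
    \sum_l ((c l)%:C%C * w l) * cintegral mu (fun z => f z * duality p (lincomb E (a l) z)) = 0.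
  move=> wt; apply: (duality_sum_eq0 p1 CF) => i.
  have [b bw] : exists b : bool, w = fun l => if b then t l else 1.
    by case: wt => ->; [exists true|exists false].
  apply: complexP.
    rewrite Re_sum -[RHS](cM (b, true, i)); apply: eq_bigr => l _.
    by rewrite -mulrA ReZ bw.
  rewrite Im_sum -[RHS](cM (b, false, i)); apply: eq_bigr => l _.
  by rewrite -mulrA ImZ bw.
have Lx l : inLp p (lincomb E (a l)) by exact: inLp_lincomb CF _.
have intx l : rintegrable mu (fun z => normc (lincomb E (a l) z) `^ p) by case: (Lx l).
have := @fourier_uniqueness R (fun z => \sum_l c l * normc (t l * E i0 z - E i1 z) `^ p).
apply.
  by apply: rintegrable_sum => l; apply: rintegrableZ; under eq_fun do rewrite -aE.
move=> k; pose F i z := E i z * cval z ^+ k.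
have HF i : inHp p (F i) by exact: inHp_mulX.
have LF i : inLp p (F i) by case: (HF i).
have cF i l : cintegrable mu (fun z => F i z * duality p (lincomb E (a l) z)).
  exact: cintegrable_duality.
have -> : (fun z => (\sum_l c l * normc (t l * E i0 z - E i1 z) `^ p)%:C%C * cval z ^+ k) =
   (fun z => \sum_l (((c l)%:C%C * t l) * (F i0 z * duality p (lincomb E (a l) z)) +
     - (c l)%:C%C * (F i1 z * duality p (lincomb E (a l) z)))).
  apply/funext => z; rewrite rmorph_sum mulr_suml; apply: eq_bigr => l _.
  by rewrite rmorphM/= -aE -(mul_duality _ p_gt0) [in RHS]aE /F aE; ring.
rewrite cintegral_sum; last first.
  by move=> l; apply: cintegrable_fD; exact: cintegrable_fZ.
rewrite (eq_bigr (fun l => (c l)%:C%C * t l * cintegral mu (fun z => F i0 z * duality p (lincomb E (a l) z)) +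
    - (c l)%:C%C * cintegral mu (fun z => F i1 z * duality p (lincomb E (a l) z)))); last first.
  by move=> l _; rewrite cintegral_fD ?cintegral_fZ//; exact: cintegrable_fZ.
rewrite big_split/= (ker t)//; last by left.
rewrite add0r; under eq_bigr do rewrite mulNr.
have h := ker (fun=> 1) (or_intror erefl) _ (HF i1).
by rewrite sumrN; apply/eqP; rewrite oppr_eq0 -[X in _ == X]h; apply/eqP/eq_bigr => l _; rewrite mulr1.
Qed.

End NormPencil.

(** * Null sets *)

Section AlmostEverywhere.
Context d (T : measurableType d) (R : realType).
Variable mu : {measure set T -> \bar R}.

Lemma ae_exists (P : T -> Prop) : mu setT != 0%E -> {ae mu, forall z, P z} -> exists z, P z.
Proof.
move=> mT [N [mN N0 sN]]; apply: contrapT => nP.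
move: mT; rewrite (_ : setT = N) ?N0 ?eqxx//.
by apply/seteqP; split => // z _; apply: sN => /= Pz; apply: nP; exists z.
Qed.

Lemma ae_countable (I : countType) (P : I -> T -> Prop) :
  (forall i, {ae mu, forall z, P i z}) -> {ae mu, forall z, forall i, P i z}.
Proof.
move=> aeP; pose N k := if unpickle k is Some i then ~` (P i) else (set0 : set T).
have nN k : mu.-negligible (N k).
  by rewrite /N; case: unpickle => [i|]; [exact: aeP|exact: negligible_set0].
apply: negligibleS (negligible_bigcup nN) => z /= /existsNP[i nPi].
by exists (pickle i) => //; rewrite /N pickleK.
Qed.

End AlmostEverywhere.

(** * Linear relations between powers of distances *)

Section PowerIndependence.
Variable R : realType.
Implicit Types (x y : R[i]) (p : R).

Lemma powR_cvg p (u : nat -> R) c : 0 < p -> (forall k, 0 <= u k) -> u @ \oo --> c ->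
  (fun k => u k `^ p) @ \oo --> c `^ p.
Proof.
move=> p0 u0 uc; have c0 : 0 <= c by apply: (ler_cvg_to (cvg_cst 0) uc); exact: nearW.
move: c0; rewrite le_eqVlt => /orP[/eqP c0|c0]; last first.
  apply: (@continuous_cvg _ _ _ _ _ u (fun a => a `^ p) c) => //.
  apply: differentiable_continuous; apply/derivable1_diffP.
  by have := is_derive1_powR p c0; case.
rewrite -c0 powR0 ?gt_eqF//; rewrite -c0 in uc.
apply/cvgrPdist_lt => e e0; have := powR_cvg0 p0 => /cvgrPdist_lt/(_ e e0)[r /= r0 rP].
move/cvgrPdist_lt : uc => /(_ r r0); apply: filterS => k.
rewrite !sub0r !normrN => ukr; have := u0 k; rewrite le_eqVlt => /orP[/eqP <-|uk].
  by rewrite powR0 ?gt_eqF// normr0.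
by have := rP (u k); rewrite /= !sub0r !normrN; apply.
Qed.

Lemma normc_cvg (u : nat -> R[i]) c : (fun k => Re (u k)) @ \oo --> Re c ->
  (fun k => Im (u k)) @ \oo --> Im c -> (fun k => normc (u k)) @ \oo --> normc c.
Proof.
move=> ur ui; have e (x : R[i]) : normc x = Num.sqrt (Re x * Re x + Im x * Im x).
  by case: x => a b; rewrite /= !expr2.
rewrite e; under eq_fun do rewrite e.
apply: continuous_cvg; first exact: sqrt_continuous.
by apply: cvgD; apply: cvgM.
Qed.

Lemma rat_cvg (x : R) : exists r : nat -> rat, (fun k => ratr (r k) : R) @ \oo --> x.
Proof.
have /choice[r rP] : forall k : nat, exists q : rat, ratr q \in `]x, x + k.+1%:R^-1[.
  by move=> k; apply: rat_in_itvoo; rewrite ltrDl invr_gt0.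
exists r; apply: (@squeeze_cvgr _ _ _ _ (cst x) (fun k => x + k.+1%:R^-1)).
- by apply: nearW => k; have := rP k; rewrite in_itv/= => /andP[/ltW-> /ltW->].
- exact: cvg_cst.
- have : (fun k => x + k.+1%:R^-1) @ \oo --> x + 0.
    by apply: cvgD; [exact: cvg_cst|exact: (@cvg_harmonic R)].
  by rewrite addr0.
Qed.

Lemma sum_normcB_powR_expansion M p N (d : 'I_N -> R) (b : 'I_N -> R[i]) (s : seq 'I_N) :
  (forall j, j \in s -> b j != 0) -> exists P C e, 0 < e /\ forall t : R, `|t| <= e ->
  `|\sum_(j <- s) d j * normc (t%:C%C - b j) `^ p - P.[t]| <= C * `|t| ^+ M.
Proof.
elim: s => [_|j s ih bs].
  by exists 0, 0, 1; split => // t _; rewrite big_nil horner0 subrr normr0 mul0r.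
have [|P [C [e [e0 PC]]]] := ih; first by move=> i si; apply: bs; rewrite inE si orbT.
have [|Q [D [e' [e'0 QD]]]] := @normcB_powR_expansion R M p (b j).
  by apply: bs; rewrite mem_head.
exists (d j *: Q + P), (`|d j| * D + C), (Num.min e e'); split.
  by rewrite lt_min e0.
move=> t; rewrite le_min => /andP[te te'].
rewrite big_cons hornerD hornerZ opprD addrACA -mulrBr mulrDl.
apply: le_trans (ler_normD _ _) _; rewrite lerD ?PC//.
by rewrite normrM -mulrA ler_wpM2l// QD.
Qed.

(* Near [a j0] all the terms but the one of index [j0] are smooth. *)
Lemma sum_normcB_powR_even p N (d : 'I_N -> R) (a : 'I_N -> R[i]) : 0 < p ->
  injective a -> (exists j, d j != 0) ->
  (forall t : R[i], \sum_j d j * normc (t - a j) `^ p = 0) ->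
  exists k : nat, p = k.*2%:R.
Proof.
move=> p0 inja [j0 dj0] rel.
(* The order of expansion exceeds [p], so that the error term cannot hide [|t| ^ p]. *)
have [M pM] : exists M : nat, p < M%:R.
  by exists (Num.truncn p).+1; exact: truncnS_gt.
pose b j := a j - a j0.
have [|P [C [e [e0 PC]]]] := @sum_normcB_powR_expansion M p N d b
    [seq j <- index_enum 'I_N | j != j0].
  by move=> j; rewrite mem_filter => /andP[jj0 _]; rewrite subr_eq0 (inj_eq inja).
apply: (@norm_powR_expansion_even R M p (- (d j0)^-1 *: P) (`|d j0|^-1 * C) e) => //.
move=> t /andP[_ te]; have := PC t te; rewrite big_filter.
have -> : \sum_(j | j != j0) d j * normc (t%:C%C - b j) `^ p = - (d j0 * `|t| `^ p).
  have := rel (a j0 + t%:C%C); rewrite (bigD1 j0)//= addrAC subrr add0r normc_real.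
  move/eqP; rewrite addr_eq0 => /eqP ->; rewrite opprK; apply: eq_bigr => j _.
  by congr (_ * normc _ `^ _); rewrite /b; ring.
move=> h; rewrite hornerZ.
have -> : `|t| `^ p - - (d j0)^-1 * P.[t] = - (d j0)^-1 * (- (d j0 * `|t| `^ p) - P.[t]).
  by field.
by rewrite normrM normrN normfV -mulrA ler_wpM2l.
Qed.

End PowerIndependence.

(** * Evenness of the exponent *)

Section EvennessOfExponent.
Variable R : realType.
Variable p : R.
Hypothesis p1 : 1 <= p.
Local Notation mu := (@arc_length R).
Variable n : nat.
Variable E : 'I_n -> circle R -> R[i].
Hypothesis CF : contractive_family p E.
Variables i0 i1 : 'I_n.
Hypothesis i01 : i0 != i1.

Let p_gt0 : 0 < p. Proof. exact: lt_le_trans p1. Qed.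

Let m z := E i1 z / E i0 z.

Lemma basis_ae_neq0 : {ae mu, forall z, E i0 z != 0}.
Proof.
have : {ae mu, forall z, lincomb E (fun j => (j == i0)%:R) z != 0}.
  by apply: (lincomb_neq0 p1 CF); exists i0; rewrite eqxx oner_neq0.
by apply: filterS => z; rewrite lincomb_delta.
Qed.

(** [E i1 - a E i0] is a nontrivial combination and vanishes almost nowhere. Thus [m] avoids any
    finite set almost everywhere and takes as many distinct values as desired. *)
Lemma basis_ratio_ae_neq a : {ae mu, forall z, m z != a}.
Proof.
have : {ae mu, forall z, lincomb E (fun j => (j == i1)%:R + - a * (j == i0)%:R) z != 0}.
  apply: (lincomb_neq0 p1 CF); exists i1.
  have i10 : (i1 == i0) = false by rewrite eq_sym (negbTE i01).
  by rewrite eqxx i10 mulr0 addr0 oner_neq0.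
apply: filterS2 basis_ae_neq0 => z z0.
rewrite (lincombD E (fun j => (j == i1)%:R) (fun j => - a * (j == i0)%:R)) lincombZ !lincomb_delta.
by apply: contra_neq => mza; rewrite -mza /m mulNr mulfVK// subrr.
Qed.

(** Gaussian rationals, because the exceptional null set depends on the parameters and only
    countably many of these sets can be discarded together. *)
Let gauss (q : rat * rat) : R[i] := (ratr q.1 +i* ratr q.2)%C.

Lemma contractive_family_even : exists k : nat, p = k.*2%:R.
Proof.
pose N := (#|{: bool * bool * 'I_n}|).+1.
(* The tuples of parameters are finite functions, which form a countable type. *)
have /choice[c cP] : forall T : {ffun 'I_N -> rat * rat}, exists c : 'I_N -> R,
    (exists l, c l != 0) /\
    {ae mu, forall z, \sum_l c l * normc (gauss (T l) * E i0 z - E i1 z) `^ p = 0}.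
  by move=> T; exact: (pencil_norm_dependent p1 CF).
pose good z := E i0 z != 0 /\ forall T : {ffun 'I_N -> rat * rat},
  \sum_l c T l * normc (gauss (T l) - m z) `^ p = 0.
have aegood : {ae mu, forall z, good z}.
  have h := ae_countable (fun T => (cP T).2).
  apply: filterS2 basis_ae_neq0 h => z z0 cz; split => // T.
  have z0' : normc (E i0 z) `^ p != 0 by rewrite gt_eqF// powR_gt0// normc_gt0.
  apply: (mulfI z0'); rewrite mulr0 -[RHS](cz T) mulr_sumr; apply: eq_bigr => l _.
  rewrite mulrCA -powRM ?normc_ge0// -normcM; congr (_ * normc _ `^ _).
  by rewrite /m mulrBr mulrCA mulfV// mulr1 mulrC.
have pick k : exists s : seq R[i], [/\ size s = k, uniq s &
    forall a, a \in s -> exists2 z, good z & m z = a].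
  elim: k => [|k [s [ss us sP]]]; first by exists [::].
  have ns : {ae mu, forall z, m z \notin s}.
    elim: {ss us sP} s => [|a s ih]; first exact: nearW.
    by apply: filterS2 (basis_ratio_ae_neq a) ih => z; rewrite inE negb_or => -> ->.
  have [z [gz zs]] : exists z, good z /\ m z \notin s.
    by apply: (ae_exists (arc_length_neq0 R)); apply: filterS2 aegood ns.
  exists (m z :: s); split => /=; rewrite ?ss ?zs//.
  by move=> a; rewrite inE => /orP[/eqP ->|/sP//]; exists z.
have [s [ss us sP]] := pick N.
pose a (j : 'I_N) := s`_j.
have inja : injective a.
  move=> i j /eqP; rewrite nth_uniq ?ss// => /eqP; exact: val_inj.
have aP j : exists2 z, good z & m z = a j by apply: sP; rewrite mem_nth// ss.
(* Rows are indexed by the parameters [q], columns by the values [a j] of [m]: a relation between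
   any [N] rows becomes one between the columns, valid for all [q]. *)
have [T|d [dn0 dP]] := @dependent_rows_columns R (rat * rat)%type N
    (fun q j => normc (gauss q - a j) `^ p).
  pose T' : {ffun 'I_N -> rat * rat} := [ffun l => T l].
  exists (c T'); split; first by case: (cP T').
  move=> j; have [z [_ gz] <-] := aP j; rewrite -[RHS](gz T').
  by apply: eq_bigr => l _; rewrite ffunE.
apply: (sum_normcB_powR_even p_gt0 inja dn0) => t.
(* The relation extends from Gaussian rationals to all complex [t] by continuity. *)
have [r rt] := rat_cvg (Re t); have [r' rt'] := rat_cvg (Im t).
have cv : (fun k => \sum_j d j * normc (gauss (r k, r' k) - a j) `^ p) @ \oo -->
    \sum_j d j * normc (t - a j) `^ p.
  apply: cvg_big => [|j _]; first exact: add_continuous.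
  apply: cvgM; first exact: cvg_cst.
  apply: powR_cvg => //; first by move=> k; exact: normc_ge0.
  apply: normc_cvg.
    under eq_fun do rewrite ReD ReN; rewrite ReD ReN.
    by apply: cvgB => //; exact: cvg_cst.
  under eq_fun do rewrite ImD ImN; rewrite ImD ImN.
  by apply: cvgB => //; exact: cvg_cst.
rewrite (_ : (fun _ => _) = cst 0) in cv; last by apply/funext => k; exact: dP.
by have := cvg_lim (@Rhausdorff R) cv; rewrite lim_cst// => <-.
Qed.

End EvennessOfExponent.

(** * Polynomials in a complex number and its conjugate *)

Section BivariateVanishing.
Variable R : realType.

Lemma poly_nat_roots_eq0 (P : {poly R[i]}) : (forall n : nat, P.[n%:R] = 0) -> P = 0.
Proof.
move=> P0; apply: (@roots_geq_poly_eq0 _ P [seq i%:R | i <- iota 0 (size P)]).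
- by apply/allP => x /mapP[i _ ->]; rewrite /root P0.
- rewrite map_inj_uniq ?iota_uniq// => i j /eqP.
  by rewrite eqr_nat => /eqP.
- by rewrite size_map size_iota.
Qed.

(* A polynomial in [t] and its conjugate, viewed as a polynomial in the real and imaginary
   parts of [t], vanishes at complex arguments, so [t] and its conjugate may be replaced by
   independent variables. *)
Lemma bivariate_conj_eq0 m n (I : 'I_m -> 'I_n -> R[i]) :
  (forall t : R[i], \sum_i \sum_j I i j * t ^+ i * (t^*)%C ^+ j = 0) ->
  forall i j, I i j = 0.
Proof.
move=> h.
have iE (x : R[i]) : (Re ('i%C * x) = - Im x) * (Im ('i%C * x) = Re x).
  by rewrite [_ * x]mulrC ReiNIm ImiRe.
pose F (x y : R[i]) := \sum_i \sum_j I i j * (x + 'i%C * y) ^+ i * (x - 'i%C * y) ^+ j.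
have F1 (a b : R) : F a%:C%C b%:C%C = 0.
  rewrite -[RHS](h (a%:C%C + 'i%C * b%:C%C)); apply: eq_bigr => i _; apply: eq_bigr => j _.
  by congr (_ * _ ^+ _); apply: complexP; rewrite !(iE, ReD, ImD, ReN, ImN, Re_conj, Im_conj)/=; ring.
pose P1 (y : R[i]) : {poly R[i]} :=
  \sum_i \sum_j (I i j)%:P * ('X + ('i%C * y)%:P) ^+ i * ('X - ('i%C * y)%:P) ^+ j.
have P1E x y : (P1 y).[x] = F x y.
  rewrite horner_sum; apply: eq_bigr => i _; rewrite horner_sum; apply: eq_bigr => j _.
  by rewrite !(hornerM, horner_exp, hornerD, hornerN, hornerC, hornerX).
have nat_real k : (k%:R : R[i]) = (k%:R)%:C%C by rewrite rmorph_nat.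
(* The variables are freed one after the other: for fixed [b] this is a polynomial in [x] that
   vanishes at every natural number. *)
have F2 x (b : R) : F x b%:C%C = 0.
  rewrite -P1E (@poly_nat_roots_eq0 (P1 b%:C%C)) ?horner0// => k.
  by rewrite P1E nat_real F1.
pose P2 (x : R[i]) : {poly R[i]} :=
  \sum_i \sum_j (I i j)%:P * (x%:P + 'i%C%:P * 'X) ^+ i * (x%:P - 'i%C%:P * 'X) ^+ j.
have P2E x y : (P2 x).[y] = F x y.
  rewrite horner_sum; apply: eq_bigr => i _; rewrite horner_sum; apply: eq_bigr => j _.
  by rewrite !(hornerM, horner_exp, hornerD, hornerN, hornerC, hornerX).
have F3 x y : F x y = 0.
  rewrite -P2E (@poly_nat_roots_eq0 (P2 x)) ?horner0// => k.
  by rewrite P2E nat_real F2.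
have F4 (s t : R[i]) : \sum_i \sum_j I i j * s ^+ i * t ^+ j = 0.
  have i2 : ('i%C : R[i]) * 'i%C = -1 by rewrite -expr2 sqr_i.
  (* The solution of [x + i y = s], [x - i y = t]. *)
  rewrite -[RHS](F3 ((s + t) / 2) (- 'i%C * (s - t) / 2)).
  apply: eq_bigr => i _; apply: eq_bigr => j _.
  have -> : 'i%C * (- 'i%C * (s - t) / 2) = (s - t) / 2.
    by rewrite mulrA mulrA mulrN i2 opprK mul1r.
  by congr (_ * _ ^+ _ * _ ^+ _); field.
have uni N (c : 'I_N -> R[i]) : (forall s : R[i], \sum_i c i * s ^+ i = 0) -> forall i, c i = 0.
  move=> cs i; have : \poly_(i < N) (if insub i is Some j then c j else 0) = 0.
    apply: poly_nat_roots_eq0 => k; rewrite horner_poly -[RHS](cs k%:R).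
    by apply: eq_bigr => j _; rewrite valK.
  by move=> /(congr1 (fun P : {poly R[i]} => P`_i)); rewrite coef_poly ltn_ord valK coef0.
move=> i; apply: (uni _ (I i)) => t.
apply: (uni _ (fun i => \sum_j I i j * t ^+ j)) => s; rewrite -[RHS](F4 s t).
by apply: eq_bigr => i' _; rewrite mulr_suml; apply: eq_bigr => j _; rewrite mulrAC.
Qed.

End BivariateVanishing.

(** * Weighted least squares *)

Section LeastSquares.
Context d (T : measurableType d) (R : realType).
Variable mu : {measure set T -> \bar R}.

(** The conclusion is the system of normal equations, whose Gram matrix [G] may be singular. It is
    solvable because a vector killed by [G] gives a combination of the [phi] with weighted norm 0;
    times [w] it vanishes almost everywhere, so the right-hand side is orthogonal to the vector. *)
Lemma least_squares (J : finType) (w psi : T -> R) (phi : J -> T -> R) :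
  (forall z, 0 <= w z) ->
  (forall r s, rintegrable mu (fun z => w z * (phi r z * phi s z))) ->
  (forall r, rintegrable mu (fun z => w z * (psi z * phi r z))) ->
  measurable_fun setT w -> measurable_fun setT psi ->
  (forall r, measurable_fun setT (phi r)) ->
  exists c : J -> R, forall r,
    \int[mu]_z (w z * ((psi z - \sum_s c s * phi s z) * phi r z)) = 0.
Proof.
move=> w0 iphi ipsi mw mpsi mphi.
pose G : 'M[R]_(#|J|) := \matrix_(r, s) \int[mu]_z (w z * (phi (enum_val r) z * phi (enum_val s) z)).
pose b : 'rV[R]_(#|J|) := \row_r \int[mu]_z (w z * (psi z * phi (enum_val r) z)).
have int2 (c e : J -> R) : rintegrable mu
    (fun z => w z * ((\sum_s c s * phi s z) * (\sum_s e s * phi s z))).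
  have -> : (fun z => w z * ((\sum_s c s * phi s z) * (\sum_s e s * phi s z))) =
      (fun z => \sum_s \sum_r c s * e r * (w z * (phi s z * phi r z))).
    apply/funext => z; rewrite mulr_suml mulr_sumr; apply: eq_bigr => s _.
    by rewrite !mulr_sumr; apply: eq_bigr => r _; ring.
  by apply: rintegrable_sum => s; apply: rintegrable_sum => r; exact: rintegrableZ.
have /submxP[c bc] : (b <= G)%MS.
  rewrite submxE; move: (cokermx G) (mulmx_coker G) => B GB.
  apply/eqP/rowP => j; rewrite [RHS]mxE mxE.
  pose e s := B (enum_rank s) j.
  pose phie z := \sum_s e s * phi s z.
  have mphie : measurable_fun setT phie.
    by apply: measurable_sum => s; apply: measurable_funM => //; exact: measurable_cst.
  have Ge r : \int[mu]_z (w z * (phi r z * phie z)) = 0.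
    have := congr1 (fun M : 'M[R]_(#|J|) => M (enum_rank r) j) GB.
    rewrite !mxE => h; rewrite -[RHS]h.
    rewrite (reindex (@enum_rank J)); last first.
      by exists enum_val => ? _; [exact: enum_rankK|exact: enum_valK].
    have -> : (fun z => w z * (phi r z * phie z)) =
        (fun z => \sum_s e s * (w z * (phi r z * phi s z))).
      by apply/funext => z; rewrite /phie !mulr_sumr; apply: eq_bigr => s _; ring.
    rewrite Rintegral_sum; last by move=> s; exact: rintegrableZ.
    apply: eq_bigr => s _; rewrite !mxE !enum_rankK RintegralZl//; last exact: iphi.
    by rewrite mulrC.
  have we0 : {ae mu, forall z, w z * phie z = 0}.
    have int0 : \int[mu]_z (w z * (phie z * phie z)) = 0.
      have -> : (fun z => w z * (phie z * phie z)) =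
          (fun z => \sum_s e s * (w z * (phi s z * phie z))).
        by apply/funext => z; rewrite {1}/phie mulr_suml mulr_sumr; apply: eq_bigr => s _; ring.
      have iphie s : rintegrable mu (fun z => w z * (phi s z * phie z)).
        have := int2 (fun r => (r == s)%:R) e; congr rintegrable; apply/funext => z.
        congr (_ * (_ * _)); rewrite (bigD1 s)//= eqxx mul1r big1 ?addr0// => r /negbTE ->.
        by rewrite mul0r.
      rewrite Rintegral_sum; last by move=> s; exact: rintegrableZ.
      by rewrite big1// => s _; rewrite RintegralZl ?Ge ?mulr0//; exact: iphie.
    have := Rintegral_ge0_eq0 (int2 e e) _ int0.
    move=> /(_ (fun z => mulr_ge0 (w0 z) (sqr_ge0 _))); apply: filterS => z /(_ I) /= /eqP.
    by rewrite !mulf_eq0 orbb => /orP[/eqP ->|/eqP h]; rewrite ?mul0r// /phie h mulr0.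
  have psi0 : \int[mu]_z (w z * (psi z * phie z)) = 0.
    rewrite (@Rintegral_ae _ _ _ mu _ (fun=> 0)).
    - by rewrite Rintegral_cst// mul0r.
    - by apply: measurable_funM => //; exact: measurable_funM.
    - exact: measurable_cst.
    - by apply: filterS we0 => z h _ /=; rewrite mulrCA h mulr0.
  rewrite -[RHS]psi0.
  rewrite (reindex (@enum_rank J)); last first.
    by exists enum_val => ? _; [exact: enum_rankK|exact: enum_valK].
  have -> : (fun z => w z * (psi z * phie z)) =
      (fun z => \sum_s e s * (w z * (psi z * phi s z))).
    by apply/funext => z; rewrite /phie !mulr_sumr; apply: eq_bigr => s _; ring.
  rewrite Rintegral_sum; last by move=> s; exact: rintegrableZ.
  apply: eq_bigr => s _; rewrite !mxE !enum_rankK RintegralZl//; last exact: ipsi.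
  by rewrite mulrC.
exists (fun s => c ord0 (enum_rank s)) => r.
have -> : (fun z => w z * ((psi z - \sum_s c ord0 (enum_rank s) * phi s z) * phi r z)) =
  (fun z => w z * (psi z * phi r z) - \sum_s c ord0 (enum_rank s) * (w z * (phi s z * phi r z))).
  apply/funext => z; rewrite mulrBl mulrBr; congr (_ - _).
  by rewrite mulr_suml mulr_sumr; apply: eq_bigr => s _; ring.
have isum : rintegrable mu (fun z => \sum_s c ord0 (enum_rank s) * (w z * (phi s z * phi r z))).
  by apply: rintegrable_sum => s; exact: rintegrableZ.
rewrite RintegralB//; last exact: ipsi.
rewrite Rintegral_sum; last by move=> s; exact: rintegrableZ.
have := congr1 (fun M : 'rV[R]_(#|J|) => M ord0 (enum_rank r)) bc.
rewrite !mxE enum_rankK => ->; apply/eqP; rewrite subr_eq0; apply/eqP.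
rewrite (reindex (@enum_rank J)); last first.
  by exists enum_val => ? _; [exact: enum_rankK|exact: enum_valK].
apply: eq_bigr => s _; rewrite !mxE !enum_rankK RintegralZl//; exact: iphi.
Qed.

End LeastSquares.

(** * Domination by powers of [L_p] functions *)

Section Degrees.
Variable R : realType.
Variable p : R.
Hypothesis p1 : 1 <= p.
Local Notation mu := (@arc_length R).
Implicit Types f g : circle R -> R[i].

(** A substitute for Hölder's inequality: degrees add under products, since all factors can be
    dominated by one function [g] of [L_p], and degree [p] means integrable. *)
Definition Lp_degree m f := cmeasurable f /\
  exists (C : R) (g : circle R -> R), [/\ 0 <= C, inLp p (fun z => (g z)%:C%C),
    forall z, 0 <= g z & forall z, normc (f z) <= C * g z ^+ m].

Lemma inLp_normc f : inLp p f -> inLp p (fun z => (normc (f z))%:C%C).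
Proof.
move=> [mf nf]; split; first exact/cmeasurable_real/measurable_normc.
under eq_fun do rewrite normc_real ger0_norm ?normc_ge0//.
exact: nf.
Qed.

Lemma Lp_degree1 f : inLp p f -> Lp_degree 1 f.
Proof.
move=> Lf; split; first by case: Lf.
exists 1, (fun z => normc (f z)); split => //; first exact: inLp_normc.
  by move=> z; exact: normc_ge0.
by move=> z; rewrite mul1r expr1.
Qed.

Lemma Lp_degreeM a b f g : Lp_degree a f -> Lp_degree b g ->
  Lp_degree (a + b) (fun z => f z * g z).
Proof.
move=> [mf [C [F [C0 LF F0 fF]]]] [mg [D [G [D0 LG G0 gG]]]]; split; first exact: cmeasurable_fM.
exists (C * D), (fun z => F z + G z); split.
- exact: mulr_ge0.
- by under eq_fun do rewrite RtoCD; exact: inLpD.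
- by move=> z; rewrite addr_ge0.
- move=> z; rewrite normcM exprD mulrACA; apply: ler_pM; rewrite ?normc_ge0//.
    by rewrite (le_trans (fF z))// ler_wpM2l// lerXn2r ?nnegrE ?addr_ge0// lerDl.
  by rewrite (le_trans (gG z))// ler_wpM2l// lerXn2r ?nnegrE ?addr_ge0// lerDr.
Qed.

Lemma Lp_degree1X f k : inLp p f -> Lp_degree k (fun z => f z ^+ k).
Proof.
move=> Lf; have [mf [C [F [C0 LF F0 fF]]]] := Lp_degree1 Lf.
split; first exact: cmeasurable_fX.
exists (C ^+ k), F; split => //; first exact: exprn_ge0.
by move=> z; rewrite normcX -exprMn lerXn2r ?nnegrE ?normc_ge0// mulr_ge0.
Qed.

Lemma Lp_degree_conj m f : Lp_degree m f -> Lp_degree m (fun z => (f z)^*%C).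
Proof.
move=> [mf [C [F [C0 LF F0 fF]]]]; split; first exact: cmeasurable_conj.
by exists C, F; split => // z; rewrite normc_conj.
Qed.

Lemma Lp_degreeZ c m f : Lp_degree m f -> Lp_degree m (fun z => c * f z).
Proof.
move=> [mf [C [F [C0 LF F0 fF]]]]; split.
  by apply: cmeasurable_fM => //; exact: cmeasurable_cst.
exists (normc c * C), F; split => //; first by rewrite mulr_ge0 ?normc_ge0.
by move=> z; rewrite normcM -mulrA ler_wpM2l ?normc_ge0.
Qed.

Lemma Lp_degreeD m f g : Lp_degree m f -> Lp_degree m g -> Lp_degree m (fun z => f z + g z).
Proof.
move=> [mf [C [F [C0 LF F0 fF]]]] [mg [D [G [D0 LG G0 gG]]]]; split; first exact: cmeasurable_fD.
exists (C + D), (fun z => F z + G z); split.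
- exact: addr_ge0.
- by under eq_fun do rewrite RtoCD; exact: inLpD.
- by move=> z; rewrite addr_ge0.
- move=> z; rewrite (le_trans (ler_normcD _ _))// mulrDl lerD//.
    by rewrite (le_trans (fF z))// ler_wpM2l// lerXn2r ?nnegrE ?addr_ge0// lerDl.
  by rewrite (le_trans (gG z))// ler_wpM2l// lerXn2r ?nnegrE ?addr_ge0// lerDr.
Qed.

Lemma Lp_degree_real m f : Lp_degree m f -> Lp_degree m (fun z => (Re (f z))%:C%C).
Proof.
move=> Df; have := Lp_degreeZ 2^-1 (Lp_degreeD Df (Lp_degree_conj Df)).
by congr Lp_degree; apply/funext => z; rewrite ReJ_add mulrC.
Qed.

Lemma Lp_degree_cintegrable m f : p = m%:R -> Lp_degree m f -> cintegrable mu f.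
Proof.
move=> pm [mf [C [F [C0 [_ LF] F0 fF]]]].
apply: (@le_cintegrable _ _ _ _ _ (fun z => C * normc (F z)%:C%C `^ p)) => //.
  exact: rintegrableZ.
by move=> z; rewrite normc_real ger0_norm// pm powR_mulrn.
Qed.

(** The dominating function is replaced by [1 + F], whose powers increase with the exponent; the
    constant 1 is in [L_p] because the circle has finite length. *)
Lemma Lp_degree_le a b f : (a <= b)%N -> Lp_degree a f -> Lp_degree b f.
Proof.
move=> ab [mf [C [F [C0 LF F0 fF]]]]; split=> //.
pose one := fun _ : circle R => (1 : R).
have L1 : inLp p (fun z => (one z)%:C%C).
  split; first exact: (cmeasurable_real (measurable_cst (1 : R))).
  exact: (rintegrable_cst (normc (1 : R)%:C%C `^ p)).
have LF1 : inLp p (fun z => (one z)%:C%C + (F z)%:C%C) by exact: inLpD.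
exists C, (fun z => one z + F z); split; first by [].
- by have -> : (fun z => (one z + F z)%:C%C) = (fun z => (one z)%:C%C + (F z)%:C%C) by
    apply/funext => z; exact: RtoCD.
- by move=> z; exact: addr_ge0.
- move=> z; rewrite (le_trans (fF z))// ler_wpM2l//.
  apply: (@le_trans _ _ ((1 + F z) ^+ a)).
    by rewrite lerXn2r ?nnegrE ?addr_ge0// lerDr.
  by rewrite ler_weXn2l// lerDl.
Qed.

End Degrees.

(** * Even exponents at least 4, written as [2 (k + 2)]: polarisation *)

Section EvenExponent.
Variable R : realType.
Variable k : nat.
Local Notation p := (@GRing.natmul R 1 k.+2.*2).
Local Notation mu := (@arc_length R).
Variable n : nat.
Variable E : 'I_n -> circle R -> R[i].
Hypothesis CF : contractive_family p E.

Let p1 : 1 <= p. Proof. by rewrite ler1n. Qed.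

Let EH i : inHp p (E i). Proof. by have [] := CF. Qed.
Let EL i : inLp p (E i). Proof. by case: (EH i). Qed.
Let LL a : inLp p (lincomb E a). Proof. exact: (inLp_lincomb p1 CF). Qed.

Lemma duality_even (x : R[i]) : duality p x = x ^+ k.+1 * (x^*)%C ^+ k.+2.
Proof.
have [->|x0] := eqVneq x 0; first by rewrite /duality conjc0 mulr0 expr0n mul0r.
rewrite /duality [(x^*)%C ^+ k.+2]exprSr mulrA -exprMn mul_conjc; congr (_ * _).
have -> : p - 2 = k.+1.*2%:R by rewrite -natrB// doubleS subn2.
by rewrite powR_mulrn ?normc_ge0// -mul2n exprM RtoCX.
Qed.

Lemma cintegrable_monomial f u w a b c d : inLp p f -> inLp p u -> inLp p w ->
  (1 + ((a + b) + (c + d)))%N = k.+2.*2 ->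
  cintegrable mu (fun z => f z * (u z ^+ a * w z ^+ b * ((u z)^*%C ^+ c * (w z)^*%C ^+ d))).
Proof.
move=> Lf Lu Lw e; have pe : p = (1 + ((a + b) + (c + d)))%:R by rewrite e.
apply: (Lp_degree_cintegrable pe); apply: Lp_degreeM => //; first exact: Lp_degree1.
have cX g m : inLp p g -> Lp_degree p m (fun z => (g z)^*%C ^+ m).
  move=> Lg; have := Lp_degree_conj (Lp_degree1X m Lg).
  by congr Lp_degree; apply/funext => z; rewrite conjcX.
by apply: Lp_degreeM => //; apply: Lp_degreeM => //; by [exact: Lp_degree1X|exact: cX].
Qed.

(** Polarisation: at [a + t c] the annihilation is an identity between polynomials in [t] and its
    conjugate, valid for all [t], so every coefficient vanishes; the binomial factors are
    nonzero. *)
Lemma duality_coef_annihilates f : inHp p f -> exists b, forall a c i j,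
  (i < k.+2)%N -> (j < k.+3)%N ->
  cintegral mu (fun z => (f z - lincomb E b z) *
    (lincomb E a z ^+ (k.+1 - i) * lincomb E c z ^+ i *
     ((lincomb E a z)^*%C ^+ (k.+2 - j) * (lincomb E c z)^*%C ^+ j))) = 0.
Proof.
move=> Hf; have [b bP] := duality_annihilates p1 CF Hf; exists b => a c i j ik jk.
pose K z := f z - lincomb E b z.
have LK : inLp p K by apply: inLpB (LL b) => //; case: Hf.
pose M i j z := K z * (lincomb E a z ^+ (k.+1 - i) * lincomb E c z ^+ i *
     ((lincomb E a z)^*%C ^+ (k.+2 - j) * (lincomb E c z)^*%C ^+ j)).
have intM i' j' : (i' < k.+2)%N -> (j' < k.+3)%N -> cintegrable mu (M i' j').
  rewrite !ltnS => ik' jk'; apply: cintegrable_monomial => //.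
  by rewrite !subnK// -addnn addnA add1n.
have := @bivariate_conj_eq0 R k.+2 k.+3 (fun i j =>
  ('C(k.+1, i) * 'C(k.+2, j))%:R * cintegral mu (M i j)).
move=> /(_ _ (Ordinal ik) (Ordinal jk)) /= h.
have {}h : ('C(k.+1, i) * 'C(k.+2, j))%:R * cintegral mu (M i j) = 0.
  apply: h => t; rewrite -[RHS](bP (fun l => a l + t * c l)).
  have -> : (fun z => (f z - lincomb E b z) * duality p (lincomb E (fun l => a l + t * c l) z)) =
     (fun z => \sum_(i < k.+2) \sum_(j < k.+3)
        (('C(k.+1, i) * 'C(k.+2, j))%:R * t ^+ i * (t^*)%C ^+ j) * M i j z).
    apply/funext => z; rewrite (lincombD E a (fun l => t * c l)) lincombZ duality_even.
    rewrite conjcD conjcM /M -/(K z).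
    move: (lincomb E a z) (lincomb E c z) (K z) => A B Kz.
    rewrite !exprDn mulr_suml mulr_sumr; apply: eq_bigr => i' _.
    rewrite !mulr_sumr; apply: eq_bigr => j' _.
    rewrite !exprMn -[_ *+ 'C(k.+1, i')]mulr_natl -[_ *+ 'C(k.+2, j')]mulr_natl natrM.
    set C1 := 'C(k.+1, i')%:R; set C2 := 'C(k.+2, j')%:R.
    set X := t ^+ i'; set Y := _ ^+ j'; set a1 := A ^+ _; set a2 := B ^+ _.
    set a3 := _ ^+ (k.+2 - _); set a4 := _ ^+ j'.
    by ring.
  rewrite cintegral_sum; last first.
    by move=> i'; apply: cintegrable_sum => j'; apply: cintegrable_fZ; exact: intM.
  apply: eq_bigr => i' _; rewrite cintegral_sum; last first.
    by move=> j'; apply: cintegrable_fZ; exact: intM.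
  apply: eq_bigr => j' _; rewrite cintegral_fZ; last exact: intM.
  by rewrite -!mulrA; congr (_ * _); rewrite [RHS]mulrA [LHS]mulrC.
have C0 : ('C(k.+1, i) * 'C(k.+2, j))%:R != 0 :> R[i].
  by rewrite pnatr_eq0 -lt0n muln_gt0 !bin_gt0; apply/andP.
by move/eqP: h; rewrite mulf_eq0 (negbTE C0) /= => /eqP.
Qed.

Lemma rintegrable_degree m (h : circle R -> R) : m = k.+2.*2 ->
  Lp_degree p m (fun z => (h z)%:C%C) -> rintegrable mu h.
Proof. by move=> -> /(Lp_degree_cintegrable erefl)[]. Qed.

Section RealPart.
Variables (a a' : 'I_n -> R[i]).
Hypothesis an0 : exists i, a i != 0.
Local Notation u := (lincomb E a).
Local Notation w := (lincomb E a').

Let W z : R := normc (u z) ^+ k.*2.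
Let psi0 z : R := normc (w z) ^+ 2.
(** Over the reals these functions span all [Re (u^* v)] with [v] in the complex span, hence the
    second half with the factor [i]. *)
Let phi (s : 'I_n + 'I_n) z : R := match s with
  | inl i => Re ((u z)^*%C * E i z) | inr i => Re ((u z)^*%C * ('i%C * E i z)) end.

Let WE z : (W z)%:C%C = u z ^+ k * (u z)^*%C ^+ k.
Proof. by rewrite -exprMn mul_conjc /W -mul2n exprM RtoCX. Qed.

Let psi0E z : (psi0 z)%:C%C = w z * (w z)^*%C.
Proof. by rewrite mul_conjc. Qed.

Let DuJ m : Lp_degree p m (fun z => (u z)^*%C ^+ m).
Proof.
have := Lp_degree_conj (Lp_degree1X m (LL a)).
by congr Lp_degree; apply/funext => z; rewrite conjcX.
Qed.

Let DW : Lp_degree p (k + k) (fun z => (W z)%:C%C).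
Proof.
under eq_fun do rewrite WE; apply: Lp_degreeM => //; exact: Lp_degree1X.
Qed.

Let Dpsi0 : Lp_degree p (1 + 1) (fun z => (psi0 z)%:C%C).
Proof.
under eq_fun do rewrite psi0E; apply: Lp_degreeM => //; first exact: Lp_degree1.
exact/Lp_degree_conj/Lp_degree1.
Qed.

Let DuE (f : circle R -> R[i]) : inLp p f -> Lp_degree p (1 + 1) (fun z => (u z)^*%C * f z).
Proof.
move=> Lf; apply: (Lp_degreeM p1 (Lp_degree_conj (Lp_degree1 (LL a)))).
exact: Lp_degree1.
Qed.

Let Dphi s : Lp_degree p (1 + 1) (fun z => (phi s z)%:C%C).
Proof.
case: s => i; first exact: (Lp_degree_real p1 (DuE (EL i))).
exact: (Lp_degree_real p1 (DuE (inLpZ 'i%C (EL i)))).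
Qed.

Let DW2 (f g : circle R -> R) : Lp_degree p (1 + 1) (fun z => (f z)%:C%C) ->
  Lp_degree p (1 + 1) (fun z => (g z)%:C%C) -> rintegrable mu (fun z => W z * (f z * g z)).
Proof.
move=> Df Dg; apply: (@rintegrable_degree ((k + k) + ((1 + 1) + (1 + 1)))).
  by rewrite -addnn; ring.
under eq_fun do rewrite !RtoCM; apply: Lp_degreeM => //; exact: Lp_degreeM.
Qed.

Let mreal m (f : circle R -> R) : Lp_degree p m (fun z => (f z)%:C%C) -> measurable_fun setT f.
Proof. by move=> [[]]. Qed.

(* [c] is chosen by least squares, so that the functional represented by the difference of
   the two sides vanishes on the span, hence everywhere. *)
Lemma norm_sqr_real_part :
  exists c, {ae mu, forall z, normc (w z) ^+ 2 = Re ((u z)^*%C * lincomb E c z)}.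
Proof.
have [cc ccP] := @least_squares _ _ R mu _ W psi0 phi
  (fun z => exprn_ge0 _ (normc_ge0 _)) (fun r s => DW2 (Dphi r) (Dphi s))
  (fun r => DW2 Dpsi0 (Dphi r)) (mreal DW) (mreal Dpsi0) (fun r => mreal (Dphi r)).
pose c i : R[i] := (cc (inl i))%:C%C + 'i%C * (cc (inr i))%:C%C.
pose psi z := psi0 z - Re ((u z)^*%C * lincomb E c z).
have sumE z : \sum_s cc s * phi s z = Re ((u z)^*%C * lincomb E c z).
  rewrite big_sumType/= /lincomb mulr_sumr Re_sum -big_split/=; apply: eq_bigr => i _.
  have -> : (u z)^*%C * (c i * E i z) = (cc (inl i))%:C%C * ((u z)^*%C * E i z) +
      (cc (inr i))%:C%C * ((u z)^*%C * ('i%C * E i z)) by rewrite /c; ring.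
  by rewrite ReD !ReZ.
have Dpsi : Lp_degree p (1 + 1) (fun z => (psi z)%:C%C).
  under eq_fun do rewrite /psi RtoCB -mulN1r; apply: Lp_degreeD => //.
  by apply: Lp_degreeZ; exact: (Lp_degree_real p1 (DuE (LL c))).
have psiE z : (psi z)%:C%C = w z * (w z)^*%C -
    2^-1 * ((u z)^*%C * lincomb E c z + u z * (lincomb E c z)^*%C).
  by rewrite /psi RtoCB psi0E ReJ_add conjcM conjcK mulrC; congr (_ - _); field.
(* [G] is [W u^* psi], so that its integrals against the [E i] are the normal equations for the
   weight [W]. *)
pose G z := u z ^+ k * (u z)^*%C ^+ k.+1 * (psi z)%:C%C.
have intG f : inLp p f -> cintegrable mu (fun z => f z * G z).
  move=> Lf; have pe : p = (1 + ((k + k.+1) + (1 + 1)))%:R.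
    by congr _%:R; rewrite -addnn; ring.
  apply: (Lp_degree_cintegrable pe); apply: Lp_degreeM => //; first exact: Lp_degree1.
  by apply: Lp_degreeM => //; apply: Lp_degreeM => //; exact: Lp_degree1X.
have GE i : cintegral mu (fun z => E i z * G z) = 0.
  have e z : E i z * G z = (W z * psi z)%:C%C * ((u z)^*%C * E i z).
    by rewrite RtoCM WE /G exprSr; ring.
  under eq_fun do rewrite e.
  apply: complexP; rewrite ?Re_cintegral ?Im_cintegral.
    rewrite -[RHS](ccP (inl i)); apply: eq_Rintegral => z _.
    by rewrite ReZ sumE mulrA.
  (* The sign comes from [Re (i x) = - Im x]. *)
  apply/eqP; rewrite -oppr_eq0; apply/eqP.
  have intI : rintegrable mu (fun z => Im ((W z * psi z)%:C%C * ((u z)^*%C * E i z))).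
    by have [_] := intG _ (EL i); under eq_fun do rewrite e.
  rewrite -mulN1r -RintegralZl//.
  rewrite -[RHS](ccP (inr i)); apply: eq_Rintegral => z _.
  rewrite ImZ sumE /phi -/(psi z) [(u z)^*%C * (_ * _)]mulrCA [_ * (_ * E i z)]mulrC ReiNIm; ring.
have G0 f : inHp p f -> cintegral mu (fun z => f z * G z) = 0.
  move=> Hf; have Lf : inLp p f by case: Hf.
  have [b bP] := duality_coef_annihilates Hf.
  have LK : inLp p (fun z => f z - lincomb E b z) by exact: inLpB.
  have K0 : cintegral mu (fun z => (f z - lincomb E b z) * G z) = 0.
    pose M (x : 'I_n -> R[i]) i j z := (f z - lincomb E b z) * (u z ^+ (k.+1 - i) * lincomb E x z ^+ i *
      ((u z)^*%C ^+ (k.+2 - j) * (lincomb E x z)^*%C ^+ j)).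
    have intM x i j : (i <= 1)%N -> (j <= 1)%N -> cintegrable mu (M x i j).
      move=> i1 j1; apply: cintegrable_monomial => //.
      by rewrite !subnK ?(leq_trans i1)// ?(leq_trans j1)// -addnn addnA add1n.
    (* The three terms of [psi] turn [G] into polarised coefficients of indices (1, 1), (1, 0) and
       (0, 1). Index (1, 1) uses one of the [k + 1] factors [u] of the functional: here the exponent
       has to exceed 2. *)
    have -> : (fun z => (f z - lincomb E b z) * G z) =
       (fun z => M a' 1 1 z + - 2^-1 * (M c 1 0 z + M c 0 1 z)).
      apply/funext => z; rewrite /G psiE /M !subn1 !subn0 /= !expr0 !expr1.
      by rewrite !exprSr; ring.
    have int2 : cintegrable mu (fun z => M c 1 0 z + M c 0 1 z).
      by apply: cintegrable_fD; exact: intM.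
    rewrite cintegral_fD ?cintegral_fZ ?cintegral_fD//; try exact: intM.
    - by rewrite !bP// addr0 mulr0 addr0.
    - exact: cintegrable_fZ.
  have -> : (fun z => f z * G z) =
      (fun z => (f z - lincomb E b z) * G z + \sum_i b i * (E i z * G z)).
    apply/funext => z; rewrite mulrBl.
    have -> : \sum_i b i * (E i z * G z) = lincomb E b z * G z.
      by rewrite /lincomb mulr_suml; apply: eq_bigr => i _; rewrite mulrA.
    by rewrite subrK.
  have intS : cintegrable mu (fun z => \sum_i b i * (E i z * G z)).
    by apply: cintegrable_sum => i; apply/cintegrable_fZ/intG.
  rewrite cintegral_fD ?K0 ?add0r//; last exact: intG.
  rewrite cintegral_sum; last by move=> i; apply/cintegrable_fZ/intG.
  by rewrite big1// => i _; rewrite cintegral_fZ ?GE ?mulr0//; exact: intG.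
exists c.
(* A further factor [u] makes [G] real; testing on [u z ^ j] then gives the Fourier coefficients of
   this real function. *)
have Gu z : u z * G z = (normc (u z) ^+ k.+1.*2 * psi z)%:C%C.
  rewrite RtoCM /G -mul2n exprM RtoCX -mul_conjc exprMn [u z ^+ k.+1]exprS.
  by ring.
have unif : {ae mu, forall z, normc (u z) ^+ k.+1.*2 * psi z = 0}.
  apply: fourier_uniqueness.
    by have [] := intG _ (LL a); under eq_fun do rewrite Gu.
  move=> j; rewrite -[RHS](G0 _ (inHp_mulX j (inHp_lincomb p1 CF a))).
  by congr cintegral; apply/funext => z; rewrite -Gu mulrAC.
apply: filterS2 (lincomb_neq0 p1 CF an0) unif => z uz /eqP.
rewrite mulf_eq0 expf_eq0/= normc_eq0 (negbTE uz) /= => /eqP.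
by rewrite /psi => /eqP; rewrite subr_eq0 => /eqP.
Qed.

End RealPart.
End EvenExponent.

(** * Proportionality of the squared moduli *)

Section EvenExponentRatio.
Variable R : realType.
Variable k : nat.
Local Notation p := (@GRing.natmul R 1 k.+2.*2).
Local Notation mu := (@arc_length R).
Variable n : nat.
Variable E : 'I_n -> circle R -> R[i].
Hypothesis CF : contractive_family p E.

Let p1 : 1 <= p. Proof. by rewrite ler1n. Qed.

Let EL i : inLp p (E i). Proof. by have [/(_ i)[]] := CF. Qed.
Let LL a : inLp p (lincomb E a). Proof. exact: (inLp_lincomb p1 CF). Qed.

Let cint2 f g : inLp p f -> inLp p g -> cintegrable mu (fun z => f z * (g z)^*%C).
Proof.
move=> Lf Lg; apply: (Lp_degree_cintegrable (m := k.+2.*2) erefl).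
apply: (@Lp_degree_le _ _ p1 (1 + 1)); first by rewrite -addnn addnS addSn.
exact: (Lp_degreeM p1 (Lp_degree1 Lf) (Lp_degree_conj (Lp_degree1 Lg))).
Qed.

Let cint2g (h : circle R -> R) B f g : measurable_fun setT h -> (forall z, `|h z| <= B) ->
  inLp p f -> inLp p g -> cintegrable mu (fun z => f z * (g z)^*%C * (h z)%:C%C).
Proof.
move=> mh hB Lf Lg; apply: (@cintegrable_bounded _ _ _ _ _ _ B); first exact: cint2.
  exact: cmeasurable_real.
by move=> z; rewrite normc_real.
Qed.

Let norm2 (f : circle R -> R[i]) z : f z * (f z)^*%C = (normc (f z) ^+ 2)%:C%C :> R[i].
Proof. exact: mul_conjc. Qed.

Let rint2 f : inLp p f -> rintegrable mu (fun z => normc (f z) ^+ 2).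
Proof. by move=> Lf; have [+ _] := cint2 Lf Lf; under eq_fun do rewrite norm2. Qed.

Let int_norm2_gt0 a : (exists i, a i != 0) -> 0 < \int[mu]_z normc (lincomb E a z) ^+ 2.
Proof.
move=> an0; rewrite lt0r Rintegral_ge0 ?andbT; last by move=> z _; exact: sqr_ge0.
apply/eqP => h0; have [i ai] := an0.
have := Rintegral_ge0_eq0 (rint2 (LL a)) (fun z => sqr_ge0 _) h0.
move=> h; have [_ ind _] := CF; move/eqP: ai; apply; apply: ind.
by apply: filterS h => z /(_ I)/= /eqP; rewrite expf_eq0/= normc_eq0 => /eqP.
Qed.

Let sum_int (h : circle R -> R) B a f : measurable_fun setT h -> (forall z, `|h z| <= B) ->
  inLp p f -> cintegral mu (fun z => lincomb E a z * (f z)^*%C * (h z)%:C%C) =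
    \sum_i a i * cintegral mu (fun z => E i z * (f z)^*%C * (h z)%:C%C).
Proof.
move=> mh hB Lf.
have -> : (fun z => lincomb E a z * (f z)^*%C * (h z)%:C%C) =
    (fun z => \sum_i a i * (E i z * (f z)^*%C * (h z)%:C%C)).
  by apply/funext => z; rewrite /lincomb !mulr_suml; apply: eq_bigr => i _; rewrite !mulrA.
have ci i : cintegrable mu (fun z => E i z * (f z)^*%C * (h z)%:C%C) by exact: (cint2g mh hB).
rewrite cintegral_sum; last by move=> i; exact: cintegrable_fZ.
by apply: eq_bigr => i _; rewrite cintegral_fZ.
Qed.

(* An eigenvector of the compression to the span of the multiplication by [h]. *)
Lemma critical_vector (h : circle R -> R) B : (0 < n)%N -> measurable_fun setT h ->
  (forall z, `|h z| <= B) -> exists a (l : R), (exists i, a i != 0) /\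
  forall c, cintegral mu (fun z => lincomb E a z * (lincomb E c z)^*%C * (h z - l)%:C%C) = 0.
Proof.
move=> n0 mh hB.
(* The Gram form is the case where the multiplier is 1; the same computations then serve both
   forms. *)
pose one := fun _ : circle R => (1 : R).
have mone : measurable_fun setT one by exact: measurable_cst.
have oneB z : `|one z| <= 1 by rewrite normr1.
have oneE z (x : R[i]) : x * (one z)%:C%C = x by exact: mulr1.
pose A : 'M[R[i]]_n := \matrix_(i, j) cintegral mu (fun z => E i z * (E j z)^*%C * (h z)%:C%C).
pose M : 'M[R[i]]_n := \matrix_(i, j) cintegral mu (fun z => E i z * (E j z)^*%C * (one z)%:C%C).
have rowA (v : 'rV_n) j : (v *m A) ord0 j =
    cintegral mu (fun z => lincomb E (fun i => v ord0 i) z * (E j z)^*%C * (h z)%:C%C).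
  by rewrite (sum_int _ mh hB (EL j)) mxE; apply: eq_bigr => i _; rewrite mxE.
have rowM (v : 'rV_n) j : (v *m M) ord0 j =
    cintegral mu (fun z => lincomb E (fun i => v ord0 i) z * (E j z)^*%C * (one z)%:C%C).
  by rewrite (sum_int _ mone oneB (EL j)) mxE; apply: eq_bigr => i _; rewrite mxE.
have sesq (u : circle R -> R) C a c : measurable_fun setT u -> (forall z, `|u z| <= C) ->
    cintegral mu (fun z => lincomb E a z * (lincomb E c z)^*%C * (u z)%:C%C) =
    \sum_j (c j)^*%C * cintegral mu (fun z => lincomb E a z * (E j z)^*%C * (u z)%:C%C).
  move=> mu_ uC.
  have -> : (fun z => lincomb E a z * (lincomb E c z)^*%C * (u z)%:C%C) =
     (fun z => \sum_j (c j)^*%C * (lincomb E a z * (E j z)^*%C * (u z)%:C%C)).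
    apply/funext => z; rewrite [X in _ * X * _]conjc_sum mulr_sumr mulr_suml.
    by apply: eq_bigr => j _; rewrite conjcM; ring.
  have ci j : cintegrable mu (fun z => lincomb E a z * (E j z)^*%C * (u z)%:C%C).
    exact: (cint2g mu_ uC).
  rewrite cintegral_sum; last by move=> j; exact: cintegrable_fZ.
  by apply: eq_bigr => j _; rewrite cintegral_fZ.
have unitM : M \in unitmx.
  rewrite -row_free_unit -kermx_eq0; apply/rowV0P => v /sub_kermxP vM.
  apply: contrapT => /eqP/rV0Pn[i vi].
  have an0 : exists i, v ord0 i != 0 by exists i.
  have e b : (fun z => lincomb E b z * (lincomb E b z)^*%C * (one z)%:C%C) =
      (fun z => (normc (lincomb E b z) ^+ 2)%:C%C).
    by apply/funext => z; rewrite oneE norm2.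
  have : cintegral mu (fun z => lincomb E (v ord0) z * (lincomb E (v ord0) z)^*%C * (one z)%:C%C) = 0.
    rewrite (sesq _ _ _ _ mone oneB) big1// => j _.
    by rewrite -rowM vM mxE mulr0.
  rewrite e cintegral_real => -[h0].
  by have := int_norm2_gt0 an0; rewrite h0 ltxx.
(* The basis is not orthonormal, so the eigenvalue problem is relative to the Gram matrix [M]:
   [v A = l v M]. *)
have [l /eigenvalueP[v vA vn0]] := eigenvalue_closed (A *m invmx M) n0.
have {}vA : v *m A = l *: (v *m M).
  by have := congr1 (mulmx^~ M) vA; rewrite mulmxA mulmxKV// scalemxAl.
have an0 : exists i, v ord0 i != 0 by move/rV0Pn: vn0.
pose a i := v ord0 i.
have vAj j : cintegral mu (fun z => lincomb E a z * (E j z)^*%C * (h z)%:C%C) =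
    l * cintegral mu (fun z => lincomb E a z * (E j z)^*%C * (one z)%:C%C).
  by rewrite -rowA -rowM vA mxE.
have hl c : cintegral mu (fun z => lincomb E a z * (lincomb E c z)^*%C * (h z)%:C%C) =
    l * cintegral mu (fun z => lincomb E a z * (lincomb E c z)^*%C * (one z)%:C%C).
  rewrite (sesq _ _ _ _ mh hB) (sesq _ _ _ _ mone oneB) mulr_sumr; apply: eq_bigr => j _.
  by rewrite vAj mulrCA.
(* Paired with the eigenvector itself, the form of [h] is real and the Gram form is positive. *)
have lreal : l = (Re l)%:C%C.
  have N0 := int_norm2_gt0 an0; set N := \int[mu]_z _ in N0.
  have := hl a.
  have -> : (fun z => lincomb E a z * (lincomb E a z)^*%C * (one z)%:C%C) =
      (fun z => (normc (lincomb E a z) ^+ 2)%:C%C).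
    by apply/funext => z; rewrite oneE norm2.
  have -> : (fun z => lincomb E a z * (lincomb E a z)^*%C * (h z)%:C%C) =
      (fun z => (normc (lincomb E a z) ^+ 2 * h z)%:C%C).
    by apply/funext => z; rewrite norm2 -RtoCM.
  rewrite !cintegral_real -/N => e; apply: complexP => //=.
  have := congr1 (fun x => Im x) e; rewrite mulrC ImZ /= => /esym/eqP.
  by rewrite mulf_eq0 (gt_eqF N0) /= => /eqP.
exists a, (Re l); split => // c.
have -> : (fun z => lincomb E a z * (lincomb E c z)^*%C * (h z - Re l)%:C%C) =
  (fun z => lincomb E a z * (lincomb E c z)^*%C * (h z)%:C%C +
     - l * (lincomb E a z * (lincomb E c z)^*%C * (one z)%:C%C)).
  by apply/funext => z; rewrite RtoCB -lreal /one; ring.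
have c1 : cintegrable mu (fun z => lincomb E a z * (lincomb E c z)^*%C * (one z)%:C%C).
  exact: (cint2g mone oneB).
rewrite cintegral_fD ?cintegral_fZ//; last 2 first.
- exact: (cint2g mh hB).
- exact: cintegrable_fZ.
by rewrite hl mulNr subrr.
Qed.

(** Since [l] depends on [h] alone, the difference [phi] of the two sides is orthogonal to every
    bounded [h]. The real and imaginary parts of [z ^ j] are such multipliers, so the Fourier
    coefficients of [phi] vanish. *)
Lemma norm_sqr_ratio (i0 : 'I_n) a :
  {ae mu, forall z, normc (lincomb E a z) ^+ 2 * \int[mu]_z normc (E i0 z) ^+ 2 =
    normc (E i0 z) ^+ 2 * \int[mu]_z normc (lincomb E a z) ^+ 2}.
Proof.
have n0 : (0 < n)%N by exact: leq_ltn_trans (leq0n i0) (ltn_ord i0).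
have key (h : circle R -> R) B : measurable_fun setT h -> (forall z, `|h z| <= B) ->
    exists l, forall b, \int[mu]_z (normc (lincomb E b z) ^+ 2 * h z) =
      l * \int[mu]_z normc (lincomb E b z) ^+ 2.
  move=> mh hB; have [a0 [l [an0 al]]] := critical_vector n0 mh hB.
  exists l => b; have [c cP] := norm_sqr_real_part CF b an0.
  have mB : measurable_fun setT (fun z => h z - l) by apply: measurable_funB.
  have hlB z : `|h z - l| <= B + `|l| by rewrite (le_trans (ler_normB _ _))// lerD2r.
  have e0 : \int[mu]_z (normc (lincomb E b z) ^+ 2 * (h z - l)) = 0.
    have i1 := cint2g mB hlB (LL c) (LL a0).
    have := congr1 (fun x => Re x) (al c); rewrite Re_cintegral [Re 0]/=.
    move=> h0; rewrite -[RHS]h0; apply: Rintegral_ae.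
    - apply: measurable_funM => //; exact: rintegrable_measurable (rint2 (LL b)).
    - by have [] := cintegrable_measurable (cint2g mB hlB (LL a0) (LL c)).
    - apply: filterS cP => z cz _; rewrite cz mulrC -ReZ -[RHS]Re_conj !conjcM !conjcK conjc_real.
      by congr Re; ring.
  have iN := rint2 (LL b).
  have ih : rintegrable mu (fun z => normc (lincomb E b z) ^+ 2 * h z).
    exact: (rintegrable_bounded iN mh hB).
  have := e0; have -> : (fun z => normc (lincomb E b z) ^+ 2 * (h z - l)) =
     (fun z => normc (lincomb E b z) ^+ 2 * h z - l * normc (lincomb E b z) ^+ 2).
    by apply/funext => z; ring.
  rewrite RintegralB//; last exact: rintegrableZ.
  by rewrite RintegralZl// => /eqP; rewrite subr_eq0 => /eqP.
pose d := fun j : 'I_n => ((j == i0)%:R : R[i]).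
have dE z : lincomb E d z = E i0 z by exact: lincomb_delta.
set N0 := \int[mu]_z normc (E i0 z) ^+ 2; set Na := \int[mu]_z normc (lincomb E a z) ^+ 2.
pose phi z := normc (lincomb E a z) ^+ 2 * N0 - normc (E i0 z) ^+ 2 * Na.
have i0int := rint2 (EL i0); have aint := rint2 (LL a).
have phi0 (h : circle R -> R) B : measurable_fun setT h -> (forall z, `|h z| <= B) ->
    \int[mu]_z (phi z * h z) = 0.
  move=> mh hB; have [l lP] := key h B mh hB.
  have -> : (fun z => phi z * h z) = (fun z => N0 * (normc (lincomb E a z) ^+ 2 * h z) -
      Na * (normc (E i0 z) ^+ 2 * h z)) by apply/funext => z; rewrite /phi; ring.
  have ia : rintegrable mu (fun z => normc (lincomb E a z) ^+ 2 * h z).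
    exact: (rintegrable_bounded aint mh hB).
  have ii : rintegrable mu (fun z => normc (E i0 z) ^+ 2 * h z).
    exact: (rintegrable_bounded i0int mh hB).
  rewrite RintegralB ?RintegralZl//; try exact: rintegrableZ.
  have := lP d; under eq_Rintegral do rewrite dE; move=> ->.
  under [X in l * X]eq_Rintegral do rewrite dE.
  by rewrite lP -/N0 -/Na; ring.
have iphi : rintegrable mu phi.
  apply: rintegrableB; under eq_fun do rewrite mulrC; exact: rintegrableZ.
have := @fourier_uniqueness R phi iphi; case=> [j|N [mN N00 sN]].
  have [m1 m2] := cmeasurable_valX R j.
  apply: complexP; rewrite ?Re_cintegral ?Im_cintegral /=.
    under eq_Rintegral do rewrite ReZ.
    apply: (phi0 _ 1 m1) => z; rewrite -(normc_circleX z j); exact: ler_Re_normc.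
  under eq_Rintegral do rewrite ImZ.
  apply: (phi0 _ 1 m2) => z; rewrite -(normc_circleX z j); exact: ler_Im_normc.
exists N; split => // z nz; apply: sN => /= h0; apply: nz.
by move/eqP: h0; rewrite /phi subr_eq0 => /eqP.
Qed.

(* The moduli of [E i1], [E i0 + E i1] and [E i0 + 'i E i1] are multiples of that of [E i0],
   so that [E i1 / E i0] is constant. *)
Lemma contractive_family_even_dim1 (i0 i1 : 'I_n) : i0 = i1.
Proof.
apply: contrapT => /eqP i01.
have N0 : 0 < \int[mu]_z normc (E i0 z) ^+ 2.
  have := @int_norm2_gt0 (fun j => (j == i0)%:R); rewrite (_ : (fun _ => _) =
    (fun z => normc (E i0 z) ^+ 2)); last by apply/funext => z; rewrite lincomb_delta.
  by apply; exists i0; rewrite eqxx oner_neq0.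
have ratio (s t : R[i]) : exists r : R,
    {ae mu, forall z, normc (s * E i0 z + t * E i1 z) ^+ 2 = r * normc (E i0 z) ^+ 2}.
  have h := norm_sqr_ratio i0 (fun j => s * (j == i0)%:R + t * (j == i1)%:R).
  have e z : lincomb E (fun j => s * (j == i0)%:R + t * (j == i1)%:R) z = s * E i0 z + t * E i1 z.
    rewrite (lincombD E (fun j => s * (j == i0)%:R) (fun j => t * (j == i1)%:R)).
    by rewrite !lincombZ !lincomb_delta.
  exists (\int[mu]_z normc (lincomb E (fun j => s * (j == i0)%:R + t * (j == i1)%:R) z) ^+ 2 /
    \int[mu]_z normc (E i0 z) ^+ 2).
  apply: filterS h => z; rewrite e => h.
  by apply: (mulIf (lt0r_neq0 N0)); rewrite h [RHS]mulrAC mulfVK ?(lt0r_neq0 N0)// mulrC.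
have [r1 h1] := ratio 0 1; have [r2 h2] := ratio 1 1; have [r3 h3] := ratio 1 'i%C.
have n0 := basis_ae_neq0 p1 CF i0.
(* The only possible value of [m = E i1 / E i0], from [|m| ^ 2 = r1], [|1 + m| ^ 2 = r2] and
   [|1 + i m| ^ 2 = r3], where the last expands to [1 - 2 Im m + r1]. *)
pose c : R[i] := Complex ((r2 - 1 - r1) / 2) (- (r3 - 1 - r1) / 2).
have hc := basis_ratio_ae_neq p1 CF i01 c.
have [z [[z1 [z2 z3]] [z0 zc]]] : exists z,
    (normc (0 * E i0 z + 1 * E i1 z) ^+ 2 = r1 * normc (E i0 z) ^+ 2 /\
     normc (1 * E i0 z + 1 * E i1 z) ^+ 2 = r2 * normc (E i0 z) ^+ 2 /\
     normc (1 * E i0 z + 'i%C * E i1 z) ^+ 2 = r3 * normc (E i0 z) ^+ 2) /\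
    (E i0 z != 0 /\ E i1 z / E i0 z != c).
  apply: (ae_exists (arc_length_neq0 R)); apply: filterS2.
  - by move=> z H1 H2; split; [exact: H1|exact: H2].
  - by apply: filterS3 h1 h2 h3.
  - by apply: filterS2 n0 hc.
move/eqP: zc; apply; apply: (mulIf z0); rewrite mulfVK//.
have J0 : ((E i0 z)^*%C : R[i]) != 0 by rewrite conjc_eq0.
have iE (x : R[i]) : (Re ('i%C * x) = - Im x) * (Im ('i%C * x) = Re x).
  by rewrite [_ * x]mulrC ReiNIm ImiRe.
move: z1 z2 z3; rewrite mul0r add0r !mul1r !normc_sqr !(ReD, ImD, iE).
move=> z1 z2 z3; apply: (mulfI J0); rewrite mulrCA [_ * E i0 z]mulrC norm2 [c * _]mulrC.
apply: complexP; rewrite ?ReZ ?ImZ normc_sqr /c ?ReM ?ImM Re_conj Im_conj /=; lra.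
Qed.

End EvenExponentRatio.

(** * From classes in [H_p] to functions on the circle *)

Section HardyFunctions.
Local Open Scope quotient_scope.
Variables (R : realType) (p : R) (p1 : 1 <= p).
Local Notation mu := (@arc_length R).
Local Notation Lp := (cLp mu p1).
Local Notation fn f := (cLp_fun (val f)).
Implicit Types (f g : Hardy p1).

Let p_gt0 : 0 < p. Proof. exact: lt_le_trans p1. Qed.

Lemma cLnorm_powR (f : circle R -> R[i]) :
  (cLnorm mu p f `^ p = \int[mu]_z (normc (f z) `^ p)%:E)%E.
Proof.
have p0 : p != 0 by rewrite gt_eqF.
have := @powR_Lnorm _ _ R mu (EFin \o (fun z => normc (f z))) p p0.
move=> ->; apply: eq_integral => z _.
by rewrite /= ger0_norm ?normc_ge0.
Qed.

Lemma inLp_cLfun (f : circle R -> R[i]) : inLp p f <-> (f : circle R -> R[i]^o) \in cLfun mu p1.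
Proof.
have intE : cmeasurable f ->
    (\int[mu]_z `|(normc (f z) `^ p)%:E| = cLnorm mu p f `^ p)%E.
  move=> mf; rewrite cLnorm_powR; apply: eq_integral => z _.
  by rewrite /= ger0_norm ?powR_ge0.
split=> [[mf /integrableP[_]]|/cLfunP[mf fy]].
  rewrite (intE mf) => fy; apply/cLfunP; split=> //.
  rewrite ltNge; apply/negP; rewrite leye_eq => /eqP e.
  by move: fy; rewrite e poweRyr ?gt_eqF.
split=> //; apply/integrableP; split.
  exact/measurable_EFinP/measurable_normc_powR.
by rewrite (intE mf) poweR_lty.
Qed.

Lemma cLp_norm_powR (q : Lp) :
  \int[mu]_z normc (cLp_fun q z) `^ p = (fine (cLnorm mu p (cLp_fun q))) `^ p.
Proof.
rewrite /Rintegral -cLnorm_powR; have [_ qy] := cLp_funP q.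
have : cLnorm mu p (cLp_fun q) \is a fin_num by rewrite ge0_fin_numE ?cLnorm_ge0.
by move=> /fineK {1}<-; rewrite poweR_EFin.
Qed.

Lemma Hardy_norm_le f g : `|f| <= `|g| ->
  \int[mu]_z normc (fn f z) `^ p <= \int[mu]_z normc (fn g z) `^ p.
Proof.
rewrite !cLp_norm_powR => fg.
apply: ge0_ler_powR; first exact: ltW.
- by rewrite nnegrE fine_ge0// cLnorm_ge0.
- by rewrite nnegrE fine_ge0// cLnorm_ge0.
- by rewrite -lecR.
Qed.

Lemma Hardy_eq0 f : {ae mu, forall z, fn f z = 0} -> f = 0.
Proof.
move=> f0; apply: normr0_eq0; rewrite -[`|f|]/((fine (cLnorm mu p (fn f)))%:C%C).
have : \int[mu]_z normc (fn f z) `^ p = 0.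
  rewrite (@Rintegral_ae _ _ _ mu _ (fun=> 0)).
  - by rewrite Rintegral_cst// mul0r.
  - by apply: measurable_normc_powR; case: (cLp_funP (val f)).
  - exact: measurable_cst.
  - by apply: filterS f0 => z -> _; rewrite [normc 0](normc0 R) powR0 ?gt_eqF.
by rewrite cLp_norm_powR => /powR_eq0_eq0 ->.
Qed.

Lemma inHp_Hardy f : inHp p (fn f).
Proof.
split; first exact/inLp_cLfun/cLp_fun_mem.
by have /hardyP := valP f.
Qed.

Lemma Hardy_of_inHp (h : circle R -> R[i]) : inHp p h ->
  exists f, {ae mu, forall z, fn f z = h z}.
Proof.
move=> [Lh Hh]; have /inLp_cLfun Lh' := Lh.
pose h' : cLfunType mu p1 := exist _ (h : circle R -> R[i]^o) Lh'.
pose q : Lp := \pi_(cLp mu p1) h'.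
have qh : {ae mu, forall z, cLp_fun q z = h z}.
  by have := cLp_fun_pi h'; apply: filterS => z /(_ I).
have Hq : q \in hardy p1.
  apply/hardyP => n n1; rewrite -[RHS](Hh n n1); apply: cintegral_aeE.
  - by apply: cmeasurable_mulz; case: (cLp_funP q).
  - by apply: cmeasurable_fM; [case: Lh|exact: cmeasurable_valX].
  - by apply: filterS qh => z; rewrite /mulz => ->.
by exists (exist _ q Hq).
Qed.

Lemma Hardy_funD f g : {ae mu, forall z, fn (f + g) z = fn f z + fn g z}.
Proof. by have := cLp_funD (val f) (val g); apply: filterS => z /(_ I). Qed.

Lemma Hardy_funZ a f : {ae mu, forall z, fn (a *: f) z = a * fn f z}.
Proof. by have := cLp_funZ a (val f); apply: filterS => z /(_ I). Qed.

Lemma Hardy_fun_sum n (e : 'I_n -> Hardy p1) (a : 'I_n -> R[i]) :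
  {ae mu, forall z, fn (\sum_i a i *: e i) z = lincomb (fun i => fn (e i)) a z}.
Proof.
rewrite /lincomb; elim: (index_enum _) => [|i s ih].
  have := Hardy_funZ 0 0; apply: filterS => z.
  by rewrite scale0r !big_nil mul0r.
rewrite big_cons; apply: filterS3 (Hardy_funD (a i *: e i) (\sum_(j <- s) a j *: e j))
  (Hardy_funZ (a i) (e i)) ih => z h1 h2 h3.
by rewrite big_cons h1 h2 h3.
Qed.

(** [P] maps [x + t (f - P f)] to [x], and contractivity compares their norms. Choosing
    representatives is linear only almost everywhere, so the inequality is carried over to functions
    through the integrals. *)
Lemma contractive_family_of_projection n (e : 'I_n -> Hardy p1) (P : {linear Hardy p1 -> Hardy p1}) :
  (forall a : 'I_n -> R[i], \sum_i a i *: e i = 0 -> forall i, a i = 0) ->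
  (forall v, P (P v) = P v) -> (forall v, `|P v| <= `|v|) ->
  range P = range (fun a : 'I_n -> R[i] => \sum_i a i *: e i) ->
  contractive_family p (fun i => fn (e i)).
Proof.
move=> ind PP Ple rP; split.
- by move=> i; exact: inHp_Hardy.
- move=> a a0; apply: ind; apply: Hardy_eq0.
  by apply: filterS2 (Hardy_fun_sum e a) a0 => z -> ->.
- move=> h Hh; have [f fh] := Hardy_of_inHp Hh.
  have [b _ bP] : range (fun a : 'I_n -> R[i] => \sum_i a i *: e i) (P f).
    by rewrite -rP; exists f.
  exists b => a t; set x := \sum_i a i *: e i.
  have Px : P x = x.
    have [y _ <-] : range P x by rewrite rP; exists a.
    exact: PP.
  have mn : `|x| <= `|x + t *: (f + (-1) *: P f)|.
    have Pw : P (x + t *: (f + (-1) *: P f)) = x.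
      by rewrite linearD linearZ linearD linearZ /= PP Px scaleN1r subrr scaler0 addr0.
    by have := Ple (x + t *: (f + (-1) *: P f)); rewrite Pw.
  have xa := Hardy_fun_sum e a.
  have ya : {ae mu, forall z, fn (x + t *: (f + (-1) *: P f)) z =
      lincomb (fun i => fn (e i)) a z + t * (h z - lincomb (fun i => fn (e i)) b z)}.
    have H1 := Hardy_funD x (t *: (f + (-1) *: P f)).
    have H2 := Hardy_funZ t (f + (-1) *: P f).
    have H3 := Hardy_funD f ((-1) *: P f).
    have H4 := Hardy_funZ (-1) (P f).
    have H5 := Hardy_fun_sum e b; rewrite bP in H5.
    have H12 : {ae mu, forall z, fn (x + t *: (f + (-1) *: P f)) z =
      fn x z + t * fn (f + (-1) *: P f) z} by apply: filterS2 H1 H2 => z -> ->.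
    have H34 : {ae mu, forall z, fn (f + (-1) *: P f) z = h z - lincomb (fun i => fn (e i)) b z}.
      have H45 : {ae mu, forall z, fn ((-1) *: P f) z = - lincomb (fun i => fn (e i)) b z}.
        by apply: filterS2 H4 H5 => z -> ->; rewrite mulN1r.
      by apply: filterS3 H3 fh H45 => z -> -> ->.
    by apply: filterS3 H12 H34 xa => z -> -> ->.
  have mfn (g : Hardy p1) : measurable_fun setT (fun z => normc (fn g z) `^ p).
    by apply: measurable_normc_powR; case: (cLp_funP (val g)).
  have HE i : inLp p (fn (e i)) by case: (inHp_Hardy (e i)).
  have Llin c : inLp p (lincomb (fun i => fn (e i)) c).
    by apply: inLp_sum => // i; exact: inLpZ.
  have mL : measurable_fun setT (fun z => normc (lincomb (fun i => fn (e i)) a z) `^ p).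
    by apply: measurable_normc_powR; case: (Llin a).
  have mR : measurable_fun setT (fun z => normc (lincomb (fun i => fn (e i)) a z +
      t * (h z - lincomb (fun i => fn (e i)) b z)) `^ p).
    apply: measurable_normc_powR; apply: cmeasurable_fD; first by case: (Llin a).
    apply: cmeasurable_fM; first exact: cmeasurable_cst.
    by apply: (inLpB p1 _ (Llin b)).1; case: Hh.
  have eL : \int[mu]_z normc (fn x z) `^ p =
      \int[mu]_z normc (lincomb (fun i => fn (e i)) a z) `^ p.
    by apply: (Rintegral_ae (mfn x) mL); apply: filterS xa => z -> _.
  have eR : \int[mu]_z normc (fn (x + t *: (f + (-1) *: P f)) z) `^ p =
      \int[mu]_z normc (lincomb (fun i => fn (e i)) a z +
        t * (h z - lincomb (fun i => fn (e i)) b z)) `^ p.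
    by apply: (Rintegral_ae (mfn _) mR); apply: filterS ya => z -> _.
  by have := Hardy_norm_le mn; rewrite eL eR.
Qed.

End HardyFunctions.

Theorem theorem3p1 (R : realType) (p : R) (p1 : 1 <= p) (p2 : p != 2) :
  ~ exists (Y : set (Hardy p1)) (n : nat),
      [/\ (1 < n)%N, has_dim Y n & one_complemented Y].
Proof.
move=> [Y [n [n1 [e [ind YE]] [_ _ [P [PP Ple rP]]]]]].
have CF := contractive_family_of_projection ind PP Ple (etrans rP YE).
pose i0 := Ordinal (ltnW n1); pose i1 := Ordinal n1.
have i01 : i0 != i1 by [].
have [k pk] := contractive_family_even p1 CF i01.
(* The values 0 and 1 of [k] would give [p = 0] and [p = 2]. *)
case: k pk => [|[|k]] pk.
- by have := p1; rewrite pk ler10.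
- by have := p2; rewrite pk eqxx.
(* The type of [e] depends on [p]; abstracting the family of functions lets [p] be rewritten. *)
- have [E] : exists E : 'I_n -> circle R -> R[i], contractive_family p E by eexists; exact: CF.
  by rewrite pk => /contractive_family_even_dim1 /(_ i0 i1)/eqP; rewrite (negbTE i01).
Qed.
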